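(* Let $M=M(i,l,s,\epsilon)$ be a non-projective indecomposable $\mathbb{F}[G]$-module. Let $a$ be the integer assigned to $(i,l,s,\epsilon)$ by the rule and case table given in the context. For $0\le c\le p-2$ put $$\kappa_c=\Theta_{i,l,s,1}\,\theta_{0,1,c}+\sum_{t=2}^{p-1}\Theta_{i,l,s,t}\,\theta_{p-t,t,c}-\theta_{a,L_i(l,s),c}$$ and $$n_{c,p}=\begin{cases}0&\text{if } c\not\equiv i\pmod 2,\\ \sum_{j=1}^{(p-1)/2}\delta_{(c+2-i)/2,\,j}\cdot\kappa_{i+2(j-1)}&\text{otherwise.}\end{cases}$$ Then $$\mathrm{Res}^G_B(M)\cong U_{a,L_i(l,s)}\oplus\bigoplus_{c=0}^{p-2}U_{c,p}^{\oplus n_{c,p}}.$$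
   Context: Let $p$ be an odd prime, $\mathbb{F}$ an algebraically closed field of characteristic $p$, $G=SL_2(\mathbb{F}_p)$ and $B\le G$ the subgroup of upper triangular matrices. All modules are finite-dimensional right modules. Let $\zeta$ be a generator of $\mathbb{F}_p^\times$, $g=\begin{pmatrix}1&1\\0&1\end{pmatrix}$ and $\lambda=\begin{pmatrix}\zeta&0\\0&\zeta^{-1}\end{pmatrix}$, so $B=\langle g,\lambda\rangle$. For $a\in\mathbb{Z}$, $S_a$ is the one-dimensional $\mathbb{F}[B]$-module on which $g$ acts trivially and $\lambda$ acts as $\zeta^a$. For $1\le b\le p$, $U_{a,b}$ is the (unique up to isomorphism) uniserial $\mathbb{F}[B]$-module of dimension $b$ whose composition factors, from the socle upwards, are $S_a,S_{a+2},S_{a+4},\dots$. These are all the indecomposable $\mathbb{F}[B]$-modules; $U_{a,b}$ is projective iff $b=p$. For $0\le c\le p-2$, $\theta_{a,b,c}$ is the multiplicity of $S_c$ as a composition factor of $U_{a,b}$; explicitly $\theta_{a,b,c}=0$ if $a\not\equiv c\pmod 2$ and otherwise $\theta_{a,b,c}=\left\lfloor\frac{2(b-1)+a-c}{p-1}\right\rfloor-\left\lceil\frac{a-c}{p-1}\right\rceil+1$. For $1\le t\le p$, $V_t\subset\mathbb{F}[x,y]$ is the space of homogeneous polynomials of degree $t-1$, with right action $x^iy^j\cdot\begin{pmatrix}\alpha&\beta\\\gamma&\delta\end{pmatrix}=(\alpha x+\beta y)^i(\gamma x+\delta y)^j$; these are the simple $\mathbb{F}[G]$-modules. The modules $M(i,l,s,\epsilon)$: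 $\mathbb{F}[G]$ has two non-semisimple blocks $\mathcal{B}_0,\mathcal{B}_1$, where $\mathcal{B}_i$ contains the simple modules $V_t$ with $1\le t\le p-1$, $t\not\equiv i\pmod 2$. The Brauer tree of $\mathcal{B}_i$ is a line with $(p-1)/2$ edges whose last vertex is exceptional of multiplicity $2$; counting from the other end, the $j$-th edge is $V_j$ if $j\not\equiv i\pmod 2$ and $V_{p-j}$ if $j\equiv i\pmod 2$. Let $(i,l,s,\epsilon)\in\{0,1\}\times\{0,\dots,\frac{p-3}{2}\}\times\{1,\dots,p-1\}\times\{-1,1\}$ with $l+s\le p-1$. It determines a walk $E_1,\dots,E_s$ of $s$ edges which starts at the $(l+1)$-th vertex of the tree of $\mathcal{B}_i$, goes towards the exceptional vertex, and turns back there once it has reached it; thus $E_k$ is edge number $\min(l+k,p-l-k)$, i.e. $E_k=V_{l+k}$ if $l+k\not\equiv i\pmod 2$ and $E_k=V_{p-l-k}$ otherwise. If $s=1$, $M(i,l,s,\epsilon)=E_1$ (independently of $\epsilon$). If $s\ge2$, let $D$ be the set of odd integers in $\{1,\dots,s\}$ if $\epsilon=1$ and the set of even ones if $\epsilon=-1$, and $D^c$ its complement. For $1\le k\le s-1$ let $M_k$ be the unique (up to isomorphism) uniserial $\mathbb{F}[G]$-module of length $2$ with top $E_k$ and socle $E_{k+1}$ if $k\in D$, and with top $E_{k+1}$ and socle $E_k$ if $k\notin D$. Let $\varphi_k$ be an epimorphism of $M_k$ onto its top and $\psi_k$ an embedding of its socle into $M_k$. Let $X$ be the set of $(m_1,\dots,m_{s-1})\in\bigoplus_k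 M_k$ with $\varphi_k(m_k)=\varphi_{k+1}(m_{k+1})$ in $E_{k+1}$ for all $k\in D^c$, $1\le k<s-1$, and $Y\subseteq X$ the submodule generated by the elements $(0,\dots,0,\psi_{k-1}(f),\psi_k(f),0,\dots,0)$ (entries in positions $k-1,k$) for $k\in D^c$, $2\le k\le s-1$, $f\in E_k$. Then $M(i,l,s,\epsilon)=X/Y$; up to isomorphism this is independent of the choices of $\varphi_k,\psi_k$. All non-projective indecomposable $\mathbb{F}[G]$-modules arise this way. $\Theta_{i,l,s,t}$ is the multiplicity of $V_t$ as a composition factor of $M(i,l,s,\epsilon)$ (it does not depend on $\epsilon$). The integer $L_i(l,s)$ is $$L_i(l,s)=\begin{cases}(1-i)p+(-1)^{i+1}\frac{2l+s+1}{2}&l,s\text{ odd},\\(1-i)p+(-1)^{i+1}\frac s2&l,s\text{ even},\\ ip+(-1)^i\frac s2&l\text{ odd},\ s\text{ even},\\ ip+(-1)^i\frac{2l+s+1}{2}&l\text{ even},\ s\text{ odd}.\end{cases}$$ The integer $a$: if $s=1$, then $a=0$ if $M=V_1$ and $a=p-L_i(l,s)$ if $M\ne V_1$. If $s\ge2$, form the tuple $(\mathrm{I},\mathrm{Lf},\mathrm{Sf},\mathrm{E},\Sigma)$, where $\mathrm{I}=i$; $\mathrm{Lf}=0$ if $l=0$, $1$ if $l$ is odd, $2$ if $l>0$ is even; $\mathrm{Sf}=0$ if $s$ is even, $1$ if $s$ is odd; $\mathrm{E}=\epsilon$; $\Sigma=0$ if $l+s\le(p-1)/2$, $1$ if $(p-1)/2<l+s<p-1$,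 $2$ if $l+s=p-1$. Then $a$ is read off from the following table, where $*$ means that any value can be taken: - $(0,0,*,-1,0)$, $(0,0,*,-1,1)$, $(0,0,0,*,2)$: $a=0$. - $(0,0,0,1,0)$, $(1,0,1,-1,0)$: $a=s$. - $(0,0,0,1,1)$, $(1,0,1,-1,1)$: $a=s$. - $(0,0,1,1,0)$, $(1,0,0,-1,0)$: $a=p-s$. - $(0,0,1,1,1)$, $(1,0,0,-1,1)$: $a=p-s$. - $(0,1,0,-1,0)$, $(0,2,1,1,0)$, $(1,1,1,1,0)$, $(1,2,0,-1,0)$: $a=p-l-s$. - $(0,1,0,-1,1)$, $(0,2,1,1,1)$, $(1,1,1,1,1)$, $(1,2,0,-1,1)$: $a=p-l-s$. - $(0,1,*,1,0)$, $(0,1,*,1,1)$, $(0,1,1,1,2)$, $(1,2,*,1,0)$, $(1,2,*,1,1)$, $(1,2,0,1,2)$: $a=l+1$. - $(0,1,1,-1,0)$, $(0,2,0,1,0)$, $(1,1,0,1,0)$, $(1,2,1,-1,0)$: $a=l+s$. - $(0,1,1,-1,1)$, $(0,2,0,1,1)$, $(1,1,0,1,1)$, $(1,2,1,-1,1)$: $a=l+s$. - $( *,1,1,-1,2)$, $(0,2,*,-1,0)$, $(0,2,*,-1,1)$, $(0,2,0,*,2)$, $(1,1,*,-1,0)$, $(1,1,*,-1,1)$: $a=p-1-l$. - $(1,0,0,*,2)$, $(1,0,*,1,0)$, $(1,0,*,1,1)$, $(1,1,1,1,2)$, $(1,2,0,-1,2)$: $a=1$. For $0\le r,j\le\frac{p-1}2$: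 $\delta_{r,j}=\frac{p-2}{p}$ if $r=j$ and $\delta_{r,j}=-\frac2p$ otherwise.
   Formalization: The table's entries for (0,1,1,-1,2) and (0,2,0,1,2), printed as a=p-1-l, are corrected to a=0: the printed values make the claim false, e.g. p=5, (i,l,s,ε)=(0,1,3,-1) gives a=3, of the wrong parity for the block; all else is as stated. *)

(* Defs.v *)
(* Modules are matrix representations: row vectors acted on from             *)
(* the right. The base field F is arbitrary of characteristic p here; it is   *)
(* a closedFieldType in the theorem.                                          *)
From mathcomp Require Import all_boot all_order all_algebra all_fingroup.
From mathcomp Require Import mxrepresentation character ring.
Set Implicit Arguments.
Unset Strict Implicit.
Unset Printing Implicit Defensive.
Import Order.TTheory GRing.Theory Num.Theory.
Local Open Scope ring_scope.

Section Modules.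
Variables (F : fieldType) (gT : finGroupType) (G : {group gT}).

Definition mxhom n1 n2 (rG1 : mx_representation F G n1)
    (rG2 : mx_representation F G n2) (f : 'M[F]_(n1, n2)) : Prop :=
  forall g, g \in G -> rG1 g *m f = f *m rG2 g.

Definition uniserial n (rG : mx_representation F G n) : Prop :=
  forall U V : 'M[F]_n, mxmodule rG U -> mxmodule rG V ->
    (U <= V)%MS \/ (V <= U)%MS.

(* The composition factors of some composition series of rG are, from the     *)
(* bottom upwards, the members of fs.                                         *)
Definition has_factors n (rG : mx_representation F G n)
    (fs : seq (representation F G)) : Prop :=
  exists (W : seq 'M[F]_n) (compW : mx_composition_series rG W),
    [/\ (last 0 W :=: 1%:M)%MS, size W = size fs
      & forall k, (k < size W)%N ->
          mx_rsim (series_repr k compW) (nth grepr0 fs k)].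

(* rS occurs m times among the factors of some composition series of rG; by   *)
(* Jordan-Holder m is determined by rG and rS.                                *)
Definition comp_mult n (rG : mx_representation F G n)
    nS (rS : mx_representation F G nS) (m : nat) : Prop :=
  exists (W : seq 'M[F]_n) (compW : mx_composition_series rG W)
         (A : {set 'I_(size W)}),
    [/\ (last 0 W :=: 1%:M)%MS,
        forall k : 'I_(size W),
          k \in A <-> mx_rsim (series_repr k compW) rS
      & #|A| = m].

Lemma dsum_mx_repr m (d : 'I_m -> nat)
    (r : forall j, mx_representation F G (d j)) :
  mx_repr G (fun g => \mxdiag_(j < m) r j g).
Proof.
split=> [|x y Gx Gy].
  by under eq_mxdiag => j do rewrite repr_mx1; rewrite mxdiagZ.
rewrite [X in _ *m X]/mxdiag mul_mxdiag_mxblock; apply: eq_mxblock => i j.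
by case: eqP => [->|]; rewrite ?conform_mx_id ?repr_mxM ?mulmx0.
Qed.

Definition dsum_repr m (d : 'I_m -> nat)
    (r : forall j, mx_representation F G (d j)) :=
  MxRepresentation (dsum_mx_repr r).

End Modules.

Section SL2.
Variable p : nat.
Local Notation gT := {'GL_2['F_p]}.

Definition SL2_set : {set gT} := [set x : gT | \det (GLval x) == 1].

Fact SL2_group_set : group_set SL2_set.
Proof.
apply/group_setP; split=> [|x y]; first by rewrite inE GL_1E det1.
by rewrite !inE GL_ME det_mulmx => /eqP-> /eqP->; rewrite mulr1.
Qed.
Canonical SL2 := Group SL2_group_set.

Definition borel_set : {set gT} :=
  [set x in SL2_set | GLval x 1 0 == 0].

Lemma mul2E (x y : gT) (i j : 'I_2) :
  GLval (x * y)%g i j = GLval x i 0 * GLval y 0 j + GLval x i 1 * GLval y 1 j.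
Proof.
rewrite GL_ME mxE !big_ord_recl big_ord0 addr0.
by congr (_ * _ + _ * _); congr (GLval _ _ _); apply: val_inj.
Qed.

Fact borel_group_set : group_set borel_set.
Proof.
apply/group_setP; split=> [|x y].
  by rewrite inE group1 GL_1E mxE.
rewrite inE => /andP[Gx /eqP x0]; rewrite inE => /andP[Gy /eqP y0].
by rewrite inE groupM // mul2E x0 y0 mul0r mulr0 addr0 eqxx.
Qed.
Canonical borel := Group borel_group_set.

Lemma borel_sub : borel \subset SL2.
Proof. by apply/subsetP => x; rewrite inE => /andP[]. Qed.


Section Reps.
Variables (F : fieldType) (chF : p \in [pchar F]).

(* The embedding of 'F_p into F.                                              *)
Definition embF (x : 'F_p) : F := (x : nat)%:R.

Lemma natr_mod_eq m k : m = p -> (k %% m)%:R = k%:R :> F.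
Proof. by move->; apply: GRing.natr_mod_pchar. Qed.

Lemma embFD x y : embF (x + y) = embF x + embF y.
Proof. by rewrite /embF -natrD /= (natr_mod_eq _ (Fp_cast (pcharf_prime chF))). Qed.

Lemma embFM x y : embF (x * y) = embF x * embF y.
Proof. by rewrite /embF -natrM /= (natr_mod_eq _ (Fp_cast (pcharf_prime chF))). Qed.

Lemma embF0 : embF 0 = 0. Proof. by []. Qed.
Lemma embF1 : embF 1 = 1. Proof. by []. Qed.

(* Polynomials in x, y over F are encoded in {poly {poly F}}, with x the      *)
(* outer and y the inner variable; lform a b is a x + b y.                    *)
Definition lform (a b : F) : {poly {poly F}} :=
  a%:P%:P * 'X + (b%:P * 'X)%:P.

(* Rows and columns are indexed by the basis x^i y^(t-1-i) of V_t.            *)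
Definition V_mx (t : nat) (g : gT) : 'M[F]_t :=
  let m i j := embF (GLval g i j) in
  \matrix_(i < t, j < t)
    (lform (m 0 0) (m 0 1) ^+ i
     * lform (m 1 0) (m 1 1) ^+ (t.-1 - i))`_j`_(t.-1 - j).

(* The degree n part of f, evaluated at x = A, y = C.                         *)
Definition hsubst n (f A C : {poly {poly F}}) : {poly {poly F}} :=
  \sum_(j < n.+1) (f`_j`_(n - j))%:P%:P * A ^+ j * C ^+ (n - j).

Lemma hsubstM n a b (f A C : {poly {poly F}}) :
  hsubst n.+1 (lform a b * f) A C
  = (a%:P%:P * A + b%:P%:P * C) * hsubst n f A C.
Proof.
have E j k : (lform a b * f)`_j`_k
  = (if j is j'.+1 then a * f`_j'`_k else 0)
    + (if k is k'.+1 then b * f`_j`_k' else 0).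
  rewrite /lform mulrDl coefD -mulrA !coefCM coefXM coefD coefCM -mulrA.
  by rewrite coefCM coefXM; case: j k => [|j] [|k]; rewrite /= ?coef0 ?mulr0.
rewrite /hsubst.
under eq_bigr => j _ do rewrite E polyCD polyCD !mulrDl.
rewrite big_split /= mulrDl; congr (_ + _).
  rewrite big_ord_recl /= !rmorph0 !mul0r add0r mulr_sumr.
  apply: eq_bigr => j _; rewrite /bump /= add1n subSS polyCM polyCM exprS.
  by rewrite !mulrA; congr (_ * _ * _); rewrite -!mulrA; congr (_ * _); rewrite mulrC.
rewrite big_ord_recr /= subnn !rmorph0 !mul0r addr0 mulr_sumr.
apply: eq_bigr => j _; have lejn : (j <= n)%N by rewrite -ltnS.
rewrite subSn // polyCM polyCM exprS.
set fj := (f`_j`_(n - j))%:P%:P; set bb := b%:P%:P.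
ring.
Qed.

Lemma hsubst_prod n i k (a b c d : F) (A C : {poly {poly F}}) : (i + k = n)%N ->
  hsubst n (lform a b ^+ i * lform c d ^+ k) A C
  = (a%:P%:P * A + b%:P%:P * C) ^+ i * (c%:P%:P * A + d%:P%:P * C) ^+ k.
Proof.
elim: n i k => [|n IHn] [|i] [|k] // ikn.
- by rewrite /hsubst big_ord1 !expr0 !mulr1 !coef1.
- have := IHn 0%N k (succn_inj ikn); rewrite !expr0 !mul1r => IH.
  by rewrite !exprS hsubstM IH.
- have := IHn i 0%N; rewrite !addn0 !expr0 !mulr1 => IH.
  by rewrite !exprS hsubstM IH //; move: ikn; rewrite addn0 => -[].
rewrite !(exprS _ i) -[X in hsubst _ X]mulrA hsubstM IHn ?mulrA //.
by case: ikn.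
Qed.

Lemma lform_subst (a b a1 b1 a2 b2 : F) :
  a%:P%:P * lform a1 b1 + b%:P%:P * lform a2 b2
  = lform (a * a1 + b * a2) (a * b1 + b * b2).
Proof.
by rewrite /lform !(polyCD, polyCM); ring.
Qed.

Fact V_mx_repr t : mx_repr SL2 (V_mx t).
Proof.
split=> [|g h _ _]; case: t => [|n] /=; rewrite ?(flatmx0 (V_mx 0 _)) ?[RHS]flatmx0 //.
- apply/matrixP => i j; rewrite !mxE /= embF0 embF1 /lform.
  rewrite !polyC0 !mul0r polyC0 addr0 add0r !polyC1 !mul1r.
  rewrite -polyC_exp mulrC coefCM coefXn.
  have := ltn_ord i; have := ltn_ord j; rewrite !ltnS => lej lei.
  rewrite -val_eqE /=; case: (eqVneq (i : nat) j) => [<-|nij].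
    by rewrite mulr1 coefXn eqxx.
  by rewrite mulr0 coef0.
apply/matrixP => i m; rewrite [LHS]mxE [RHS]mxE /= !mul2E !embFD !embFM.
set a := embF (GLval g 0 0); set b := embF (GLval g 0 1).
set c := embF (GLval g 1 0); set d := embF (GLval g 1 1).
rewrite -!lform_subst -(hsubst_prod (n := n)); last by rewrite subnKC // -ltnS.
rewrite /hsubst !coef_sum; apply: eq_bigr => j _.
by rewrite !mxE -mulrA !coefCM.
Qed.

Definition Vmod t := MxRepresentation (V_mx_repr t).

(* g = [1 1; 0 1] acts trivially, lambda = [z 0; 0 z^-1] acts as z^a.         *)
Definition S_mx (a : int) (g : gT) : 'M[F]_1 := (embF (GLval g 0 0) ^ a)%:M.

Fact S_mx_repr a : mx_repr borel (S_mx a).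
Proof.
split=> [|x y]; first by rewrite /S_mx GL_1E mxE embF1 exp1rz.
rewrite inE => /andP[_ /eqP x0]; rewrite inE => /andP[_ /eqP y0].
by rewrite /S_mx mul2E y0 mulr0 addr0 embFM expfzMl scalar_mxM.
Qed.

Definition Smod a := MxRepresentation (S_mx_repr a).

(* rU is (isomorphic to) U_{a,b}.                                             *)
Definition is_U (a : int) (b : nat) n (rU : mx_representation F borel n) :=
  uniserial rU
  /\ has_factors rU [seq Representation (Smod (a + (2 * k)%:Z)) | k <- iota 0 b].

End Reps.
End SL2.

Section StringModules.
Variables (p : nat) (F : fieldType) (chF : p \in [pchar F]).
Variables (i l s : nat) (eps : int).

(* The dimension t of the simple module V_t on the j-th edge of the Brauer    *)
(* tree of the block B_i, edges being counted from the non-exceptional end.   *)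
Definition tree_edge (j : nat) : nat :=
  if odd j != odd i then j else (p - j)%N.

(* E_k = V_(walk k).                                                          *)
Definition walk (k : nat) : nat := tree_edge (minn (l + k) (p - l - k))%N.

(* Membership of k >= 1 in the set D.                                         *)
Definition inD (k : nat) : bool := if eps == 1 then odd k else ~~ odd k.

(* M_k has top E_(top_idx k) and socle E_(soc_idx k).                         *)
Definition top_idx k := if inD k then k else k.+1.
Definition soc_idx k := if inD k then k.+1 else k.

(* All choices made in the construction of M(i,l,s,eps) for s >= 2. M_k is    *)
(* used for 1 <= k < s only; component j of the direct sum of the M_k is      *)
(* M_(j+1). Only phi_k = sd_phi k (top_idx k) and psi_k = sd_psi k            *)
(* (soc_idx k) are used: the second index is a separate argument so that      *)
(* maps to (or from) the same E_j have convertible types.                     *)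
Record string_data := StringData {
  sd_deg : nat -> nat;
  sd_M : forall k, mx_representation F (SL2 p) (sd_deg k);
  sd_uniserial : forall k, (0 < k < s)%N -> uniserial (sd_M k);
  sd_factors : forall k, (0 < k < s)%N ->
    has_factors (sd_M k) [:: Representation (Vmod chF (walk (soc_idx k)));
                             Representation (Vmod chF (walk (top_idx k)))];
  sd_phi : forall k j, 'M[F]_(sd_deg k, walk j);
  sd_phi_hom : forall k, (0 < k < s)%N ->
    mxhom (sd_M k) (Vmod chF (walk (top_idx k))) (sd_phi k (top_idx k));
  sd_phi_epi : forall k, (0 < k < s)%N -> row_full (sd_phi k (top_idx k));
  sd_psi : forall k j, 'M[F]_(walk j, sd_deg k);
  sd_psi_hom : forall k, (0 < k < s)%N ->
    mxhom (Vmod chF (walk (soc_idx k))) (sd_M k) (sd_psi k (soc_idx k));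
  sd_psi_mono : forall k, (0 < k < s)%N -> row_free (sd_psi k (soc_idx k));
  sd_sum := dsum_repr (fun j : 'I_s.-1 => sd_M j.+1);
  sd_X : 'M[F]_(\sum_(j < s.-1) sd_deg j.+1);
  sd_XP : forall m : 'rV[F]_(\sum_(j < s.-1) sd_deg j.+1),
    (m <= sd_X)%MS <->
    (forall j j' : 'I_s.-1, j' = j.+1 :> nat -> ~~ inD j.+1 ->
       submxrow m j *m sd_phi j.+1 j.+2 = submxrow m j' *m sd_phi j'.+1 j.+2);
  sd_X_mod : mxmodule sd_sum sd_X;
  (* sd_gen k f = (0, .., 0, psi_(k-1) f, psi_k f, 0, .., 0)                  *)
  sd_gen := (fun (k : nat) (f : 'rV[F]_(walk k)) =>
    \mxrow_(j < s.-1)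
      (if (j.+1 == k.-1) || (j.+1 == k) then f *m sd_psi j.+1 k else 0));
  sd_Y : 'M[F]_(\sum_(j < s.-1) sd_deg j.+1);
  sd_Y_mod : mxmodule sd_sum sd_Y;
  sd_Y_gen : forall k f, (1 < k < s)%N -> ~~ inD k -> (@sd_gen k f <= sd_Y)%MS;
  sd_Y_min : forall Z : 'M[F]_(\sum_(j < s.-1) sd_deg j.+1),
    mxmodule sd_sum Z ->
    (forall k f, (1 < k < s)%N -> ~~ inD k -> (@sd_gen k f <= Z)%MS) ->
    (sd_Y <= Z)%MS
}.


Definition sd_quotient (D : string_data) :=
  section_repr (sd_Y_mod D) (sd_X_mod D).

(* rM is isomorphic to M(i,l,s,eps).                                          *)
Definition is_M n (rM : mx_representation F (SL2 p) n) : Prop :=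
  if s == 1%N then mx_rsim rM (Vmod chF (walk 1))
  else exists D : string_data, mx_rsim rM (sd_quotient D).

End StringModules.

(* The multiplicity of S_c in U_{a,b}.                                        *)
Definition theta (p : nat) (a b c : int) : int :=
  if (a == c %[mod 2])%Z then
    Num.floor ((2 * (b - 1) + a - c)%:~R / (p%:R - 1) : rat)
    - Num.ceil ((a - c)%:~R / (p%:R - 1) : rat) + 1
  else 0.

Definition Lval (p i l s : nat) : int :=
  match odd l, odd s with
  | true, true =>
      (1 - i%:Z) * p%:Z + (-1) ^+ i.+1 * ((2 * l + s + 1)./2)%N%:Z
  | false, false => (1 - i%:Z) * p%:Z + (-1) ^+ i.+1 * (s./2)%:Z
  | true, false => i%:Z * p%:Z + (-1) ^+ i * (s./2)%:Z
  | false, true => i%:Z * p%:Z + (-1) ^+ i * ((2 * l + s + 1)./2)%N%:Z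
  end.

(* The case table for a when s >= 2, read from top to bottom, Ep being true   *)
(* for epsilon = 1. The published table assigns p-1-l to (0,1,1,-1,2) and     *)
(* (0,2,0,1,2), through (_,1,1,-1,2) and (0,2,0,_,2); both are misprints for  *)
(* 0, corrected in the first line below. In both cases p = l+s+1 and,         *)
(* reversing the walk, M(0,l,s,eps) is isomorphic to M(0,0,s,-1), for which   *)
(* the table itself has a = 0. With p-1-l in the first case, a has the wrong  *)
(* parity for the block B_0 and the n_{c,p} are not integers; in the second,  *)
(* for p = 7 and (l,s) = (2,4), the restriction is U_{0,5} + U_{4,7}, whereas *)
(* a = 4 would give U_{4,5} + U_{2,7}.                                        *)
Definition a_table (p l s I Lf Sf : nat) (Ep : bool) (Sg : nat) : int :=
  match I, Lf, Sf, Ep, Sg with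
  | 0, 1, 1, false, 2 | 0, 2, 0, true, 2 => 0%R
  | 0, 0, _, false, 0 | 0, 0, _, false, 1 | 0, 0, 0, _, 2 => 0%R
  | 0, 0, 0, true, 0 | 1, 0, 1, false, 0 => s%:Z
  | 0, 0, 0, true, 1 | 1, 0, 1, false, 1 => s%:Z
  | 0, 0, 1, true, 0 | 1, 0, 0, false, 0 => (p%:Z - s%:Z)%R
  | 0, 0, 1, true, 1 | 1, 0, 0, false, 1 => (p%:Z - s%:Z)%R
  | 0, 1, 0, false, 0 | 0, 2, 1, true, 0
  | 1, 1, 1, true, 0 | 1, 2, 0, false, 0 => (p%:Z - l%:Z - s%:Z)%R
  | 0, 1, 0, false, 1 | 0, 2, 1, true, 1
  | 1, 1, 1, true, 1 | 1, 2, 0, false, 1 => (p%:Z - l%:Z - s%:Z)%R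
  | 0, 1, _, true, 0 | 0, 1, _, true, 1 | 0, 1, 1, true, 2
  | 1, 2, _, true, 0 | 1, 2, _, true, 1 | 1, 2, 0, true, 2 => (l%:Z + 1)%R
  | 0, 1, 1, false, 0 | 0, 2, 0, true, 0
  | 1, 1, 0, true, 0 | 1, 2, 1, false, 0 => (l%:Z + s%:Z)%R
  | 0, 1, 1, false, 1 | 0, 2, 0, true, 1
  | 1, 1, 0, true, 1 | 1, 2, 1, false, 1 => (l%:Z + s%:Z)%R
  | _, 1, 1, false, 2 | 0, 2, _, false, 0 | 0, 2, _, false, 1
  | 0, 2, 0, _, 2 | 1, 1, _, false, 0 | 1, 1, _, false, 1 =>
      (p%:Z - 1 - l%:Z)%R
  | 1, 0, 0, _, 2 | 1, 0, _, true, 0 | 1, 0, _, true, 1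
  | 1, 1, 1, true, 2 | 1, 2, 0, false, 2 => 1%R
  | _, _, _, _, _ => 0%R
  end%N.

Definition aval (p i l s : nat) (eps : int) : int :=
  if s == 1%N then
    if walk p i l 1 == 1%N then 0 else p%:Z - Lval p i l s
  else
    a_table p l s i
      (if l == 0%N then 0 else if odd l then 1 else 2)%N
      (odd s)
      (eps == 1)
      (if l + s <= (p - 1)./2 then 0 else if l + s < p - 1 then 1 else 2)%N.

Definition delta (p r j : nat) : rat :=
  if r == j then (p%:R - 2) / p%:R else - 2 / p%:R.

(* kappa_c and n_{c,p}, Theta t being the multiplicity of V_t in M.           *)
Definition kappa (p i l s : nat) (eps : int) (Theta : nat -> nat) (c : nat) : int :=
  (Theta 1%N)%:Z * theta p 0 1 c%:Z
  + \sum_(2 <= t < p) (Theta t)%:Z * theta p (p%:Z - t%:Z) t%:Z c%:Z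
  - theta p (aval p i l s eps) (Lval p i l s) c%:Z.

Definition ncp (p i l s : nat) (eps : int) (Theta : nat -> nat) (c : nat) : rat :=
  if odd c != odd i then 0
  else \sum_(1 <= j < ((p - 1)./2).+1)
         delta p (c + 2 - i)./2 j
         * (kappa p i l s eps Theta (i + 2 * (j - 1))%N)%:~R.

(* Main.v *)
Require Import Defs.
From mathcomp Require Import all_boot all_order all_algebra all_fingroup.
From mathcomp Require Import all_solvable mxrepresentation character finfield.
From mathcomp Require Import archimedean ssrAC ring zify.
Set Implicit Arguments.
Unset Strict Implicit.
Unset Printing Implicit Defensive.
Import Order.TTheory GRing.Theory Num.Theory.
Local Open Scope ring_scope.

(** The restriction to the Borel subgroup [B] is computed from generators and
    relations. [B] is the semidirect product of a torus, whose weights are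
    integers modulo [p - 1], and of a cyclic group of order [p]. The sum
    [N = - sum_x x^-1 g^x], over the nonzero [x] in the prime field, is a
    logarithm of the unipotent generator [g]: it is a nilpotent operator with
    [N ^ p = 0] that lowers weights by [2], and [g^x] is the truncated
    exponential of [x N] ([unip_exp]). So a [B]-module is a graded module over
    the truncated polynomial ring in [N] ([mxhom_borel]), the module [U_(a,b)]
    is the one generated by a vector of weight [a + 2 (b - 1)] killed by
    [N ^ b] ([Umod_is_U], [orbmx_hom]), and [V_t] restricts to such a module of
    dimension [t] with a generator of weight [t - 1].

    A string module with walk [E_1, ..., E_s] has one generator [x_k] of weight
    [dim E_k - 1] for each factor. If [E_k] is in the socle then [x_k] is killed
    by [N ^ dim E_k]. If [E_k] is a top, [x_k N ^ dim E_k] lies in the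
    neighbouring socles, and weights leave one candidate in each: a multiple of
    [x N], if the two dimensions have sum [p + 1], and of [x] itself if they
    have sum [p - 1], [x] being the generator of that socle. The multiple is not
    zero, because the index of [B] is prime to [p], so that an extension which
    does not split over the whole group does not split over [B] either
    ([extension_link]). This is the content of [string_module_presentation].

    The sums [p + 1] and [p - 1] alternate along the walk, and so do tops and
    socles. Hence the walk can be read from one of its ends in such a way that
    each top is linked to its predecessor with sum [p + 1] and to its successor
    with sum [p - 1]. A top [y] with a predecessor [z] satisfies
    [y N ^ dim = e z N + e' z'] with [e != 0], [z'] being its successor, if any:
    it generates a free module which absorbs [z N] up to [z'], and only [z]
    itself is left over from [z]. Correcting the first generator successively by
    elements of these free modules produces a vector that generates a single
    further summand, the module [U_(a,L)] ([chain_covers]). The decomposition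
    follows since this sum of modules maps onto the restriction and has the same
    dimension ([chain_dim_sum]).

    It remains to identify the numbers. [theta] counts the weights of a
    uniserial module in a residue class ([theta_occ]), so by Jordan-Hoelder
    [kappa_c] is the multiplicity of [S_c] in the projective part
    ([kappa_tops]). The free module with top of weight [w] contains every [S_c]
    of the right parity twice, and [S_w] a third time, and [delta] inverts this
    matrix ([delta_sum]). Finally [L] and [a] are read off the first generator
    of the chain, case by case ([Lval_chain_dim], [aval_first_weight]). *)

(** * Power sums and characters of the prime field *)

Section PrimeField.
Variables (p : nat) (F : fieldType).
Hypotheses (p_odd : odd p) (p_pr : prime p) (chF : p \in [pchar F]).
Local Notation emb := (@embF p F).

Lemma p_gt2 : (2 < p)%N.
Proof. by case: p p_pr p_odd => [|[|[|]]]. Qed.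

Lemma natF_eq0 m : ((m%:R : F) == 0) = (p %| m)%N.
Proof. by rewrite (dvdn_pcharf chF). Qed.

Lemma natF_neq0 m : (0 < m < p)%N -> (m%:R : F) != 0.
Proof. by case/andP=> m0 mp; rewrite natF_eq0 gtnNdvd. Qed.

Lemma embF_eq0 (x : 'F_p) : (emb x == 0) = (x == 0).
Proof.
rewrite /embF natF_eq0; apply/idP/eqP => [dv|->]; last exact: dvdn0.
apply/val_inj/eqP; rewrite /= -leqn0 leqNgt; apply/negP => x0.
have := dvdn_leq x0 dv; rewrite leqNgt => /negP[].
by rewrite -[X in (_ < X)%N](Fp_cast p_pr) ltn_ord.
Qed.

Lemma embFB x y : emb (x - y) = emb x - emb y.
Proof. by apply/eqP; rewrite eq_sym subr_eq -(embFD chF) subrK. Qed.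

Lemma embFN x : emb (- x) = - emb x.
Proof. by rewrite -[- x]sub0r embFB embF0 sub0r. Qed.

Lemma embF_inj : injective emb.
Proof.
by move=> x y /eqP; rewrite -subr_eq0 -embFB embF_eq0 subr_eq0 => /eqP.
Qed.

Lemma embFX x k : emb (x ^+ k) = emb x ^+ k.
Proof. by elim: k => [|k IH]; rewrite ?expr0 ?embF1 // !exprS (embFM chF) IH. Qed.

Lemma embFV x : emb x^-1 = (emb x)^-1.
Proof.
have [->|x0] := eqVneq x 0; first by rewrite !invr0.
apply: (mulfI (_ : emb x != 0)); first by rewrite embF_eq0.
by rewrite -(embFM chF) !divff ?embF_eq0.
Qed.

Lemma embF_expp (x : 'F_p) : emb x ^+ p = emb x.
Proof. by rewrite -embFX; congr embF; have := expf_card x; rewrite card_Fp. Qed.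

Lemma embF_fermat (x : 'F_p) : x != 0 -> emb x ^+ p.-1 = 1.
Proof.
move=> x0; apply: (mulfI (_ : emb x != 0)); first by rewrite embF_eq0.
by rewrite -exprS prednK ?prime_gt0 // embF_expp mulr1.
Qed.

Lemma card_unitsFp : #|[pred x : 'F_p | x != 0]| = p.-1.
Proof.
by have := cardC1 (0 : 'F_p); rewrite card_Fp // => <-; apply: eq_card => x.
Qed.

(** A nontrivial power map on the units of the prime field has a non-fixed
    value, because a polynomial of degree below [p - 1] cannot vanish at all
    of them. *)
Lemma exp_neq1_exists e : ~~ (p.-1 %| e)%N ->
  exists2 x : 'F_p, x != 0 & emb x ^+ e != 1.
Proof.
move=> ndv; have q0 : (0 < p.-1)%N by have := p_gt2; lia.
apply/exists_inP; apply: contraNT ndv; rewrite negb_exists_in => all0.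
have all1 (x : 'F_p) : x != 0 -> emb x ^+ e = 1.
  by move=> x0; have := forallP all0 x; rewrite x0 negbK => /eqP.
rewrite /dvdn; apply: contraT => r0; pose r := (e %% p.-1)%N.
have r_lt : (r < p.-1)%N by rewrite ltn_mod.
pose P : {poly F} := 'X^r - 1.
have sP : size P = r.+1 by rewrite size_XnsubC ?lt0n.
have := @max_poly_roots _ P [seq emb x | x <- enum [pred x : 'F_p | x != 0]].
rewrite -size_poly_eq0 sP size_map -cardE card_unitsFp => /(_ isT).
rewrite map_inj_uniq ?enum_uniq; last exact: embF_inj.
suff -> : all (root P) [seq emb x | x <- enum [pred x : 'F_p | x != 0]].
  by move=> /(_ isT isT); rewrite ltnS leqNgt r_lt.
apply/allP => _ /mapP[x xU ->]; have x0 : x != 0 by rewrite mem_enum inE in xU.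
rewrite rootE !hornerE; apply/eqP.
rewrite -[RHS](subrr 1); congr (_ - _); rewrite -(all1 _ x0).
by rewrite [in RHS](divn_eq e p.-1) exprD mulnC exprM embF_fermat // expr1n mul1r.
Qed.

(** The power [0 ^ 0 = 1] makes the sum vanish for [e = 0], whence the condition
    [0 < e]. *)
Lemma sum_embF_exp e :
  \sum_(x : 'F_p) emb x ^+ e = if (0 < e)%N && (p.-1 %| e)%N then -1 else 0.
Proof.
have [->|e0] /= := posnP e.
  under eq_bigr => x _ do rewrite expr0.
  by rewrite sumr_const card_Fp // -[_ *+ _]/(p%:R) (pcharf0 chF).
have [dv|ndv] := boolP (p.-1 %| e)%N.
  rewrite (bigD1 (0 : 'F_p)) //= embF0 expr0n gtn_eqF // add0r.
  rewrite (eq_bigr (fun=> 1)) => [|x x0].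
    rewrite sumr_const card_unitsFp; apply/eqP; rewrite -addr_eq0 -mulrSr.
    by rewrite prednK ?prime_gt0 // natF_eq0.
  by case/dvdnP: dv => k ->; rewrite mulnC exprM embF_fermat // expr1n.
have [y y0 ye] := exp_neq1_exists ndv.
set S := \sum_x _; have : emb y ^+ e * S = S.
  rewrite mulr_sumr [RHS](reindex_inj (mulfI y0)).
  by apply: eq_bigr => x _; rewrite (embFM chF) exprMn.
move/eqP; rewrite -{2}[S]mul1r -subr_eq0 -mulrBl mulf_eq0 subr_eq0 (negPf ye).
by move/eqP.
Qed.

Lemma expz_fermat (x : 'F_p) (m k : int) : x != 0 -> (m = k %[mod p.-1])%Z ->
  emb x ^ m = emb x ^ k.
Proof.
move=> x0 mk; have ex : emb x != 0 by rewrite embF_eq0.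
have H (q : int) : emb x ^ (q * p.-1) = 1.
  by rewrite mulrC -exprz_exp -exprnP embF_fermat // exp1rz.
by rewrite (divz_eq m p.-1) (divz_eq k p.-1) mk !expfzDr // !H.
Qed.

(** The weights of the torus are exactly the residues modulo [p - 1]. *)
Lemma expz_inj (m k : int) :
  (forall x : 'F_p, x != 0 -> emb x ^ m = emb x ^ k) -> (m = k %[mod p.-1])%Z.
Proof.
move=> eqmk; have q0 : p.-1%:Z != 0 by have := p_gt2; lia.
have dge := modz_ge0 (m - k) q0.
case E: ((m - k) %% p.-1)%Z dge => [e|] // _.
suff : (p.-1 %| e)%N.
  move=> /dvdnP[q eE]; apply/eqP; rewrite eqz_mod_dvd; apply/dvdz_mod0P.
  by rewrite -modz_mod E eE PoszM modzMl.
apply: contraT => /exp_neq1_exists[x x0 /negP[]].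
have ex : emb x \is a GRing.unit by rewrite unitfE embF_eq0.
rewrite exprnP (@expz_fermat x e (m - k)) //; last by rewrite -E modz_mod.
by rewrite expfzDr ?embF_eq0 // eqmk // -expfzDr ?embF_eq0 // subrr.
Qed.

End PrimeField.

(** * The Borel subgroup: torus weights and the nilpotent operator *)

Lemma det2 (R : comNzRingType) (A : 'M[R]_2) :
  \det A = A 0 0 * A 1 1 - A 0 1 * A 1 0.
Proof.
rewrite (expand_det_row _ 0) !big_ord_recl big_ord0 addr0 /cofactor /=.
rewrite !det_mx11 !mxE /= expr0 expr1 mul1r mulN1r mulrN.
by congr (_ * _ - _ * _); congr (A _ _); apply: val_inj.
Qed.

Lemma mxpowSr (R : pzRingType) n (A : 'M[R]_n) k : A ^+ k.+1 = A ^+ k *m A.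
Proof. exact: exprSr. Qed.

Lemma mxpowD (R : pzRingType) n (A : 'M[R]_n) j k :
  A ^+ (j + k) = A ^+ j *m A ^+ k.
Proof. exact: exprD. Qed.

Section Elements.
Variable p : nat.
Local Notation gT := {'GL_2['F_p]}.

(** The entries determine the matrix when the determinant is [1], and nothing
    else about it is used. *)
Lemma gl2_sig (a b c d : 'F_p) : {x : gT | a * d - b * c = 1 ->
  [/\ GLval x 0 0 = a, GLval x 0 1 = b, GLval x 1 0 = c & GLval x 1 1 = d]}.
Proof.
pose A := \matrix_(i < 2, j < 2)
  if i == 0 then if j == 0 then a else b else if j == 0 then c else d.
exists (insubd (1%g : gT) A) => dt.
have uA : A \is a GRing.unit.
  by rewrite -[_ \is a _]/(A \in unitmx) unitmxE det2 !mxE /= dt unitr1.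
have -> : GLval (insubd (1%g : gT) A) = A by apply: insubdK; apply: uA.
by rewrite !mxE.
Qed.

Definition gl2 a b c d : gT := sval (gl2_sig a b c d).

Lemma gl2E a b c d : a * d - b * c = 1 ->
  [/\ GLval (gl2 a b c d) 0 0 = a, GLval (gl2 a b c d) 0 1 = b,
      GLval (gl2 a b c d) 1 0 = c & GLval (gl2 a b c d) 1 1 = d].
Proof. exact: (svalP (gl2_sig a b c d)). Qed.

Lemma gl2_eq (x y : gT) :
  GLval x 0 0 = GLval y 0 0 -> GLval x 0 1 = GLval y 0 1 ->
  GLval x 1 0 = GLval y 1 0 -> GLval x 1 1 = GLval y 1 1 -> x = y.
Proof.
move=> e1 e2 e3 e4; apply: val_inj; apply/matrixP => i j.
have H (k : 'I_2) : k = 0 \/ k = 1.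
  by case: k => [[|[|]]] // h; [left | right]; apply: val_inj.
by case: (H i) => ->; case: (H j) => ->.
Qed.

Definition unip (b : 'F_p) : gT := gl2 1 b 0 1.
Definition tor (a : 'F_p) : gT := gl2 a 0 0 a^-1.
Definition weyl : gT := gl2 0 1 (-1) 0.

Lemma unipE b : [/\ GLval (unip b) 0 0 = 1, GLval (unip b) 0 1 = b,
  GLval (unip b) 1 0 = 0 & GLval (unip b) 1 1 = 1].
Proof. by apply: gl2E; rewrite mulr1 mulr0 subr0. Qed.

Lemma weylE : [/\ GLval weyl 0 0 = 0, GLval weyl 0 1 = 1,
  GLval weyl 1 0 = -1 & GLval weyl 1 1 = 0].
Proof. by apply: gl2E; rewrite mulr0 mulrN1 opprK add0r. Qed.

Lemma unip_borel b : unip b \in borel p.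
Proof.
case: (unipE b) => e1 e2 e3 e4; rewrite !inE det2 e1 e2 e3 e4.
by rewrite mulr0 subr0 mulr1 !eqxx.
Qed.

Lemma weyl_SL2 : weyl \in SL2 p.
Proof.
case: weylE => e1 e2 e3 e4; rewrite inE det2 e1 e2 e3 e4.
by rewrite mulr0 mulrN1 opprK add0r.
Qed.

Lemma unipD a b : (unip a * unip b)%g = unip (a + b).
Proof.
have [e1 e2 e3 e4] := unipE a; have [f1 f2 f3 f4] := unipE b.
have [g1 g2 g3 g4] := unipE (a + b); apply: gl2_eq; rewrite mul2E.
- by rewrite e1 e2 f1 f3 g1 mulr0 addr0 mulr1.
- by rewrite e1 e2 f2 f4 g2 mul1r mulr1 addrC.
- by rewrite e3 e4 f1 f3 g3 mulr0 addr0 mul0r.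
by rewrite e3 e4 f2 f4 g4 mul0r add0r mulr1.
Qed.

Lemma unip0 : unip 0 = 1%g.
Proof. by apply: (mulgI (unip 0)); rewrite unipD mulg1 addr0. Qed.

Hypothesis p_pr : prime p.

Lemma torE a : a != 0 -> [/\ GLval (tor a) 0 0 = a, GLval (tor a) 0 1 = 0,
  GLval (tor a) 1 0 = 0 & GLval (tor a) 1 1 = a^-1].
Proof. by move=> a0; apply: gl2E; rewrite mulr0 subr0 divff. Qed.

Lemma tor_borel a : a != 0 -> tor a \in borel p.
Proof.
move=> a0; case: (torE a0) => e1 e2 e3 e4.
by rewrite !inE det2 e1 e2 e3 e4 mulr0 subr0 divff // !eqxx.
Qed.

Lemma torM a b : a != 0 -> b != 0 -> (tor a * tor b)%g = tor (a * b).
Proof.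
move=> a0 b0; have [e1 e2 e3 e4] := torE a0; have [f1 f2 f3 f4] := torE b0.
have [g1 g2 g3 g4] := torE (mulf_neq0 a0 b0); apply: gl2_eq; rewrite mul2E.
- by rewrite e1 e2 f1 f3 g1 mulr0 addr0.
- by rewrite e1 e2 f2 f4 g2 mul0r mulr0 addr0.
- by rewrite e3 e4 f1 f3 g3 mulr0 addr0 mul0r.
by rewrite e3 e4 f2 f4 g4 mul0r add0r invfM.
Qed.

Lemma tor_unip a b c : a != 0 -> c = a ^+ 2 * b ->
  (tor a * unip b)%g = (unip c * tor a)%g.
Proof.
move=> a0 cE; have [e1 e2 e3 e4] := torE a0; have [f1 f2 f3 f4] := unipE b.
have [g1 g2 g3 g4] := unipE c; apply: gl2_eq; rewrite [LHS]mul2E [RHS]mul2E.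
- by rewrite e1 e2 e3 f1 f3 g1 g2 !mulr0 !addr0 mul1r mulr1.
- rewrite e1 e2 e4 f2 f4 g1 g2 mul0r mulr0 addr0 add0r cE.
  by rewrite expr2 mulrAC mulfK.
- by rewrite e3 e4 e1 f1 f3 g3 g4 !mulr0 !mul0r !addr0.
by rewrite e3 e4 e2 f2 f4 g3 g4 !mul0r !add0r mulr1 mul1r.
Qed.

Lemma borelE x : x \in borel p ->
  exists a b, a != 0 /\ x = (unip b * tor a)%g.
Proof.
rewrite !inE det2 => /andP[/eqP dt /eqP x10]; rewrite x10 mulr0 subr0 in dt.
have a0 : GLval x 0 0 != 0.
  by apply/eqP => a0; move/esym/eqP: dt; rewrite a0 mul0r oner_eq0.
have [b bE] : exists b, b = GLval x 0 1 * GLval x 0 0 by eexists.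
exists (GLval x 0 0), b; split=> //.
have [e1 e2 e3 e4] := torE a0; have [f1 f2 f3 f4] := unipE b.
apply: gl2_eq; rewrite [RHS]mul2E.
- by rewrite f1 f2 e1 e3 mulr0 addr0 mul1r.
- by rewrite f1 f2 e2 e4 mulr0 add0r bE mulfK.
- by rewrite f3 f4 e1 e3 x10 mulr0 addr0 mul0r.
by rewrite f3 f4 e2 e4 mul0r add0r mul1r; apply: (mulfI a0); rewrite divff.
Qed.

End Elements.

Section Nil.
Variables (p : nat) (F : fieldType).
Hypotheses (p_odd : odd p) (p_pr : prime p) (chF : p \in [pchar F]).
Local Notation emb := (@embF p F).
Local Notation gT := {'GL_2['F_p]}.

(** For [0 < k < p] this is [N ^ k / k!], where [N] is the logarithm of the
    unipotent generator: in the group algebra the coefficient of [g^x] in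
    [N ^ k / k!] is [- x ^ (p - 1 - k)]. *)
Definition logdp n (r : gT -> 'M[F]_n) (k : nat) : 'M[F]_n :=
  - \sum_(x : 'F_p) emb x ^+ (p.-1 - k) *: r (unip x).

Definition nilop n (r : gT -> 'M[F]_n) := logdp r 1.

Definition weight n (r : gT -> 'M[F]_n) m (v : 'M[F]_(m, n)) (c : int) :=
  forall a : 'F_p, a != 0 -> v *m r (tor a) = emb a ^ c *: v.

Section Rep.
Variables (n : nat) (r : mx_representation F (borel p) n).
Local Notation N := (nilop r).

Lemma rep_unipM x y : r (unip x) *m r (unip y) = r (unip (x + y)).
Proof. by rewrite -unipD repr_mxM ?unip_borel. Qed.

(** Multiplication is a convolution on the prime field; expanding
    [(z - x) ^ (p - 1 - k)] leaves the power sums of the [x], all of which vanish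
    except one. *)
Lemma nilop_logdp k : (0 < k < p)%N ->
  N *m logdp r k = if (k.+1 < p)%N then k.+1%:R *: logdp r k.+1 else 0.
Proof.
case/andP=> k0 kp; rewrite /nilop /logdp mulNmx mulmxN opprK.
have p3 := p_gt2 p_odd p_pr.
transitivity (\sum_(z : 'F_p) (\sum_(x : 'F_p)
     emb x ^+ (p.-1 - 1) * (emb z - emb x) ^+ (p.-1 - k)) *: r (unip z)).
  rewrite mulmx_suml; under eq_bigr => x _ do rewrite mulmx_sumr.
  rewrite exchange_big /=; under [RHS]eq_bigr => z _ do rewrite scaler_suml.
  rewrite [RHS]exchange_big /= exchange_big /=; apply: eq_bigr => x _.
  rewrite [RHS](reindex_inj (addrI x)); apply: eq_bigr => y _.
  rewrite -scalemxAl -scalemxAr scalerA rep_unipM -(embFB chF).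
  by rewrite [x + y]addrC addrK.
have inner (z : 'F_p) : \sum_(x : 'F_p)
     emb x ^+ (p.-1 - 1) * (emb z - emb x) ^+ (p.-1 - k) =
     if (k.+1 < p)%N then - (k.+1%:R * emb z ^+ (p.-1 - k.+1)) else 0.
  under eq_bigr => x _ do rewrite exprBn mulr_sumr.
  rewrite exchange_big /=.
  have E (m : 'I_(p.-1 - k).+1) : \sum_(x : 'F_p) emb x ^+ (p.-1 - 1) *
      ((-1) ^+ m * emb z ^+ (p.-1 - k - m) * emb x ^+ m *+ 'C(p.-1 - k, m)) =
      if m == 1%N :> nat then - (k.+1%:R * emb z ^+ (p.-1 - k.+1)) else 0.
    transitivity ((-1) ^+ m * emb z ^+ (p.-1 - k - m) *+ 'C(p.-1 - k, m) *
        \sum_(x : 'F_p) emb x ^+ (p.-1 - 1 + m)).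
      rewrite mulr_sumr; apply: eq_bigr => x _.
      by rewrite exprD mulrnAr mulrnAl mulrCA.
    rewrite (sum_embF_exp p_odd p_pr chF).
    have mle := ltn_ord m.
    have [m1|m1] := eqVneq (m : nat) 1%N.
      rewrite m1 subnK ?dvdnn ?andbT; last lia.
      have -> : (0 < p.-1)%N by lia.
      rewrite bin1 expr1 -subnDA addn1 mulN1r mulrN1 mulNrn opprK.
      have -> : (emb z ^+ (p.-1 - k.+1) *+ (p.-1 - k) : F) =
         (p.-1 - k)%:R * emb z ^+ (p.-1 - k.+1) by rewrite mulr_natl.
      rewrite -mulNr; congr (_ * _); apply/eqP; rewrite -addr_eq0 -natrD.
      by rewrite (natF_eq0 chF); have -> : (p.-1 - k + k.+1 = p)%N by lia.
    case: ifP; last by rewrite mulr0.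
    case/andP=> _ /dvdnP[q qE]; exfalso.
    case: q qE => [|[|q]] qE; [lia | lia |].
    have : (2 * p.-1 <= q.+2 * p.-1)%N by rewrite leq_mul2r; lia.
    lia.
  under eq_bigr => m _ do rewrite E.
  case: ifP => [k1|k1].
    have h1 : (1 < (p.-1 - k).+1)%N by lia.
    rewrite (bigD1 (Ordinal h1)) //= big1 ?addr0 // => m.
    by rewrite -val_eqE /= => /negPf ->.
  rewrite big1 // => m _; case: ifP => // /eqP m1.
  by have := ltn_ord m; rewrite m1; lia.
under eq_bigr => z _ do rewrite inner.
case: ifP => _; last by rewrite big1 // => z _; rewrite scale0r.
rewrite scalerN scaler_sumr -sumrN; apply: eq_bigr => z _.
by rewrite scaleNr scalerA.
Qed.

Lemma nilop_exp k : (0 < k < p)%N -> N ^+ k = k`!%:R *: logdp r k.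
Proof.
elim: k => // k IH /andP[_ kp]; have [->|k0] := posnP k.
  by rewrite expr1 scale1r.
have kk : (0 < k < p)%N by rewrite k0 ltnW.
rewrite exprS IH // -[_ * _]/(_ *m _) -scalemxAr nilop_logdp // kp scalerA.
by rewrite factS natrM mulrC.
Qed.

Lemma nilop_expp : N ^+ p = 0.
Proof.
have p3 := p_gt2 p_odd p_pr; have pE : p = p.-1.+1 by lia.
transitivity (N ^+ p.-1.+1); first by congr (_ ^+ _).
rewrite exprS nilop_exp; last lia.
rewrite -[_ * _]/(_ *m _) -scalemxAr nilop_logdp; last lia.
by rewrite (_ : (p.-1.+1 < p)%N = false) ?scaler0 //; lia.
Qed.

(** For nonzero [b] and [x] the coefficient of [g^x] in the right hand side is, up
    to sign, the geometric sum of the [(b / x) ^ k], which detects [x = b]. *)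
Lemma unip_logdp (b : 'F_p) :
  r (unip b) = 1%:M + \sum_(1 <= k < p) emb b ^+ k *: logdp r k.
Proof.
have p3 := p_gt2 p_odd p_pr.
have [->|b0] := eqVneq b 0.
  rewrite unip0 repr_mx1 big_nat_cond big1 ?addr0 // => k /andP[/andP[k0 _] _].
  by rewrite embF0 expr0n gtn_eqF // scale0r.
apply/eqP; rewrite addrC -subr_eq; apply/eqP; symmetry.
transitivity (- \sum_(x : 'F_p)
    (\sum_(1 <= k < p) emb b ^+ k * emb x ^+ (p.-1 - k)) *: r (unip x)).
  rewrite -sumrN; under [RHS]eq_bigr => x _ do rewrite scaler_suml.
  under [LHS]eq_bigr => k _ do rewrite scalerN scaler_sumr.
  rewrite sumrN sumrN exchange_big /=; congr (- _).
  by apply: eq_bigr => x _; apply: eq_bigr => k _; rewrite scalerA.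
have inner (x : 'F_p) : \sum_(1 <= k < p) emb b ^+ k * emb x ^+ (p.-1 - k) =
    (x == 0)%:R - (x == b)%:R.
  have [->|x0] := eqVneq x 0.
    rewrite eq_sym (negPf b0) subr0 (big_cat_nat (n := p.-1)) /=; try lia.
    rewrite [X in _ + X]big_ltn; last lia.
    rewrite [X in _ + (_ + X)]big_geq; last lia.
    rewrite subnn expr0 mulr1 addr0 (embF_fermat p_pr chF) //.
    rewrite big_nat_cond big1 ?add0r // => k /andP[/andP[_ kp] _].
    by rewrite embF0 expr0n (_ : (p.-1 - k == 0)%N = false) ?mulr0 //; lia.
  have [->|xb] := eqVneq x b.
    rewrite sub0r big_nat_cond (eq_bigr (fun=> 1)) => [|k /andP[/andP[_ kp] _]].
      rewrite -big_nat_cond sumr_const_nat; apply/eqP; rewrite -addr_eq0 -mulrSr.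
      by rewrite (natF_eq0 chF); have -> : ((p - 1).+1 = p)%N by lia.
    by rewrite -exprD subnKC ?(embF_fermat p_pr chF) //; lia.
  rewrite subr0; apply/eqP; rewrite -(mulrI_eq0 _ (_ : GRing.lreg (emb b - emb x))); last first.
    by apply: lregP; rewrite subr_eq0 (inj_eq (embF_inj p_pr chF)) eq_sym.
  rewrite big_add1 mulr_sumr big_mkord; apply/eqP.
  have := subrXX (emb b) (emb x) p.-1; rewrite !(embF_fermat p_pr chF) // subrr.
  move/(congr1 (fun z => emb b * z)); rewrite mulr0 mulrCA mulr_sumr => S0.
  rewrite -mulr_sumr [RHS]S0; congr (_ * _).
  rewrite (reindex_inj rev_ord_inj) /=; apply: eq_bigr => k _.
  have := ltn_ord k => kp; rewrite mulrA -exprS.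
  by congr (_ ^+ _ * _ ^+ _); lia.
under eq_bigr => x _ do rewrite inner.
rewrite (bigD1 0) //= (bigD1 b) //= big1 ?addr0; last first.
  by move=> x /andP[/negPf -> /negPf ->]; rewrite subrr scale0r.
rewrite !eqxx (negPf b0) eq_sym (negPf b0) subr0 sub0r scale1r scaleN1r.
by rewrite unip0 repr_mx1 opprD opprK addrC.
Qed.

Lemma fact_neq0 k : (k < p)%N -> (k`!%:R : F) != 0.
Proof.
elim: k => [|k IH] kp; first by rewrite oner_neq0.
by rewrite factS natrM mulf_neq0 ?IH ?(natF_neq0 chF) //; apply: ltnW.
Qed.

Lemma unip_exp (b : 'F_p) :
  r (unip b) = \sum_(k < p) (emb b ^+ k / k`!%:R) *: N ^+ k.
Proof.
have p3 := p_gt2 p_odd p_pr.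
rewrite unip_logdp -(big_mkord predT (fun k => (emb b ^+ k / k`!%:R) *: N ^+ k)).
rewrite [RHS]big_ltn; last lia.
rewrite expr0 expr0 mul1r invr1 scale1r; congr (_ + _).
apply: eq_big_nat => k kp; rewrite nilop_exp // scalerA divfK //.
by apply: fact_neq0; case/andP: kp.
Qed.

(** Conjugation by the torus element [a] maps [g^x] to the power [a ^ 2 x], and
    the coefficients of [N] are homogeneous of degree [-1] in [x]. *)
Lemma nilop_tor a : a != 0 -> r (tor a) *m N = emb a ^ 2 *: (N *m r (tor a)).
Proof.
move=> a0; rewrite /nilop /logdp mulmxN mulNmx scalerN; congr (- _).
rewrite mulmx_suml mulmx_sumr scaler_sumr.
have p3 := p_gt2 p_odd p_pr; have e0 : emb a != 0 by rewrite (embF_eq0 p_pr chF).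
rewrite [RHS](reindex_inj (mulfI (expf_neq0 2 a0))) /=; apply: eq_bigr => x _.
rewrite -scalemxAr -!scalemxAl scalerA -!repr_mxM ?tor_borel ?unip_borel //.
rewrite (tor_unip a0 erefl); congr (_ *: _).
rewrite (embFM chF) (embFX chF) exprMn mulrA -exprnP -exprM -exprD.
have -> : (2 + 2 * (p.-1 - 1) = p.-1 * 2)%N by lia.
by rewrite exprM (embF_fermat p_pr chF) // expr1n mul1r.
Qed.

Lemma weight_nilop m (v : 'M_(m, n)) c :
  weight r v c -> weight r (v *m N) (c - 2).
Proof.
move=> wv a a0; have e0 : emb a != 0 by rewrite (embF_eq0 p_pr chF).
have := congr1 (mulmx v) (nilop_tor a0); rewrite mulmxA wv // -scalemxAl.
rewrite -scalemxAr mulmxA expfzDr // => E.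
rewrite mulrC -scalerA E scalerA -expfzDr // addrC subrr expr0z scale1r.
by [].
Qed.

Lemma weight_nilopX m (v : 'M_(m, n)) c k :
  weight r v c -> weight r (v *m N ^+ k) (c - (2 * k)%N%:Z).
Proof.
elim: k => [|k IH] wv; first by rewrite expr0 mulmx1 subr0.
rewrite exprSr -[_ * _]/(_ *m _) mulmxA.
have -> : c - (2 * k.+1)%N%:Z = c - (2 * k)%N%:Z - 2 by lia.
by apply: weight_nilop; apply: IH.
Qed.

(** The torus projector onto the weight [c]; the sign is the inverse of the
    order [p - 1] of the torus. *)
Definition wproj c : 'M[F]_n :=
  - \sum_(a : 'F_p | a != 0) emb a ^ (- c) *: r (tor a).

Lemma wproj_weight m (v : 'M_(m, n)) c : weight r (v *m wproj c) c.
Proof.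
move=> b b0; have e0 : emb b != 0 by rewrite (embF_eq0 p_pr chF).
rewrite /wproj mulmxN mulNmx scalerN; congr (- _).
rewrite mulmx_sumr mulmx_suml scaler_sumr.
rewrite [RHS](reindex_inj (mulIf b0)) /=; apply: eq_big => [a|a a0].
  by rewrite mulf_eq0 negb_or b0 andbT.
have ea : emb a != 0 by rewrite (embF_eq0 p_pr chF).
rewrite -!scalemxAr -scalemxAl scalerA -mulmxA -repr_mxM ?tor_borel //.
rewrite torM //; congr (_ *: _).
by rewrite (embFM chF) expfzMl mulrCA -expfzDr // subrr expr0z mulr1.
Qed.

Lemma wproj_id m (v : 'M_(m, n)) c : weight r v c -> v *m wproj c = v.
Proof.
move=> wv; rewrite /wproj mulmxN mulmx_sumr.
rewrite (eq_bigr (fun=> v)) => [|a a0]; last first.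
  have ea : emb a != 0 by rewrite (embF_eq0 p_pr chF).
  by rewrite -scalemxAr wv // scalerA -expfzDr // addrC subrr expr0z scale1r.
rewrite sumr_const card_unitsFp // -scaler_nat -scaleNr -[RHS]scale1r.
congr (_ *: _); apply/eqP; rewrite eq_sym -subr_eq0 opprK -[1 in X in X + _]/(1%:R).
by rewrite -natrD add1n (natF_eq0 chF) prednK ?prime_gt0.
Qed.

End Rep.

Section Hom.
Variables (n1 n2 : nat) (r1 : mx_representation F (borel p) n1).
Variables (r2 : mx_representation F (borel p) n2) (f : 'M[F]_(n1, n2)).

Lemma nilop_hom : mxhom r1 r2 f -> nilop r1 *m f = f *m nilop r2.
Proof.
move=> hf; rewrite /nilop /logdp mulNmx mulmxN; congr (- _).
rewrite mulmx_suml mulmx_sumr; apply: eq_bigr => x _.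
by rewrite -scalemxAl -scalemxAr hf ?unip_borel.
Qed.

Lemma nilopX_hom k : mxhom r1 r2 f -> nilop r1 ^+ k *m f = f *m nilop r2 ^+ k.
Proof.
move/nilop_hom => hf; elim: k => [|k IH]; first by rewrite !expr0 mul1mx mulmx1.
by rewrite !mxpowSr -mulmxA hf mulmxA IH -mulmxA.
Qed.

Lemma weight_hom m (v : 'M_(m, n1)) c :
  mxhom r1 r2 f -> weight r1 v c -> weight r2 (v *m f) c.
Proof.
by move=> hf wv a a0; rewrite -mulmxA -hf ?tor_borel // mulmxA wv // -scalemxAl.
Qed.

(** The Borel subgroup is generated by the torus and by the exponentials of the
    multiples of the logarithm. *)
Lemma mxhom_borel :
  (forall a : 'F_p, a != 0 -> r1 (tor a) *m f = f *m r2 (tor a)) ->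
  nilop r1 *m f = f *m nilop r2 -> mxhom r1 r2 f.
Proof.
move=> hT hN _ /borelE[a [b [a0 ->]]]; rewrite !repr_mxM ?unip_borel ?tor_borel //.
rewrite -mulmxA hT // !mulmxA; congr (_ *m _).
have hX k : nilop r1 ^+ k *m f = f *m nilop r2 ^+ k.
  elim: k => [|k IH]; first by rewrite !expr0 mul1mx mulmx1.
  by rewrite !mxpowSr -mulmxA hN mulmxA IH -mulmxA.
rewrite !unip_exp mulmx_suml mulmx_sumr; apply: eq_bigr => k _.
by rewrite -scalemxAl -scalemxAr hX.
Qed.
End Hom.

Lemma nilop_module n (r : mx_representation F (borel p) n) m (U : 'M_(m, n)) :
  mxmodule r U -> (U *m nilop r <= U)%MS.
Proof.
move=> modU; rewrite /nilop /logdp mulmxN eqmx_opp mulmx_sumr.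
apply: summx_sub => x _; rewrite -scalemxAr scalemx_sub //.
exact: (mxmoduleP modU) (unip_borel x).
Qed.
End Nil.

(** * Filtrations with simple factors *)

Section Filtrations.
Variables (F : fieldType) (gT : finGroupType) (G : {group gT}).

(** A map from [r] that is equivariant modulo [U] and generates [V] over [U]
    becomes an isomorphism onto the section as soon as dimensions agree. *)
Lemma section_rsim n (rG : mx_representation F G n) (U V : 'M[F]_n)
    (modU : mxmodule rG U) (modV : mxmodule rG V)
    t (r : mx_representation F G t) (f : 'M[F]_(t, n)) :
  (U + f :=: V)%MS -> \rank V = (\rank U + t)%N ->
  (forall g, g \in G -> (r g *m f - f *m rG g <= U)%MS) ->
  mx_rsim r (section_repr modU modV).
Proof.
move=> defV rkV homf; set V' := <<in_factmod U V>>%MS.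
have sfV : (f <= V)%MS by rewrite -defV addsmxSr.
have sfV' : (in_factmod U f <= V')%MS by rewrite genmxE submxMr.
have rk : \rank V' = t.
  apply: (@addIn (\rank U)); rewrite genmxE mxrank_in_factmod.
  have sUV : (U <= V)%MS by rewrite -defV addsmxSl.
  by rewrite (addsmx_idPr sUV) rkV addnC.
exists (in_submod V' (in_factmod U f)) => // [|g Gg].
  rewrite /row_free mxrank_in_submod // -(in_factmod_addsK U f) in_factmodE.
  by rewrite (eqmxMr _ defV) -in_factmodE -rk genmxE.
rewrite -in_submodJ // -in_factmodJ //.
have -> : r g *m in_submod V' (in_factmod U f) =
    in_submod V' (in_factmod U (r g *m f)).
  by rewrite /in_submod /in_factmod /= !mulmxA.
congr in_submod; apply/eqP.
by rewrite -subr_eq0 -linearB /= in_factmod_eq0 homf.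
Qed.

(** A composition series given by maps from simple modules, each of them
    equivariant modulo the images of the previous ones. As the dimensions add up
    to the total one, the partial sums of the images have the expected ranks. *)
Lemma has_factors_filtration n (rG : mx_representation F G n) m (t : nat -> nat)
    (r : forall j, mx_representation F G (t j)) (f : forall j, 'M[F]_(t j, n)) :
  (forall j, (j < m)%N -> mx_irreducible (r j)) ->
  (forall j g, (j < m)%N -> g \in G ->
     (r j g *m f j - f j *m rG g <= \sum_(i < j) <<f i>>)%MS) ->
  (\sum_(j < m) t j = n)%N ->
  (1%:M <= \sum_(j < m) <<f j>>)%MS ->
  has_factors rG (mkseq (fun j => Representation (r j)) m).
Proof.
move=> irr homf sumt full.
pose S k := (\sum_(i < k) <<f i>>)%MS; pose T k := (\sum_(i < k) t i)%N.
have SS k : (S k.+1 :=: S k + f k)%MS.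
  by rewrite /S big_ord_recr /=; apply: adds_eqmx => //; apply: genmxE.
have rkS k : (\rank (S k) <= T k)%N.
  elim: k => [|k IH]; first by rewrite /S big_ord0 mxrank0.
  rewrite SS /T big_ord_recr /=; apply: leq_trans (mxrank_adds_leqif _ _) _.
  by apply: leq_add => //; apply: rank_leq_row.
have rkT k : (k <= m)%N -> \rank (S k) = T k.
  move=> km; apply/eqP; rewrite eqn_leq rkS /=.
  have H d : (\rank (S (k + d)) + T k <= \rank (S k) + T (k + d))%N.
    elim: d => [|d IH]; first by rewrite addn0.
    rewrite addnS SS /T big_ord_recr /=.
    have h1 := (mxrank_adds_leqif (S (k + d)%N) (f (k + d)%N)).1.
    have h2 := rank_leq_row (f (k + d)%N).
    rewrite -/(T (k + d)%N) -/(T k); move: h1 h2 IH.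
    by move: (\rank _) (\rank _) (\rank _) (\rank _); lia.
  have := H (m - k)%N; rewrite subnKC // {2}/T sumt.
  have : \rank (S m) = n by apply/eqP; rewrite -[_ == n]sub1mx.
  by move=> ->; rewrite addnC leq_add2r.
have modS k : (k <= m)%N -> mxmodule rG (S k).
  elim: k => [|k IH] km; first by rewrite /S big_ord0 mxmodule0.
  apply/mxmoduleP => g Gg; rewrite (eqmxMr _ (SS k)) SS addsmxMr addsmx_sub.
  have mS := IH (ltnW km); rewrite (submx_trans (mxmoduleP mS g Gg)) ?addsmxSl //=.
  have -> : f k *m rG g = r k g *m f k - (r k g *m f k - f k *m rG g).
    by rewrite opprB addrC subrK.
  rewrite addmx_sub // ?eqmx_opp; last by rewrite (submx_trans (homf _ _ _ _)) ?addsmxSl.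
  by rewrite (submx_trans (submxMl _ _)) ?addsmxSr.
pose W := mkseq (fun k => S k.+1) m.
have W0 k : (k <= m)%N -> (0 :: W)`_k = S k.
  case: k => [|k] km /=; first by rewrite /S big_ord0.
  by rewrite nth_mkseq.
have Wk k : (k < m)%N -> W`_k = S k.+1 by move=> km; rewrite nth_mkseq.
have sec k (km : (k < m)%N) modU modV :
    mx_rsim (r k) (@section_repr _ _ _ _ rG (0 :: W)`_k W`_k modU modV).
  apply: section_rsim (f k) _ _ _ => [||g Gg].
  - by rewrite W0 1?ltnW // Wk //; apply: eqmx_sym (SS k).
  - by rewrite W0 1?ltnW // Wk // !rkT // 1?ltnW // /T big_ord_recr.
  by rewrite W0 1?ltnW // homf.
have subW : mx_subseries rG W.
  by apply/(all_nthP 0) => k; rewrite size_mkseq => km; rewrite Wk // modS.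
have compW : mx_composition_series rG W.
  split=> // k; rewrite size_mkseq => km.
  apply/(max_submodP (mx_subseries_module' k subW) (mx_subseries_module k subW)).
    by rewrite W0 1?ltnW // Wk // SS addsmxSl.
  exact: mx_rsim_irr (sec k km _ _) (irr k km).
exists W, compW; split; first last.
- move=> k; rewrite size_mkseq => km; apply: mx_rsim_sym.
  by rewrite nth_mkseq //=; apply: sec.
- by rewrite !size_mkseq.
rewrite (last_nth 0) size_mkseq W0 //.
by apply/eqmxP; rewrite submx1 full.
Qed.

Lemma irr_dim1 (r : mx_representation F G 1) : mx_irreducible r.
Proof.
apply/mx_irrP; split=> // U _ nzU; rewrite /row_full eqn_leq rank_leq_row /=.
by rewrite lt0n mxrank_eq0.
Qed.

End Filtrations.

(** * The simple modules and the uniserial modules of the Borel subgroup *)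

Section Models.
Variables (p : nat) (F : fieldType).
Hypotheses (p_odd : odd p) (p_pr : prime p) (chF : p \in [pchar F]).
Local Notation emb := (@embF p F).
Local Notation gT := {'GL_2['F_p]}.
Local Notation Vmx := (@V_mx p F).

Lemma lform_l a : lform a 0 = a%:P%:P * 'X :> {poly {poly F}}.
Proof. by rewrite /lform polyC0 mul0r polyC0 addr0. Qed.

Lemma lform_r b : lform 0 b = (b%:P * 'X)%:P :> {poly {poly F}}.
Proof. by rewrite /lform !polyC0 mul0r add0r. Qed.

Lemma V_unipE t (b : 'F_p) i j :
  Vmx t (unip b) i j = emb b ^+ (i - j) *+ 'C(i, j).
Proof.
have [e1 e2 e3 e4] := unipE b; rewrite mxE e1 e2 e3 e4 embF0 embF1 /lform.
rewrite !polyC0 !mul0r add0r !polyC1 !mul1r -polyC_exp coefMC exprDn coef_sum.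
have ti := ltn_ord i; have tj := ltn_ord j.
rewrite (eq_bigr (fun k : 'I_i.+1 => if (j : nat) == (i - k)%N then
    (emb b ^+ (i - j) *+ 'C(i, j)) *: 'X^(i - j) else 0)); last first.
  move=> k _; rewrite coefMn -polyC_exp mulrC coefCM coefXn.
  have := ltn_ord k; rewrite ltnS => ki.
  case: eqVneq => [->|_]; last by rewrite mulr0 mul0rn.
  rewrite mulr1 exprMn -polyC_exp mul_polyC subKn // bin_sub // scalerMnl.
  by rewrite -scalerMnl.
have [ji|ij] := leqP j i.
  have h : (i - j < i.+1)%N by lia.
  rewrite (bigD1 (Ordinal h)) //= big1 ?addr0 => [|k]; last first.
    rewrite -val_eqE /= => ki; case: eqP => // jk; have := ltn_ord k.
    by move: ki; rewrite jk; lia.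
  rewrite subKn // eqxx mulrC coefXnM coefZ coefXn.
  rewrite (_ : (t.-1 - j < t.-1 - i)%N = false); last lia.
  by rewrite (_ : (t.-1 - j - (t.-1 - i) == i - j)%N = true) ?mulr1 //; lia.
rewrite bin_small // mulr0n big1 ?mul0r ?coef0 // => k _.
by case: eqP => // jk; lia.
Qed.

Lemma V_torE t (a : 'F_p) i j : a != 0 ->
  Vmx t (tor a) i j = (emb a ^ ((2 * i)%N%:Z - t%:Z + 1)) *+ (i == j).
Proof.
move=> a0; have [e1 e2 e3 e4] := torE a0.
have ea : emb a != 0 by rewrite (embF_eq0 p_pr chF).
rewrite mxE e1 e2 e3 e4 embF0 lform_l lform_r.
rewrite exprMn -!polyC_exp coefMC coefCM coefXn.
rewrite (embFV p_pr chF) [j == i :> nat]eq_sym.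
case: eqVneq => [ij|ij]; last by rewrite mulr0 mul0r coef0 (_ : (i == j) = false) //; apply/negbTE.
have -> : i = j by apply: val_inj.
rewrite eqxx mulr1 mulr1n exprMn -!polyC_exp !coefCM coefXn eqxx mulr1.
rewrite exprVn exprnN [X in X * _]exprnP -expfzDr //; congr (_ ^ _).
have := ltn_ord j; lia.
Qed.

Lemma V_weylE t (i j : 'I_t) : i = 0%N :> nat ->
  Vmx t (weyl p) i j = (-1) ^+ t.-1 *+ (j == t.-1 :> nat).
Proof.
have [e1 e2 e3 e4] := weylE p; move=> i0.
rewrite mxE e1 e2 e3 e4 i0 expr0 mul1r subn0 embF0 (embFN chF) embF1.
rewrite lform_l exprMn -!polyC_exp coefCM coefXn.
case: eqVneq => [->|_]; last by rewrite mulr0 coef0.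
by rewrite mulr1 subnn coefC.
Qed.

Lemma V_nilopE t : (t <= p)%N ->
  nilop (Vmx t) = \matrix_(i < t, j < t) (i%:R *+ (i == j.+1 :> nat)).
Proof.
move=> tp; apply/matrixP => i j; have p3 := p_gt2 p_odd p_pr.
have ti := ltn_ord i; have tj := ltn_ord j.
rewrite /nilop /logdp !mxE summxE.
under eq_bigr => x _ do rewrite mxE V_unipE mulrnAr -exprD.
rewrite sumrMnl (sum_embF_exp p_odd p_pr chF).
have [ji|ij] := leqP j i; last first.
  by rewrite bin_small // mulr0n oppr0 (_ : (i == j.+1 :> nat) = false) ?mulr0n //; lia.
have -> : (0 < p.-1 - 1 + (i - j))%N && (p.-1 %| p.-1 - 1 + (i - j))%N =
          (i == j.+1 :> nat).
  apply/andP/eqP => [[_ /dvdnP[q qE]]|->].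
    case: q qE => [|[|q]] qE; [lia | lia |].
    have : (2 * p.-1 <= q.+2 * p.-1)%N by rewrite leq_mul2r; lia.
    by lia.
  rewrite (_ : p.-1 - 1 + (j.+1 - j) = p.-1)%N ?dvdnn; last lia.
  by split=> //; lia.
case: eqP => [->|_]; last by rewrite mulr0n mul0rn oppr0.
by rewrite binSn mulr1n mulNrn opprK.
Qed.

(** The monomial [x ^ k y ^ (t - 1 - k)] of [V_t]; it is zero if [k >= t], which
    keeps the action of the nilpotent operator uniform. *)
Definition monv t k : 'rV[F]_t := \row_(j < t) (j == k :> nat)%:R.

Lemma monv_delta t (i : 'I_t) : monv t i = delta_mx 0 i.
Proof. by apply/rowP => j; rewrite !mxE. Qed.

Lemma monv_row t m (A : 'M[F]_(t, m)) (i : 'I_t) : monv t i *m A = row i A.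
Proof. by rewrite monv_delta -rowE. Qed.

Lemma monv_nilop t k : (k < t <= p)%N ->
  monv t k *m nilop (Vmx t) = k%:R *: monv t k.-1.
Proof.
case/andP=> kt tp; rewrite (monv_row _ (Ordinal kt)) V_nilopE //.
apply/rowP => j; rewrite !mxE /=; case: k kt => [|k] kt.
  by rewrite mul0r mul0rn.
by rewrite eqSS eq_sym mulr_natr.
Qed.

Lemma monv_nilopX t k j : (k < t <= p)%N ->
  monv t k *m nilop (Vmx t) ^+ j = (k ^_ j)%:R *: monv t (k - j).
Proof.
case/andP=> kt tp; elim: j => [|j IH].
  by rewrite expr0 mulmx1 ffactn0 scale1r subn0.
rewrite mxpowSr mulmxA IH -scalemxAl monv_nilop; last by rewrite tp andbT; lia.
rewrite scalerA -natrM -ffactnSr; congr (_ *: monv _ _); lia.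
Qed.

Lemma monv_tor t k a : (k < t)%N -> a != 0 ->
  monv t k *m Vmx t (tor a) = emb a ^ ((2 * k)%N%:Z - t%:Z + 1) *: monv t k.
Proof.
move=> kt a0; rewrite (monv_row _ (Ordinal kt)); apply/rowP => j.
rewrite mxE V_torE // !mxE /= -val_eqE /= eq_sym.
by case: eqP; rewrite ?mulr1 ?mulr0.
Qed.

Lemma monv_weyl t : (0 < t)%N ->
  monv t 0 *m Vmx t (weyl p) = (-1) ^+ t.-1 *: monv t t.-1.
Proof.
move=> t0; rewrite (monv_row _ (Ordinal t0)); apply/rowP => j.
by rewrite mxE V_weylE // !mxE mulr_natr.
Qed.

Lemma monv_sum t (u : 'rV[F]_t) : u = \sum_(i < t) u 0 i *: monv t i.
Proof. by rewrite {1}[u]row_sum_delta; apply: eq_bigr => i _; rewrite monv_delta. Qed.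

(** The uniserial module [U_{a,b}] is a twist of the restriction of [V_b]. *)
Definition Umx (a : int) b (g : gT) : 'M[F]_b :=
  emb (GLval g 0 0) ^ (a + b%:Z - 1) *: Vmx b g.

Lemma Umx_repr a b : mx_repr (borel p) (Umx a b).
Proof.
have [V1 VM] := V_mx_repr chF b.
split=> [|x y Bx By]; first by rewrite /Umx V1 GL_1E mxE embF1 exp1rz scale1r.
have Sx := subsetP (borel_sub p) x Bx; have Sy := subsetP (borel_sub p) y By.
rewrite /Umx VM // -scalemxAl -scalemxAr scalerA mul2E; congr (_ *: _).
move: By; rewrite inE => /andP[_ /eqP ->].
by rewrite mulr0 addr0 (embFM chF) expfzMl.
Qed.

Definition Umod a b := MxRepresentation (Umx_repr a b).

Lemma Umx_nilop a b : nilop (Umx a b) = nilop (Vmx b).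
Proof.
rewrite /nilop /logdp; congr (- _); apply: eq_bigr => x _.
by have [e1 _ _ _] := unipE x; rewrite /Umx e1 embF1 exp1rz scale1r.
Qed.

Lemma Umx_tor a b k (c : 'F_p) : (k < b)%N -> c != 0 ->
  monv b k *m Umx a b (tor c) = emb c ^ (a + (2 * k)%N%:Z) *: monv b k.
Proof.
move=> kb c0; have [e1 _ _ _] := torE c0; rewrite /Umx e1 -scalemxAr.
rewrite monv_tor // scalerA -expfzDr ?(embF_eq0 p_pr chF) //.
by congr (_ ^ _ *: _); lia.
Qed.

(** The linear map sending [x ^ (b - 1 - j) y ^ j] to the multiple of
    [v N ^ j] for which it commutes with the nilpotent operators, whenever
    [v N ^ b = 0]: on [V_b] the operator is [y d/dx], so that
    [x ^ (b - 1) N ^ j] is a falling factorial times [x ^ (b - 1 - j) y ^ j]. *)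
Definition orbmx n (N : 'M[F]_n) (v : 'rV_n) b : 'M_(b, n) :=
  \matrix_(i < b) ((b.-1 ^_ (b.-1 - i))%:R^-1 *: (v *m N ^+ (b.-1 - i))).

Lemma monv_orbmx n (N : 'M[F]_n) v b k : (k < b)%N ->
  monv b k *m orbmx N v b = (b.-1 ^_ (b.-1 - k))%:R^-1 *: (v *m N ^+ (b.-1 - k)).
Proof. by move=> kb; rewrite (monv_row _ (Ordinal kb)) rowK. Qed.

Lemma ffact_neq0 m k : (k <= m < p)%N -> ((m ^_ k)%:R : F) != 0.
Proof.
case/andP=> km mp; apply: contraNneq (fact_neq0 chF mp) => m0.
by rewrite -(ffact_fact km) natrM m0 mul0r.
Qed.

Lemma orbmx_top n (N : 'M[F]_n) v b : (0 < b)%N ->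
  monv b b.-1 *m orbmx N v b = v.
Proof.
move=> b0; rewrite monv_orbmx ?prednK // subnn ffactn0 invr1 scale1r.
by rewrite expr0 mulmx1.
Qed.

Lemma orbmx_pow n (N : 'M[F]_n) v b j : (j < b <= p)%N ->
  v *m N ^+ j = (b.-1 ^_ j)%:R *: (monv b (b.-1 - j) *m orbmx N v b).
Proof.
case/andP=> jb bp; rewrite monv_orbmx; last lia.
rewrite (_ : b.-1 - (b.-1 - j) = j)%N; last lia.
by rewrite scalerA divff ?scale1r // ffact_neq0 //; lia.
Qed.

Lemma orbmx_sub n (N : 'M[F]_n) v b j : (j < b <= p)%N ->
  (v *m N ^+ j <= orbmx N v b)%MS.
Proof. by move=> jb; rewrite (orbmx_pow N v jb) scalemx_sub // submxMl. Qed.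

Lemma orbmx_subP n (N : 'M[F]_n) v b m (U : 'M_(m, n)) :
  (forall j, (j < b)%N -> (v *m N ^+ j <= U)%MS) -> (orbmx N v b <= U)%MS.
Proof.
move=> sU; apply/row_subP => i; rewrite rowK scalemx_sub // sU //.
by have := ltn_ord i; lia.
Qed.

Lemma weightE n (r : gT -> 'M[F]_n) m (v : 'M_(m, n)) w w' :
  (w = w' %[mod p.-1])%Z -> weight r v w -> weight r v w'.
Proof. by move=> e wv a a0; rewrite wv // (expz_fermat p_pr chF a0 e). Qed.

Lemma weight_sub n (r : gT -> 'M[F]_n) m (u v : 'M_(m, n)) w :
  weight r u w -> weight r v w -> weight r (u - v) w.
Proof. by move=> wu wv a a0; rewrite mulmxBl wu // wv // scalerBr. Qed.

Lemma weight_scale n (r : gT -> 'M[F]_n) m (v : 'M_(m, n)) w c :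
  weight r v w -> weight r (c *: v) w.
Proof. by move=> wv a a0; rewrite -scalemxAl wv // !scalerA mulrC. Qed.

(** [U_(a,b)] is the universal module generated by a vector of weight
    [a + 2 (b - 1)] killed by the [b]-th power of the nilpotent operator. *)
Lemma orbmx_hom n (r : mx_representation F (borel p) n) (v : 'rV_n) a b w :
  (b <= p)%N -> weight r v w -> v *m nilop r ^+ b = 0 ->
  (w = a + (2 * b.-1)%N%:Z %[mod p.-1])%Z ->
  mxhom (Umod a b) r (orbmx (nilop r) v b).
Proof.
move=> bp wv vb0 wE; apply: (mxhom_borel p_odd p_pr chF) => [c c0|].
  apply/row_matrixP => i; rewrite !row_mul; have ib := ltn_ord i.
  rewrite -(monv_row (Umod a b (tor c))) Umx_tor // -scalemxAl.
  rewrite -monv_row monv_orbmx // -scalemxAl.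
  rewrite (weight_nilopX p_odd p_pr chF _ (weightE wE wv)) //.
  rewrite !scalerA mulrC; congr (_ * _ ^ _ *: _); lia.
rewrite Umx_nilop; apply/row_matrixP => i; rewrite !row_mul.
have ib := ltn_ord i; rewrite -(monv_row (nilop _)) monv_nilop; last by rewrite ib.
rewrite -monv_row monv_orbmx // -!scalemxAl -mulmxA -mxpowSr.
have [i0|i0] := posnP i.
  rewrite i0 scale0r subn0 prednK ?vb0 ?scaler0 //; lia.
rewrite monv_orbmx; last lia.
rewrite scalerA (_ : (b.-1 - i.-1 = (b.-1 - i).+1)%N); last lia.
congr (_ *: _); rewrite ffactnSr subKn; last lia.
by rewrite natrM invfM mulrCA divff ?mulr1 // (natF_neq0 chF) //; lia.
Qed.

Definition flag t k : 'M[F]_t := (\sum_(i < k) <<monv t i>>)%MS.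

Lemma flagP t k (u : 'rV_t) :
  reflect (forall j : 'I_t, (k <= j)%N -> u 0 j = 0) (u <= flag t k)%MS.
Proof.
apply: (iffP idP) => [/sub_sumsmxP[c ->] j kj|u0].
  rewrite summxE big1 // => i _; have := submxMl (c i) <<monv t i>>%MS.
  rewrite genmxE => /sub_rVP[d ->]; rewrite !mxE (_ : (j == i :> nat) = false) ?mulr0 //.
  by have := ltn_ord i; lia.
rewrite (monv_sum u); apply: summx_sub => i _.
have [ki|ik] := leqP k i; first by rewrite u0 // scale0r sub0mx.
by rewrite scalemx_sub // (sumsmx_sup (Ordinal ik)) // genmxE.
Qed.

Lemma flagS t k : (flag t k.+1 :=: flag t k + monv t k)%MS.
Proof. by rewrite /flag big_ord_recr /=; apply: adds_eqmx => //; apply: genmxE. Qed.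

Lemma sub_flag t j k : (j <= k)%N -> (flag t j <= flag t k)%MS.
Proof.
move=> jk; apply/row_subP => i; apply/flagP => l kl.
by move/flagP: (row_sub i (flag t j)) => h; apply: h; apply: leq_trans kl.
Qed.

Lemma flag_full t : (flag t t :=: 1%:M)%MS.
Proof.
apply/eqmxP; rewrite submx1; apply/row_subP => i; apply/flagP => j.
by have := ltn_ord j; lia.
Qed.

Lemma mulmx_nilopV t (u : 'rV_t) (j : 'I_t) : (t <= p)%N ->
  (u *m nilop (Vmx t)) 0 j =
    if insub j.+1 is Some i then u 0 i * j.+1%:R else 0.
Proof.
move=> tp; rewrite V_nilopE // mxE; case: insubP => [i _ ij|jt].
  rewrite (bigD1 i) //= mxE ij eqxx mulr1n big1 ?addr0 // => l li.
  by rewrite mxE -ij (inj_eq val_inj) (negPf li) mulr0n mulr0.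
rewrite big1 // => l _; rewrite mxE; case: eqP => [lj|]; last by rewrite mulr0n mulr0.
by have := ltn_ord l; rewrite lj (negPf jt).
Qed.

(** The nilpotent operator lowers the degree in [x] by exactly one, the degrees
    being below [p]. So a vector of degree [k] yields vectors of all smaller
    degrees, and elimination gives the monomials themselves. *)
Lemma flag_gen t m (U : 'M_(m, t)) k (u : 'rV_t) : (k < t <= p)%N ->
  (U *m nilop (Vmx t) <= U)%MS -> (u <= U)%MS -> (u <= flag t k.+1)%MS ->
  ~~ (u <= flag t k)%MS -> (flag t k.+1 <= U)%MS.
Proof.
case/andP=> kt tp UN; elim: k kt u => [|k IH] kt u uU uk nuk.
  rewrite /flag big_ord1 genmxE.
  move/flagP: uk => uk; rewrite (monv_sum u) in nuk uU.
  have uE : \sum_(i < t) u 0 i *: monv t i = u 0 (Ordinal kt) *: monv t 0.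
    rewrite (bigD1 (Ordinal kt)) //= big1 ?addr0 // => i i0.
    by rewrite uk ?scale0r // lt0n.
  rewrite uE in nuk uU; have u0 : u 0 (Ordinal kt) != 0.
    by apply: contraNneq nuk => ->; rewrite scale0r sub0mx.
  by rewrite -(eqmx_scale _ u0).
pose K := Ordinal kt; have kt' := ltnW kt.
have uK : u 0 K != 0.
  apply: contraNneq nuk => uK; apply/flagP => j; rewrite leq_eqVlt => /predU1P[kj|].
    by rewrite -uK; congr (u _ _); apply: val_inj.
  exact: (flagP _ _ uk).
have sfU : (flag t k.+1 <= U)%MS.
  apply: (IH kt' (u *m nilop (Vmx t))).
  - by apply: submx_trans UN; apply: submxMr.
  - apply/flagP => j kj; rewrite mulmx_nilopV //; case: insubP => // i _ ij.
    by rewrite (flagP _ _ uk) ?mul0r // ij.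
  apply/negP => /flagP/(_ (Ordinal kt') (leqnn _))/eqP.
  rewrite mulmx_nilopV //; case: insubP => [l _ lk|]; last by rewrite kt.
  have -> : l = K by apply: val_inj.
  by apply/negP; rewrite mulf_neq0 // (natF_neq0 chF) //= (leq_trans kt tp).
rewrite flagS addsmx_sub sfU /=.
have -> : monv t k.+1 = (u 0 K)^-1 *: (u - \sum_(i < t | i != K) u 0 i *: monv t i).
  by rewrite {2}(monv_sum u) (bigD1 K) //= addrK scalerA mulVf ?scale1r.
rewrite scalemx_sub // addmx_sub // eqmx_opp summx_sub // => i iK.
have [ki|ik] := leqP k.+2 i; first by rewrite (flagP _ _ uk) // scale0r sub0mx.
have ik' : (i < k.+1)%N by move: iK ik; rewrite -val_eqE /=; lia.
by rewrite scalemx_sub // (submx_trans _ sfU) // (sumsmx_sup (Ordinal ik')) ?genmxE.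
Qed.

(** The operator is a single nilpotent Jordan block, hence its invariant
    subspaces form a chain. *)
Lemma nilop_sub_flag t m (U : 'M_(m, t)) : (t <= p)%N ->
  (U *m nilop (Vmx t) <= U)%MS -> exists2 k, (k <= t)%N & (U :=: flag t k)%MS.
Proof.
move=> tp UN; have ex : exists k, (U <= flag t k)%MS.
  by exists t; rewrite flag_full submx1.
case: (ex_minnP ex) => -[|k] sUk mink.
  by exists 0%N => //; apply/eqmxP; rewrite sUk /flag big_ord0 sub0mx.
have kt : (k < t)%N by apply: mink; rewrite flag_full submx1.
exists k.+1 => //; apply/eqmxP; rewrite sUk /=.
have /row_subPn[i ni] : ~~ (U <= flag t k)%MS by apply/negP => /mink; rewrite ltnn.
apply: flag_gen ni => //; first by rewrite kt.
- exact: row_sub.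
exact: submx_trans (row_sub _ _) sUk.
Qed.

(** The modules [V_t], [1 <= t <= p], are simple: a nonzero submodule is a
    member of the flag, hence contains the lowest monomial, which the Weyl
    element moves to the highest one. *)
Lemma Vmod_irr t : (0 < t <= p)%N -> mx_irreducible (Vmod chF t).
Proof.
case/andP=> t0 tp; apply/mx_irrP; split=> // U modU nzU.
have UN : (U *m nilop (Vmx t) <= U)%MS.
  pose rB := subg_repr (Vmod chF t) (borel_sub p).
  apply: (@nilop_module _ _ _ rB).
  apply/mxmoduleP => x Bx; exact: (mxmoduleP modU x (subsetP (borel_sub p) x Bx)).
have [k kt defU] := nilop_sub_flag tp UN.
have k0 : (0 < k)%N.
  by case: k defU kt => // defU; rewrite -mxrank_eq0 defU /flag big_ord0 mxrank0 in nzU.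
have m0 : (monv t 0 <= U)%MS.
  by rewrite defU (sumsmx_sup (Ordinal k0)) ?genmxE.
have mt : (monv t t.-1 <= U)%MS.
  have := mxmoduleP modU _ (weyl_SL2 p) => /(submx_trans (submxMr _ m0)).
  rewrite [X in (X <= _)%MS](monv_weyl t0).
  by rewrite eqmx_scale ?signr_eq0.
have kE : k = t.
  apply/eqP; rewrite eqn_leq kt leqNgt; apply/negP => ltkt.
  have tt : (t.-1 < t)%N by rewrite prednK.
  move: mt; rewrite defU => /flagP/(_ (Ordinal tt)) /=.
  by rewrite mxE eqxx => /(_ _)/eqP; rewrite oner_eq0 => h; have := h _; lia.
by rewrite -sub1mx defU kE flag_full submx1.
Qed.

Lemma Umod_uniserial a b : (b <= p)%N -> uniserial (Umod a b).
Proof.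
move=> bp U V modU modV.
have H W : mxmodule (Umod a b) W -> (W *m nilop (Vmx b) <= W)%MS.
  by move/nilop_module; rewrite Umx_nilop.
have [j _ defU] := nilop_sub_flag bp (H _ _ modU).
have [k _ defV] := nilop_sub_flag bp (H _ _ modV).
case: (leqP j k) => jk; [left | right]; rewrite defU defV sub_flag //.
exact: ltnW.
Qed.

(** On the [j]-th step of the flag the unipotent elements act trivially and the
    torus by the weight [a + 2 j]. *)
Lemma Umod_factor a b j g : (j < b)%N -> g \in borel p ->
  (S_mx F (a + (2 * j)%N%:Z) g *m monv b j - monv b j *m Umod a b g
     <= flag b j)%MS.
Proof.
move=> jb /borelE[x [y [x0 ->]]].
have [e1 e2 e3 e4] := torE x0; have [f1 f2 f3 f4] := unipE y.
rewrite /S_mx mul2E f1 f2 e1 e3 mulr0 addr0 mul1r mul_scalar_mx.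
rewrite repr_mxM ?unip_borel ?tor_borel // mulmxA.
set w := monv b j *m Umod a b (unip y).
have wE : (w - monv b j <= flag b j)%MS.
  apply/flagP => l jl; rewrite mxE.
  have -> : w 0 l = emb y ^+ (j - l) *+ 'C(j, l).
    by rewrite /w (monv_row _ (Ordinal jb)) mxE /= /Umx mxE f1 embF1 exp1rz mul1r V_unipE.
  rewrite !mxE; case: eqVneq => [->|lj].
    by rewrite subnn binn mulr1n expr0 subrr.
  by rewrite bin_small ?mulr0n ?subr0 // ltn_neqAle eq_sym lj.
rewrite -[w](subrK (monv b j)) mulmxDl Umx_tor // opprD addrCA subrr addr0.
rewrite eqmx_opp; apply: submx_trans (submxMr _ wE) _.
rewrite /flag sumsmxMr; apply/sumsmx_subP => i _.
have ij := ltn_ord i; rewrite (eqmxMr _ (genmxE _)) Umx_tor ?(ltn_trans ij) //.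
by rewrite scalemx_sub // (sumsmx_sup i) // genmxE.
Qed.

Lemma Umod_is_U a b : (b <= p)%N -> is_U chF a b (Umod a b).
Proof.
move=> bp; split; first exact: Umod_uniserial.
rewrite -/(mkseq (fun k => Representation (Smod chF (a + (2 * k)%N%:Z))) b).
apply: (has_factors_filtration (t := fun=> 1%N) (f := monv b)) => [j _|j g jb Bg||].
- exact: irr_dim1.
- exact: Umod_factor.
- by rewrite sum1_card card_ord.
by rewrite -/(flag b b) flag_full.
Qed.

End Models.

(** * Nonsplit extensions of simple modules, restricted to the Borel subgroup *)

Section RelativeTrace.
Variables (F : fieldType) (gT : finGroupType) (G H : {group gT}).
Hypothesis sHG : H \subset G.

(** Averaging over the cosets of a subgroup of invertible index turns a section
    over the subgroup into a section over the whole group. *)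
Lemma relative_section n m (rM : mx_representation F G n)
    (rV : mx_representation F G m) (f : 'M[F]_(n, m)) (s : 'M[F]_(m, n)) :
  (#|G : H|%g%:R : F) != 0 -> mxhom rM rV f -> s *m f = 1%:M ->
  (forall h, h \in H -> rV h *m s = s *m rM h) ->
  exists2 s', mxhom rV rM s' & s' *m f = 1%:M.
Proof.
move=> ind0 homf sf homs.
pose c x := rV x^-1%g *m s *m rM x.
have cH h x : h \in H -> x \in G -> c (h * x)%g = c x.
  move=> Hh Gx; have Gh := subsetP sHG h Hh.
  rewrite /c invMg !repr_mxM ?groupV // -!mulmxA; congr (_ *m _).
  rewrite !mulmxA -[_ *m s *m _]mulmxA -homs // mulmxA -repr_mxM ?groupV //.
  by rewrite mulVg repr_mx1 mul1mx.
have cG g x : g \in G -> x \in G -> c x *m rM g = rV g *m c (x * g)%g.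
  move=> Gg Gx; rewrite /c invMg !repr_mxM ?groupV // !mulmxA.
  by rewrite -repr_mxM ?groupV // mulgV repr_mx1 mul1mx.
pose S := \sum_(X in rcosets H G) c (repr X).
have reprG X : X \in rcosets H G -> repr X \in G /\ X = (H :* repr X)%g.
  case/rcosetsP=> x Gx ->; split; last by rewrite rcoset_repr.
  have /rcosetP[h Hh ->] := mem_repr_rcoset H x.
  by rewrite groupM // (subsetP sHG).
exists (#|G : H|%g%:R^-1 *: S) => [g Gg|].
  rewrite -scalemxAr -scalemxAl; congr (_ *: _).
  rewrite mulmx_sumr mulmx_suml.
  have injg : injective (fun X : {set gT} => X :* g)%g.
    by apply: (can_inj (g := fun X => (X :* g^-1)%g)) => X; rewrite -rcosetM mulgV rcoset1.
  rewrite [LHS](reindex_inj injg) /=; apply: eq_big => [X|X].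
    apply/rcosetsP/rcosetsP=> [[x Gx E]|[x Gx ->]].
      exists (x * g^-1)%g; first by rewrite groupM ?groupV.
      by rewrite rcosetM -E -rcosetM mulgV rcoset1.
    by exists (x * g)%g; rewrite ?groupM // rcosetM.
  case/rcosetsP=> x Gx XgE.
  have XE : X = (H :* (x * g^-1))%g by rewrite rcosetM -XgE -rcosetM mulgV rcoset1.
  have [Gr Xr] : repr X \in G /\ X = (H :* repr X)%g.
    by apply: reprG; apply/rcosetsP; exists (x * g^-1)%g; rewrite ?groupM ?groupV.
  rewrite cG //; congr (_ *m _).
  rewrite {1}Xr -rcosetM; have /rcosetP[h Hh ->] := mem_repr_rcoset H (repr X * g)%g.
  by rewrite cH // groupM.
rewrite -scalemxAl mulmx_suml (eq_bigr (fun=> 1%:M)) => [|X /reprG[Gx _]].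
  by rewrite sumr_const -/(#|G : H|%g) -scaler_nat scalerA mulVf ?scale1r.
rewrite /c -!mulmxA homf // (mulmxA s) sf mul1mx.
by rewrite -repr_mxM ?groupV // mulVg repr_mx1.
Qed.

End RelativeTrace.

Section Link.
Variables (p : nat) (F : fieldType).
Hypotheses (p_odd : odd p) (p_pr : prime p) (chF : p \in [pchar F]).
Local Notation emb := (@embF p F).
Local Notation gT := {'GL_2['F_p]}.
Local Notation Vmx := (@V_mx p F).

(** The order of [GL_2] contains [p] only to the first power, and [p] already
    divides the order of the Borel subgroup. *)
Lemma borel_index_neq0 : (#|SL2 p : borel p|%g%:R : F) != 0.
Proof.
rewrite (natF_eq0 chF); apply/negP => dv.
have ord1 : #[unip (1%R : 'F_p)]%g = p.
  apply: nt_prime_order => //.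
    have H k : (unip (1%R : 'F_p) ^+ k)%g = unip k%:R.
      by elim: k => [|k IH]; rewrite ?expg0 ?unip0 // expgS IH unipD -natr1 addrC.
    by rewrite H (pchar_Fp_0 p_pr) unip0.
  apply/negP => /eqP u1; have [_ e2 _ _] := unipE (1 : 'F_p).
  by move: e2; rewrite u1 GL_1E mxE /= => /eqP; rewrite eq_sym oner_eq0.
have dvB : (p %| #|borel p|)%N by rewrite -{1}ord1 order_dvdG ?unip_borel.
have dv2 : (p ^ 2 %| #|'GL_2['F_p]%g|)%N.
  apply: dvdn_trans (cardSg (subsetT (SL2 p))).
  by rewrite -(Lagrange (borel_sub p)) dvdn_mul.
have := logn_card_GL_p 2 p_pr; rewrite binn => lg.
by move: dv2; rewrite pfactor_dvdn ?lg // cardG_gt0.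
Qed.

Section Extension.
Variables (n t t' : nat) (rM : mx_representation F (SL2 p) n).
Variables (f : 'M[F]_(n, t)) (h : 'M[F]_(t', n)).
Hypotheses (t0 : (0 < t)%N) (t'0 : (0 < t')%N) (nE : n = (t + t')%N).
Hypotheses (uniM : uniserial rM).
Hypotheses (homf : mxhom rM (Vmod chF t) f) (homh : mxhom (Vmod chF t') rM h).
Hypotheses (epif : row_full f) (monoh : row_free h).
Local Notation rB := (subg_repr rM (borel_sub p)).
Local Notation N := (nilop rB).

(** By uniseriality the kernel of [f] and the image of [h] are comparable, and
    they have the same dimension. *)
Lemma extension_exact : (kermx f :=: h)%MS.
Proof.
have rkk : \rank (kermx f) = t'.
  by rewrite mxrank_ker (eqP epif) nE addKn.
have modk : mxmodule rM (kermx f).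
  apply/mxmoduleP => g Gg; apply/sub_kermxP.
  by rewrite -mulmxA homf // mulmxA mulmx_ker mul0mx.
have modh : mxmodule rM <<h>>%MS.
  rewrite (eqmx_module _ (genmxE _)); apply/mxmoduleP => g Gg.
  by rewrite -homh // submxMl.
have rkh : \rank <<h>>%MS = t' by rewrite genmxE (eqP monoh).
have eqK : (kermx f == <<h>>)%MS.
  case: (uniM modk modh) => sub; first by rewrite -(mxrank_leqif_eq sub) rkk rkh.
  by rewrite andbC -(mxrank_leqif_eq sub) rkk rkh.
exact: eqmx_trans (eqmxP eqK) (genmxE h).
Qed.

Lemma extension_comp0 : h *m f = 0.
Proof. by apply/sub_kermxP; rewrite extension_exact. Qed.

(** Averaging would turn a section over the Borel subgroup into one over the
    whole group, whose image is incomparable with that of [h]. *)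
Lemma extension_nonsplit (s : 'M[F]_(t, n)) : s *m f = 1%:M ->
  (forall g, g \in borel p -> Vmod chF t g *m s = s *m rM g) -> False.
Proof.
move=> sf homs.
have [s' homs' s'f] := relative_section (borel_sub p) borel_index_neq0 homf sf homs.
have mods : mxmodule rM <<s'>>%MS.
  rewrite (eqmx_module _ (genmxE _)); apply/mxmoduleP => g Gg.
  by rewrite -homs' // submxMl.
have modh : mxmodule rM <<h>>%MS.
  rewrite (eqmx_module _ (genmxE _)); apply/mxmoduleP => g Gg.
  by rewrite -homh // submxMl.
have := uniM mods modh; rewrite !genmxE => -[/submxP[A s'E]|/submxP[A hE]].
  have := s'f; rewrite s'E -mulmxA extension_comp0 mulmx0 => /(congr1 mxrank).
  by rewrite mxrank0 mxrank1; lia.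
have := extension_comp0; rewrite hE -mulmxA s'f mulmx1 => A0.
by have := monoh; rewrite /row_free hE A0 mul0mx mxrank0; lia.
Qed.

(** The torus is diagonal in the monomial basis, and it sees weights modulo
    [p - 1] only. *)
Lemma weight_coef d (z : 'rV[F]_d) w (i : 'I_d) :
  weight (Vmx d) z w -> z 0 i != 0 ->
  (w = (2 * i)%N%:Z - d%:Z + 1 %[mod p.-1])%Z.
Proof.
move=> wz zi; apply: (expz_inj p_odd p_pr chF) => a a0.
apply: (mulIf zi); have := congr1 (fun A : 'rV_d => A 0 i) (wz a a0).
rewrite !mxE (bigD1 i) //= V_torE // eqxx mulr1n big1 ?addr0 => [|j ji].
  by rewrite mulrC => <-.
by rewrite (V_torE p_odd p_pr chF) // (negPf ji) mulr0n mulr0.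
Qed.

Lemma wproj_hom n1 n2 (r1 : mx_representation F (borel p) n1)
    (r2 : mx_representation F (borel p) n2) k c :
  mxhom r1 r2 k -> wproj r1 c *m k = k *m wproj r2 c.
Proof.
move=> homk; rewrite /wproj mulNmx mulmxN; congr (- _).
rewrite mulmx_suml mulmx_sumr; apply: eq_bigr => x x0.
by rewrite -scalemxAl -scalemxAr homk ?tor_borel.
Qed.

Lemma resV_hom d n1 (r : mx_representation F (SL2 p) n1) (k : 'M[F]_(d, n1)) :
  mxhom (Vmod chF d) r k ->
  mxhom (subg_repr (Vmod chF d) (borel_sub p)) (subg_repr r (borel_sub p)) k.
Proof. by move=> homk g Bg; apply: homk; apply: (subsetP (borel_sub p)). Qed.

(** A nonsplit extension of [V_t] by [V_t'] with [t + t' = p - 1] or [p + 1]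
    restricts to a nonsplit extension for the Borel subgroup, and weights leave
    a single possibility for [v N ^ t] when [v] is a suitable lift of
    [x ^ (t - 1)]. *)
Lemma extension_link d : (d <= 1)%N -> (t + t' = p.-1 + 2 * d)%N -> (t < p)%N ->
  exists v : 'rV[F]_n, exists2 a : F, a != 0 &
    [/\ weight rM v (t.-1%:Z), v *m f = monv F t t.-1 &
        v *m N ^+ t = a *: (monv F t' (t'.-1 - d) *m h)].
Proof.
move=> d1 tt' tp; have p3 := p_gt2 p_odd p_pr.
have rBf : mxhom rB (subg_repr (Vmod chF t) (borel_sub p)) f.
  by move=> g Bg; apply: homf; apply: (subsetP (borel_sub p)).
have rBh := resV_hom homh.
pose VB k := subg_repr (Vmod chF k) (borel_sub p).
have wtop k : (0 < k)%N -> weight (VB k) (monv F k k.-1) (k.-1%:Z).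
  move=> k0 c c0; rewrite /= (monv_tor p_odd p_pr chF) ?prednK //.
  by congr (_ ^ _ *: _); lia.
(* The torus projector is equivariant: applied to any lift of the top monomial
   it gives one which is a weight vector. *)
have [v0 wv0 v0f] : exists2 v0, weight rB v0 (t.-1%:Z) & v0 *m f = monv F t t.-1.
  have /submxP[m mE] : (monv F t t.-1 <= f)%MS by rewrite submx_full.
  exists (m *m wproj rB (t.-1%:Z)); first exact: (wproj_weight p_pr chF).
  by rewrite -mulmxA (wproj_hom _ rBf) mulmxA -mE (wproj_id p_pr chF (wtop _ t0)).
have fN k : v0 *m N ^+ k *m f = monv F t t.-1 *m nilop (Vmx t) ^+ k.
  by rewrite -mulmxA (nilopX_hom _ rBf) mulmxA v0f.
have [z zE] : exists z, v0 *m N ^+ t = z *m h.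
  apply/submxP; rewrite -extension_exact; apply/sub_kermxP.
  by rewrite fN (monv_nilopX p_odd p_pr chF) ?ffact_small ?scale0r // ?prednK //; lia.
have hN y k : y *m nilop (Vmx t') ^+ k *m h = y *m h *m N ^+ k.
  by rewrite -mulmxA (nilopX_hom _ rBh) mulmxA.
have wz : weight (VB t') z (- t%:Z - 1).
  move=> c c0; apply: (row_free_inj monoh).
  rewrite -mulmxA rBh ?tor_borel // mulmxA -zE -scalemxAl -zE.
  rewrite (weight_nilopX p_odd p_pr chF _ wv0) //; congr (_ ^ _ *: _); lia.
pose j0 := (t'.-1 - d)%N; have t'p : (t' <= p)%N by lia.
have zN : z *m nilop (Vmx t') ^+ (p - t) = 0.
  apply: (row_free_inj monoh); rewrite hN -zE mul0mx -mulmxA -mxpowD.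
  rewrite subnKC ?(ltnW tp) //.
  by rewrite (nilop_expp p_odd p_pr chF) mulmx0.
(* For [d = 1] the weight of [z] also allows the last monomial, which
   [v0 N ^ p = 0] excludes. *)
have zlast (i : 'I_t') : d = 1%N -> i = t'.-1 :> nat -> z 0 i = 0.
  move=> dE it; have := congr1 (fun A : 'rV_t' => A 0 (Ordinal t'0)) zN.
  rewrite {1}(monv_sum z) mulmx_suml summxE (bigD1 i) //= big1 => [|l li].
    rewrite addr0 -scalemxAl (monv_nilopX p_odd p_pr chF) ?ltn_ord // !mxE it /=.
    rewrite (_ : t'.-1 - (p - t) = 0)%N; last lia.
    rewrite eqxx mulr1 => /eqP; rewrite mulf_eq0 (negPf (ffact_neq0 chF _)) ?orbF; last lia.
    by move/eqP.
  rewrite -scalemxAl (monv_nilopX p_odd p_pr chF) ?ltn_ord // ffact_small ?scale0r ?scaler0 ?mxE //.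
  by have := ltn_ord l; move: li; rewrite -val_eqE /= it; lia.
(* The weight of [z] is [- t - 1]. Apart from [j0] and the monomial excluded
   above, the monomials of this weight are multiples of images under [N ^ t] of
   other monomials. *)
have zsmall (i : 'I_t') : z 0 i != 0 -> i != j0 :> nat -> (i + t < t')%N.
  move=> zi ij; have := weight_coef wz zi => /eqP; rewrite eqz_mod_dvd => /dvdzP[q qE].
  have il := ltn_ord i.
  have nl : (d == 1%N) && (i == t'.-1 :> nat) = false.
    by apply/negP => /andP[/eqP e1 /eqP e2]; rewrite (zlast i) ?eqxx in zi.
  have q0 : (0 <= p.-1%:Z) by [].
  have [q_small|[q_1|q_big]] : (q <= -2 \/ q = -1 \/ 0 <= q) by lia.
  - by have := ler_wpM2r q0 q_small; lia.
  - by move: ij; rewrite /j0; lia.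
  by have := mulr_ge0 q_big q0; lia.
(* Hence subtracting [y h] from the lift clears all the coefficients of [z] but
   the one at [j0]. *)
pose y := \sum_(i < t' | i != j0 :> nat)
            (z 0 i / ((i + t) ^_ t)%:R) *: monv F t' (i + t).
have wy : weight (VB t') y (t.-1%:Z).
  move=> c c0; rewrite /y mulmx_suml scaler_sumr; apply: eq_bigr => i ij.
  have [->|zi] := eqVneq (z 0 i) 0; first by rewrite mul0r scale0r mul0mx scaler0.
  rewrite -scalemxAl /= (monv_tor p_odd p_pr chF) ?zsmall // scalerA [RHS]scalerA.
  rewrite mulrC; congr (_ * _ *: _); apply: (expz_fermat p_pr chF c0).
  have /eqP := weight_coef wz zi; rewrite eqz_mod_dvd => dv.
  apply/eqP; rewrite eqz_mod_dvd -rpredN; move: dv; congr (_ %| _)%Z; lia.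
have yN : y *m nilop (Vmx t') ^+ t = \sum_(i < t' | i != j0 :> nat) z 0 i *: monv F t' i.
  rewrite mulmx_suml; apply: eq_bigr => i ij.
  have [->|zi] := eqVneq (z 0 i) 0; first by rewrite mul0r !scale0r mul0mx.
  have it := zsmall i zi ij.
  rewrite -scalemxAl (monv_nilopX p_odd p_pr chF) ?it // addnK scalerA divfK //.
  by rewrite (ffact_neq0 chF) // leq_addl /=; lia.
have j0t : (j0 < t')%N by rewrite /j0; lia.
pose a := z 0 (Ordinal j0t); pose v := v0 - y *m h.
have wv : weight rB v (t.-1%:Z).
  by apply: weight_sub => //; apply: weight_hom rBh wy.
have vf : v *m f = monv F t t.-1.
  by rewrite mulmxBl v0f -mulmxA extension_comp0 mulmx0 subr0.
have vN : v *m N ^+ t = a *: (monv F t' j0 *m h).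
  rewrite mulmxBl zE -hN yN -mulmxBl {1}(monv_sum z) (bigD1 (Ordinal j0t)) //=.
  by rewrite (eq_bigl (fun i : 'I_t' => i != j0 :> nat)) // addrK -scalemxAl.
exists v, a; last by split.
(* If that coefficient were zero, [v] would generate a copy of [V_t] over the
   Borel subgroup. *)
apply/negP => /eqP a0; move: vN; rewrite a0 scale0r => vN0.
apply: (@extension_nonsplit (orbmx N v t)).
  apply/row_matrixP => i; rewrite row_mul -monv_row monv_orbmx ?ltn_ord //.
  rewrite -scalemxAl -mulmxA (nilopX_hom _ rBf) mulmxA vf.
  have it := ltn_ord i; rewrite (monv_nilopX p_odd p_pr chF); last lia.
  rewrite scalerA mulVf ?(ffact_neq0 chF) ?scale1r; try lia.
  by rewrite subKn ?monv_delta ?row1 //; lia.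
move=> g Bg.
have wE : (t.-1%:Z = 1 - t%:Z + (2 * t.-1)%N%:Z %[mod p.-1])%Z.
  by congr (_ %% _)%Z; lia.
have := orbmx_hom p_odd p_pr chF (ltnW tp) wv vN0 wE Bg.
by rewrite /= /Umx subrK subrr expr0z scale1r.
Qed.

End Extension.
End Link.

(** * Sections of modules and the walk on the Brauer tree *)

Section General.
Variables (F : fieldType) (gT : finGroupType) (G : {group gT}).

Lemma has_factors_dim n (rG : mx_representation F G n) fs :
  has_factors rG fs -> (\sum_(k < size fs) rdegree (nth (@grepr0 F gT G) fs k) = n)%N.
Proof.
case=> W [compW [lastW szW factW]].
have rk k : (k <= size W)%N ->
    \rank (0 :: W)`_k = (\sum_(j < k) rdegree (nth (@grepr0 F gT G) fs j))%N.
  elim: k => [|k IH] kW; first by rewrite /= mxrank0 big_ord0.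
  have /mxrank_rsim := factW k kW; rewrite big_ord_recr /= => <-.
  have [_ /(_ k kW)[/ltmxW sub _]] := compW.
  by rewrite -(IH (ltnW kW)) addnC genmxE mxrank_in_factmod (addsmx_idPr sub).
rewrite -szW -rk // -(last_nth 0) lastW; exact: mxrank1.
Qed.

(** The quotient map of [V] onto [V / U], extended to the ambient space as a linear
    map, so that a single matrix applies to all the vectors of [V]. *)
Lemma section_map N (rG : mx_representation F G N) (U V : 'M[F]_N)
    (modU : mxmodule rG U) (modV : mxmodule rG V)
    n (rM : mx_representation F G n) :
  mx_rsim rM (section_repr modU modV) ->
  exists tau : 'M[F]_(N, n),
    [/\ forall m (x : 'M_(m, N)) g, (x <= V)%MS -> g \in G ->
          x *m rG g *m tau = x *m tau *m rM g,
        forall m (x : 'M_(m, N)), (x <= V)%MS -> (x *m tau == 0) = (x <= U)%MS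
      & row_full (V *m tau)].
Proof.
case/mx_rsim_sym=> B rkE freeB homB; set W := <<in_factmod U V>>%MS in rkE B freeB homB.
pose t0 m (x : 'M_(m, N)) := in_submod W (in_factmod U x) *m B.
have t0E m (x : 'M_(m, N)) : x *m t0 _ 1%:M = t0 _ x.
  by rewrite /t0 /in_submod /in_factmod /= mul1mx !mulmxA.
have inW m (x : 'M_(m, N)) : (x <= V)%MS -> (in_factmod U x <= W)%MS.
  by move=> xV; rewrite genmxE submxMr.
exists (t0 _ 1%:M); split=> [m x g xV Gg|m x xV|].
- rewrite !t0E /t0 (in_factmodJ modU) // (in_submodJ (section_module modU modV)) ?inW //.
  rewrite -mulmxA -[RHS]mulmxA -homB //.
- rewrite t0E /t0 -(mul0mx _ B) (inj_eq (row_free_inj freeB)).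
  rewrite -(in_factmod_eq0 U); apply/eqP/eqP => [x0|->]; last by rewrite linear0.
  by rewrite -(in_submodK (inW _ _ xV)) x0 linear0.
rewrite t0E /t0 -sub1mx.
have sB : (1%:M <= B)%MS.
  by rewrite sub1mx /row_full -{2}rkE -[_ == _]/(row_free B).
apply: submx_trans sB _; rewrite -{1}[B]mul1mx submxMr // -val_submodS.
by rewrite val_submod1 in_submodK ?inW // genmxE.
Qed.

End General.

Lemma finite_choice (T : nat -> Type) (x0 : forall k, T k)
    (P : forall k, T k -> Prop) s :
  (forall k, (0 < k < s)%N -> exists x, P k x) ->
  exists f : forall k, T k, forall k, (0 < k < s)%N -> P k (f k).
Proof.
elim: s => [|s IH] ex; first by exists x0 => k; rewrite ltn0 andbF.
have [|f Pf] := IH; first by move=> k /andP[k0 ks]; apply: ex; rewrite k0 ltnW.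
have [s0|s0] := posnP s.
  by exists f => k; rewrite ltnS s0 => /andP[]; case: k.
have [|x Px] := ex s; first by rewrite s0 /=.
exists (fun k => match s =P k with ReflectT e => ecast k (T k) e x | _ => f k end).
move=> k /andP[k0 ks]; case: eqP => [e|sk]; first by case: k / e k0 ks.
by apply: Pf; rewrite k0 /= ltn_neqAle -ltnS ks andbT; apply/eqP => /esym.
Qed.

Section Walk.
Variables (p i l s : nat) (eps : int).
Hypotheses (p_odd : odd p) (p_pr : prime p).
Hypotheses (Hls : (l + s <= p - 1)%N).
Local Notation w := (walk p i l).

(** [tree_edge] takes opposite branches at [j] and [p - j], as [p] is odd; so the
    same formula holds before and after the walk turns back. *)
Lemma walkE k : (0 < k <= s)%N ->
  w k = (if odd (l + k) != odd i then l + k else p - l - k)%N.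
Proof.
move=> /andP[k0 ks]; rewrite /walk /tree_edge; have p3 := p_gt2 p_odd p_pr.
have oddp : odd (p - l - k) = ~~ odd (l + k).
  by rewrite -subnDA oddB ?p_odd //; lia.
case: (leqP (l + k) (p - l - k)) => h.
  by case: ifP => // _; rewrite subnDA.
by rewrite oddp; case: (odd (l + k)) (odd i) => -[] //=; lia.
Qed.

Lemma walk_gt0 k : (0 < k <= s)%N -> (0 < w k < p)%N.
Proof. by move=> ks; rewrite walkE //; case: ifP => _; lia. Qed.

(** The type of the link between [E_k] and [E_(k+1)]: their dimensions add up
    to [p - 1 + 2 * linkd k]. *)
Definition linkd k : nat := (odd (l + k) == odd i).

Lemma walk_link k : (0 < k < s)%N -> (w k + w k.+1 = p.-1 + 2 * linkd k)%N.
Proof.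
move=> /andP[k0 ks]; rewrite !walkE ?k0 1?ltnW //= /linkd addnS /=.
by case: (odd (l + k)); case: (odd i) => /=; lia.
Qed.

Lemma walk_top_soc k : (0 < k < s)%N ->
  (w (top_idx eps k) + w (soc_idx eps k) = p.-1 + 2 * linkd k)%N.
Proof.
move=> ks; rewrite -walk_link // /top_idx /soc_idx.
by case: inD => //; rewrite addnC.
Qed.

Lemma inDS k : inD eps k.+1 = ~~ inD eps k.
Proof. by rewrite /inD /=; case: (eps == 1); rewrite ?negbK. Qed.

End Walk.

(** * Generators of a string module *)

Section StringStructure.
Variables (p : nat) (F : fieldType).
Hypotheses (p_odd : odd p) (p_pr : prime p) (chF : p \in [pchar F]).
Variables (i l s : nat) (eps : int).
Hypotheses (s2 : (1 < s)%N) (Hls : (l + s <= p - 1)%N).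
Variable D : string_data chF i l s eps.
Local Notation w := (walk p i l).
Local Notation Vmx := (@V_mx p F).
Local Notation inD := (inD eps).
Local Notation top := (top_idx eps).
Local Notation soc := (soc_idx eps).
Local Notation psi := (sd_psi D).
Local Notation phi := (sd_phi D).
Local Notation rBj j := (subg_repr (sd_M D j) (borel_sub p)).
Local Notation BN := (\sum_(j < s.-1) sd_deg D j.+1)%N.
Local Notation rS := (subg_repr (sd_sum D) (borel_sub p)).

Lemma top_range j : (0 < j < s)%N -> (0 < top j <= s)%N.
Proof. by rewrite /top_idx; case: ifP => _; lia. Qed.

Lemma soc_range j : (0 < j < s)%N -> (0 < soc j <= s)%N.
Proof. by rewrite /soc_idx; case: ifP => _; lia. Qed.

Lemma inD_top j : inD (top j).
Proof. by rewrite /top_idx; case: ifP => // dj; rewrite inDS dj. Qed.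

Lemma inD_soc j : ~~ inD (soc j).
Proof. by rewrite /soc_idx; case: ifP => [dj|->] //; rewrite inDS dj. Qed.

Lemma inD_adj k j : inD k -> (j == k.-1) || (j == k) -> (0 < k)%N -> top j = k.
Proof.
rewrite /top_idx => dk /orP[|] /eqP -> k0; last by rewrite dk.
by rewrite (_ : inD k.-1 = false) ?prednK //; apply/negbTE; rewrite -inDS prednK.
Qed.

Lemma top_adj j : (j == (top j).-1) || (j == top j).
Proof. by rewrite /top_idx; case: ifP => _; rewrite eqxx ?orbT. Qed.

Lemma sd_deg_eq j : (0 < j < s)%N -> sd_deg D j = (w (top j) + w (soc j))%N.
Proof.
move=> js; have := has_factors_dim (sd_factors D js) => <-.
by rewrite !big_ord_recl big_ord0 /= addn0 addnC.
Qed.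

Lemma sd_link j : (0 < j < s)%N -> exists vc : 'rV[F]_(sd_deg D j) * F,
  [/\ vc.2 != 0, weight (sd_M D j) vc.1 ((w (top j)).-1%:Z),
      vc.1 *m phi j (top j) = monv F (w (top j)) (w (top j)).-1 &
      vc.1 *m nilop (rBj j) ^+ w (top j) =
        vc.2 *: (monv F (w (soc j)) ((w (soc j)).-1 - linkd i l j) *m psi j (soc j))].
Proof.
move=> js; have /andP[t0 tp] := walk_gt0 i p_odd p_pr Hls (top_range js).
have /andP[t'0 t'p] := walk_gt0 i p_odd p_pr Hls (soc_range js).
have [|v [c c0 [wv vf vN]]] := extension_link p_odd p_pr t0 t'0 (sd_deg_eq js)
  (sd_uniserial js) (sd_phi_hom D js) (sd_psi_hom D js) (sd_phi_epi D js)
  (sd_psi_mono D js) _ (walk_top_soc i eps p_odd p_pr Hls js) tp.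
  exact: leq_b1.
by exists (v, c).
Qed.

(** Choice of the lifts [v j] of the top monomials in the modules [M_j]. *)
Variables (v : forall j, 'rV[F]_(sd_deg D j)) (c : nat -> F).
Hypothesis vc_link : forall j, (0 < j < s)%N ->
  [/\ c j != 0, weight (sd_M D j) (v j) ((w (top j)).-1%:Z),
      v j *m phi j (top j) = monv F (w (top j)) (w (top j)).-1 &
      v j *m nilop (rBj j) ^+ w (top j) =
        c j *: (monv F (w (soc j)) ((w (soc j)).-1 - linkd i l j) *m psi j (soc j))].

Definition lift_mx j k : 'M[F]_(w k, sd_deg D j) :=
  orbmx (nilop (rBj j)) (v j) (w k).

(** The lift of a top [E_k] to [X]: the gluing condition over [E_k] forces it to
    have components in both of the modules [M_(k-1)] and [M_k], if both exist. *)
Definition top_mx k : 'M[F]_(w k, BN) :=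
  \mxrow_(j < s.-1) (if (j.+1 == k.-1) || (j.+1 == k) then lift_mx j.+1 k else 0).

Definition soc_mx a k : 'M[F]_(w k, BN) :=
  \mxrow_(j < s.-1) (if j.+1 == a then psi j.+1 k else 0).

Lemma lift_phi j k : (0 < j < s)%N -> k = top j -> lift_mx j k *m phi j k = 1%:M.
Proof.
move=> js ->; have [_ _ vf _] := vc_link js.
have /andP[t0 tp] := walk_gt0 i p_odd p_pr Hls (top_range js).
apply/row_matrixP => r; rewrite row_mul rowK -scalemxAl -mulmxA.
have homf : mxhom (rBj j) (subg_repr (Vmod chF (w (top j))) (borel_sub p)) (phi j (top j)).
  by move=> g Bg; apply: (sd_phi_hom D js); apply: (subsetP (borel_sub p)).
rewrite (nilopX_hom _ homf) mulmxA vf; have rt := ltn_ord r.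
rewrite (monv_nilopX p_odd p_pr chF); last lia.
rewrite scalerA mulVf ?(ffact_neq0 chF) ?scale1r; try lia.
by rewrite subKn ?monv_delta ?row1 //; lia.
Qed.

Lemma psi_phi j k k' : (0 < j < s)%N -> k = top j -> k' = soc j ->
  psi j k' *m phi j k = 0.
Proof.
move=> js -> ->.
exact: (extension_comp0 (sd_deg_eq js) (sd_uniserial js) (sd_phi_hom D js)
  (sd_psi_hom D js) (sd_phi_epi D js) (sd_psi_mono D js)).
Qed.

Lemma phi_exact j m (x : 'M_(m, _)) : (0 < j < s)%N ->
  x *m phi j (top j) = 0 -> (x <= psi j (soc j))%MS.
Proof.
move=> js x0.
by rewrite -(extension_exact (sd_deg_eq js) (sd_uniserial js) (sd_phi_hom D js)
  (sd_psi_hom D js) (sd_phi_epi D js) (sd_psi_mono D js)); apply/sub_kermxP.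
Qed.

Lemma ord_range (j : 'I_s.-1) : (0 < j.+1 < s)%N.
Proof. by have := ltn_ord j; lia. Qed.

Lemma sub_XP m (A : 'M[F]_(m, BN)) : (A <= sd_X D)%MS <->
  (forall j j' : 'I_s.-1, j' = j.+1 :> nat -> ~~ inD j.+1 ->
     submxrow A j *m phi j.+1 j.+2 = submxrow A j' *m phi j'.+1 j.+2).
Proof.
have rowE (r : 'I_m) j : submxrow (row r A) j = row r (submxrow A j).
  by rewrite -{1}[A]submxrowK row_mxrow mxrowK.
split=> [/row_subP sA j j' jj' dj|hA].
  apply/row_matrixP => r; rewrite !row_mul -!rowE.
  by have /sd_XP := sA r; apply.
apply/row_subP => r; apply/sd_XP => j j' jj' dj.
by rewrite !rowE -!row_mul (hA j j').
Qed.

Lemma top_mx_sub k : (0 < k <= s)%N -> inD k -> (top_mx k <= sd_X D)%MS.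
Proof.
move=> /andP[k0 ks] dk; apply/sub_XP => j j' jj' dj; rewrite !mxrowK.
have dj' : inD j.+2 by rewrite inDS.
have [kj|kj] := eqVneq k j.+2.
  subst k; rewrite jj' /= !eqxx orbT /=.
  rewrite (@lift_phi j.+1) ?ord_range //; last by rewrite /top_idx (negPf dj).
  by rewrite -jj' lift_phi ?ord_range //; rewrite /top_idx jj' dj'.
rewrite !ifF ?mul0mx //; apply/negP => /orP[] /eqP e; move: dk kj.
- by rewrite jj' in e; rewrite -(prednK k0) -e inDS dj'.
- by rewrite -e jj' eqxx.
- by rewrite -(prednK k0) -e eqxx.
by rewrite -e (negPf dj).
Qed.

Lemma soc_mx_sub a k : (0 < a < s)%N -> k = soc a -> (soc_mx a k <= sd_X D)%MS.
Proof.
move=> as' kE; apply/sub_XP => j j' jj' dj; rewrite !mxrowK.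
have dj' : inD j.+2 by rewrite inDS.
transitivity (0 : 'M[F]_(w k, w j.+2)); [|symmetry].
  case: eqP => [ja|]; last by rewrite mul0mx.
  by rewrite psi_phi ?ord_range // ?ja // -ja /top_idx (negPf dj).
case: eqP => [ja|]; last by rewrite mul0mx.
by rewrite psi_phi ?ord_range // ?ja // -ja jj' /top_idx dj'.
Qed.

(** Component by component, by exactness of each extension [M_j]. *)
Lemma soc_decomp m (x : 'M_(m, BN)) :
  (forall j : 'I_s.-1, submxrow x j *m phi j.+1 (top j.+1) = 0) ->
  exists y : forall j : 'I_s.-1, 'M_(m, w (soc j.+1)),
    x = \sum_(j < s.-1) y j *m soc_mx j.+1 (soc j.+1).
Proof.
move=> x0.
exists (fun j => submxrow x j *m pinvmx (psi j.+1 (soc j.+1))).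
apply/mxrowP => j; rewrite submxrow_sum (bigD1 j) //= [X in _ + X]big1 ?addr0 => [|j' jj'].
  by rewrite mul_mxrow mxrowK eqxx mulmxKpV // phi_exact ?ord_range.
by rewrite mul_mxrow mxrowK eqSS (inj_eq val_inj) eq_sym (negPf jj') mulmx0.
Qed.

Lemma soc_mx_hom a k g : (0 < a < s)%N -> k = soc a -> g \in SL2 p ->
  Vmod chF (w k) g *m soc_mx a k = soc_mx a k *m sd_sum D g.
Proof.
move=> as' kE Gg; rewrite mul_mxrow mul_mxrow_mxdiag; apply: eq_mxrow => j.
case: eqP => [ja|]; last by rewrite mulmx0 mul0mx.
have := sd_psi_hom D (ord_range j); rewrite -(_ : k = soc j.+1); last by rewrite ja.
by apply.
Qed.

Definition gen_mx k := soc_mx k.-1 k + soc_mx k k.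

Lemma gen_mxE k (f : 'rV_(w k)) : (0 < k)%N -> sd_gen D f = f *m gen_mx k.
Proof.
move=> k0; rewrite /sd_gen /gen_mx -mxrowD mul_mxrow; apply: eq_mxrow => j.
have jk : (j.+1 == k.-1) && (j.+1 == k) = false.
  by apply/negP => /andP[/eqP -> /eqP]; lia.
case: (j.+1 =P k.-1) jk => _; case: (j.+1 =P k) => //= _ _; rewrite ?addr0 ?add0r //.
by rewrite mulmx0.
Qed.

Lemma gen_mx_Y k : (1 < k < s)%N -> ~~ inD k -> (gen_mx k <= sd_Y D)%MS.
Proof.
move=> ks dk; apply/row_subP => r; rewrite rowE -gen_mxE; last lia.
exact: sd_Y_gen.
Qed.

Lemma soc_pred k : (1 < k < s)%N -> ~~ inD k -> k = soc k.-1.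
Proof.
move=> ks dk; have k0 : k = k.-1.+1 by lia.
by rewrite /soc_idx ifT //; move: dk; rewrite {1}k0 inDS negbK.
Qed.

Lemma soc_self k : ~~ inD k -> k = soc k.
Proof. by move=> dk; rewrite /soc_idx (negPf dk). Qed.

(** The span of the generators is a submodule, because the [soc_mx a k] are
    equivariant; so minimality of [Y] applies to it. *)
Lemma Y_generated (y : 'rV_BN) : (y <= sd_Y D)%MS ->
  exists h : forall k, 'rV_(w k),
    y = \sum_(k < s.+1 | (1 < k < s)%N && ~~ inD k) h k *m gen_mx k.
Proof.
pose Z := (\sum_(k < s.+1 | (1 < k < s)%N && ~~ inD k) <<gen_mx k>>)%MS.
have YZ : (sd_Y D <= Z)%MS.
  apply: sd_Y_min => [|k f ks dk].
    apply/mxmoduleP => g Gg; rewrite sumsmxMr; apply/sumsmx_subP => k kk.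
    rewrite (eqmxMr _ (genmxE _)) mulmxDl; have [ks dk] := andP kk.
    rewrite -(soc_mx_hom _ (soc_pred ks dk) Gg); last lia.
    rewrite -(soc_mx_hom _ (soc_self dk) Gg); last lia.
    by rewrite -mulmxDr (submx_trans (submxMl _ _)) // (sumsmx_sup k) ?genmxE.
  have ks' : (k < s.+1)%N by lia.
  rewrite (sumsmx_sup (Ordinal ks')) /= ?ks //.
  by rewrite genmxE gen_mxE ?submxMl //; lia.
move=> yY; have /sub_sumsmxP[h ->] := submx_trans yY YZ.
exists (fun k => h (inord k) *m <<gen_mx k>>%MS *m pinvmx (gen_mx k)).
apply: eq_bigr => k _; rewrite inord_val.
by rewrite mulmxKpV // (submx_trans (submxMl _ _)) ?genmxE.
Qed.

(** The component in which the copy of the socle [E_k] is taken: [M_k], except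
    that the last socle [E_s] only occurs in [M_(s-1)]. *)
Definition soc_pos k := if (k < s)%N then k else k.-1.

Lemma soc_posP k : (0 < k <= s)%N -> ~~ inD k ->
  (0 < soc_pos k < s)%N /\ k = soc (soc_pos k).
Proof.
move=> /andP[k0 ks] dk; rewrite /soc_pos; case: ifP => ks'.
  by rewrite k0 ks'; split=> //; apply: soc_self.
split; first lia.
rewrite /soc_idx ifT ?prednK //.
by move: dk; rewrite -{1}(prednK k0) inDS negbK.
Qed.

(** One map for each simple factor: onto a copy of it in the socle, or onto a lift
    of it. *)
Definition piece_mx k : 'M[F]_(w k, BN) :=
  if inD k then top_mx k else soc_mx (soc_pos k) k.

Lemma piece_mx_sub k : (0 < k <= s)%N -> (piece_mx k <= sd_X D)%MS.
Proof.
move=> ks; rewrite /piece_mx; case: ifP => dk; first exact: top_mx_sub.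
by have [ap kE] := soc_posP ks (negbT dk); apply: soc_mx_sub.
Qed.

Lemma piece_mx_phi k (j : 'I_s.-1) q : q = top j.+1 -> (0 < k <= s)%N ->
  submxrow (piece_mx k) j *m phi j.+1 q = if k == q then
    lift_mx j.+1 k *m phi j.+1 q else 0.
Proof.
move=> qE ks; have [k0 ks'] := andP ks.
rewrite /piece_mx; case: ifP => dk; rewrite mxrowK.
  case: ifP => [adj|nadj]; last first.
    by rewrite mul0mx; case: eqP => // kq; rewrite kq qE top_adj in nadj.
  by rewrite qE (inD_adj dk adj k0) eqxx.
have -> : (k == q) = false by apply/eqP => kq; rewrite kq qE inD_top in dk.
case: eqP => [jE|]; last by rewrite mul0mx.
have [_ kE] := soc_posP ks (negbT dk).
by rewrite psi_phi ?ord_range // kE -jE.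
Qed.

Lemma gen_mx_phi k (j : 'I_s.-1) q : q = top j.+1 -> (1 < k < s)%N -> ~~ inD k ->
  submxrow (gen_mx k) j *m phi j.+1 q = 0.
Proof.
move=> qE ks dk; rewrite /gen_mx submxrowD !mxrowK mulmxDl.
case: eqP => [jk|_]; case: eqP => [jk'|_]; rewrite ?mul0mx ?addr0 ?add0r //.
- lia.
- by rewrite psi_phi ?ord_range // jk -soc_pred.
by rewrite psi_phi ?ord_range // jk' -soc_self.
Qed.

Lemma gen_mx_comp k (j : 'I_s.-1) : (1 < k < s)%N -> ~~ inD k ->
  submxrow (gen_mx k) j = if k == soc j.+1 then psi j.+1 k else 0.
Proof.
move=> ks dk; rewrite /gen_mx submxrowD !mxrowK.
have [jk|jk] := eqVneq j.+1 k.-1.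
  by rewrite jk -soc_pred // eqxx (_ : (k.-1 == k) = false) ?addr0 //; lia.
have [jk'|jk'] := eqVneq j.+1 k; first by rewrite jk' -soc_self // eqxx add0r.
rewrite addr0 ifF //; apply/negP => /eqP; rewrite /soc_idx; case: ifP => _ kE.
  by move: jk; rewrite kE eqxx.
by move: jk'; rewrite kE eqxx.
Qed.

(** The summands of the string module are linearly independent modulo [Y]:
    the maps [phi] detect the tops, and then, component by component, the
    elements of [Y] and the chosen copies of the socles do not interfere. *)
Lemma piece_mx_free (f : forall k, 'rV[F]_(w k)) :
  ((\sum_(k < s.+1 | (0 < k)%N) f k *m piece_mx k)%R <= sd_Y D)%MS ->
  forall k, (0 < k <= s)%N -> f k = 0.
Proof.
case/Y_generated=> h sumE.
have comp (j : 'I_s.-1) : \sum_(k < s.+1 | (0 < k)%N) f k *m submxrow (piece_mx k) j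
    = \sum_(k < s.+1 | (1 < k < s)%N && ~~ inD k) h k *m submxrow (gen_mx k) j.
  have := congr1 (fun A => submxrow A j) sumE; rewrite !submxrow_sum => H.
  transitivity (\sum_(k < s.+1 | (0 < k)%N) submxrow (f k *m piece_mx k) j).
    by apply: eq_bigr => k _; rewrite mul_submxrow.
  by rewrite H; apply: eq_bigr => k _; rewrite mul_submxrow.
have ftop k : (0 < k <= s)%N -> inD k -> f k = 0.
  move=> ks dk; pose a := if (k < s)%N then k else k.-1.
  have [ar aE] : (0 < a < s)%N /\ k = top a.
    rewrite /a; case: ifP => ks'; first by rewrite /top_idx dk; split=> //; lia.
    have kS : k = k.-1.+1 by lia.
    split; first lia.
    by rewrite /top_idx ifF //; apply/negbTE; rewrite -inDS -kS.
  have jp : (a.-1 < s.-1)%N by lia.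
  have [j ja] : exists j : 'I_s.-1, j.+1 = a :> nat by exists (Ordinal jp) => /=; lia.
  have := congr1 (mulmx^~ (phi j.+1 k)) (comp j); rewrite /= !mulmx_suml.
  rewrite [RHS]big1 => [|k' /andP[ks' dk']]; last first.
    by rewrite -mulmxA gen_mx_phi ?mulmx0 // ja.
  have kO : (k < s.+1)%N by lia.
  rewrite (bigD1 (Ordinal kO)) /=; last lia.
  rewrite [X in _ + X]big1 ?addr0 => [|k' /andP[k0' kk']]; last first.
    rewrite -mulmxA (@piece_mx_phi _ j) ?ja //; last by rewrite k0' -ltnS ltn_ord.
    by rewrite -(inj_eq val_inj) /= in kk'; rewrite (negPf kk') mulmx0.
  rewrite -mulmxA (@piece_mx_phi _ j) ?ja // eqxx.
  by rewrite lift_phi ?mulmx1 ?ja // -ja ord_range.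
have fsoc (j : 'I_s.-1) :
    f (soc j.+1) *+ (j.+1 == soc_pos (soc j.+1)) = h (soc j.+1) *+ (1 < soc j.+1 < s)%N.
  have js := ord_range j; have qs := soc_range js; have dq := inD_soc j.+1.
  apply: (row_free_inj (sd_psi_mono D js)).
  have qO : (soc j.+1 < s.+1)%N by lia.
  have := comp j; rewrite (bigD1 (Ordinal qO)) /=; last lia.
  rewrite [X in _ + X]big1 ?addr0 => [|k /andP[k0 kq]]; last first.
    have ks : (0 < k <= s)%N by rewrite k0 -ltnS ltn_ord.
    have [dk|dk] := boolP (inD k); first by rewrite ftop // mul0mx.
    rewrite /piece_mx (negPf dk) mxrowK; case: eqP => [jk|]; last by rewrite mulmx0.
    have [_ kE] := soc_posP ks dk; rewrite -jk in kE.
    by move: kq; rewrite -(inj_eq val_inj) /= kE eqxx.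
  rewrite /piece_mx (negPf dq) mxrowK => E.
  transitivity (f (soc j.+1) *m
     (if j.+1 == soc_pos (soc j.+1) then psi j.+1 (soc j.+1) else 0)).
    by case: eqP => _; rewrite ?mulr1n ?mulr0n ?mul0mx ?mulmx0.
  rewrite E; case: (boolP (1 < soc j.+1 < s)%N) => q1.
    rewrite (bigD1 (Ordinal qO)) /=; last by rewrite q1.
    rewrite [X in _ + X]big1 ?addr0 => [|k /andP[/andP[ks dk] kq]].
      by rewrite gen_mx_comp // eqxx mulr1n.
    by rewrite gen_mx_comp // -(inj_eq val_inj) /= in kq *; rewrite (negPf kq) mulmx0.
  rewrite mulr0n mul0mx big1 // => k /andP[ks dk].
  rewrite gen_mx_comp //; case: eqP => [kE|]; last by rewrite mulmx0.
  by rewrite -kE ks in q1.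
have hsoc k : (1 < k < s)%N -> ~~ inD k -> h k = 0.
  move=> ks dk; have jp : (k.-2 < s.-1)%N by lia.
  have [j ja] : exists j : 'I_s.-1, j.+1 = k.-1 :> nat by exists (Ordinal jp) => /=; lia.
  have := fsoc j; rewrite ja -soc_pred // ks /soc_pos ifT; last by lia.
  by rewrite (_ : (k.-1 == k) = false) ?mulr0n ?mulr1n //; lia.
move=> k ks; have [dk|dk] := boolP (inD k); first exact: ftop.
have [ap kE] := soc_posP ks dk.
have jp : ((soc_pos k).-1 < s.-1)%N by lia.
have [j ja] : exists j : 'I_s.-1, j.+1 = soc_pos k :> nat by exists (Ordinal jp) => /=; lia.
have := fsoc j; rewrite ja -kE eqxx mulr1n => ->.
by case: (boolP (1 < k < s)%N) => k1; rewrite ?mulr0n // mulr1n hsoc.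
Qed.

(** The quotient map onto the string module. *)
Variables (n : nat) (rM : mx_representation F (SL2 p) n) (tau : 'M[F]_(BN, n)).
Hypotheses
  (tauJ : forall m (x : 'M_(m, BN)) g, (x <= sd_X D)%MS -> g \in SL2 p ->
     x *m sd_sum D g *m tau = x *m tau *m rM g)
  (tau0 : forall m (x : 'M_(m, BN)), (x <= sd_X D)%MS ->
     (x *m tau == 0) = (x <= sd_Y D)%MS)
  (tau_full : row_full (sd_X D *m tau)).
Local Notation rMB := (subg_repr rM (borel_sub p)).
Local Notation N := (nilop rMB).

(** The images of these maps in the string module. They are equivariant for the
    socles, and equivariant up to the socles for the tops. *)
Definition beta k : 'M[F]_(w k, n) := piece_mx k *m tau.

Definition Soc : 'M[F]_n :=
  (\sum_(k < s.+1 | (0 < k)%N && ~~ inD k) <<beta k>>)%MS.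

Lemma beta_soc k : (0 < k <= s)%N -> ~~ inD k -> (beta k <= Soc)%MS.
Proof.
move=> ks dk; have kO : (k < s.+1)%N by lia.
by rewrite (sumsmx_sup (Ordinal kO)) ?genmxE //= dk andbT; lia.
Qed.

Lemma beta_hom k : (0 < k <= s)%N -> ~~ inD k ->
  mxhom (Vmod chF (w k)) rM (beta k).
Proof.
move=> ks dk g Gg; have [ap kE] := soc_posP ks dk.
rewrite /beta /piece_mx (negPf dk) mulmxA soc_mx_hom // tauJ //.
exact: soc_mx_sub.
Qed.

(** The two copies of a shared socle are opposite in the quotient. *)
Definition soc_sign a : F := if a == soc_pos (soc a) then 1 else -1.

Lemma soc_tau a k : (0 < a < s)%N -> k = soc a ->
  soc_mx a k *m tau = soc_sign a *: beta k.
Proof.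
move=> ar kE; have dk : ~~ inD k by rewrite kE inD_soc.
have ks : (0 < k <= s)%N by rewrite kE soc_range.
have [ap kE'] := soc_posP ks dk; rewrite /soc_sign -kE.
have [apos|apos] := eqVneq a (soc_pos k).
  by rewrite scale1r /beta /piece_mx (negPf dk) apos.
have [aE kk] : a = k.-1 /\ (1 < k < s)%N.
  move: apos kE; rewrite /soc_pos /soc_idx; case: ifP => ks'; case: ifP => da; lia.
have := gen_mx_Y kk dk; rewrite -tau0; last first.
  by rewrite addmx_sub // soc_mx_sub //; [lia | apply: soc_pred | lia | apply: soc_self].
rewrite /gen_mx mulmxDl addr_eq0 -aE => /eqP ->.
rewrite scaleN1r /beta /piece_mx (negPf dk) /soc_pos ifT //; lia.
Qed.

Lemma soc_part m (x : 'M_(m, BN)) :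
  (forall j : 'I_s.-1, submxrow x j *m phi j.+1 (top j.+1) = 0) ->
  (x *m tau <= Soc)%MS.
Proof.
case/soc_decomp=> y ->; rewrite mulmx_suml; apply: summx_sub => j _.
have js := ord_range j.
rewrite -mulmxA (soc_tau js (erefl (soc j.+1))) -scalemxAr scalemx_sub //.
rewrite (submx_trans (submxMl _ _)) // beta_soc ?soc_range //.
exact: inD_soc.
Qed.

Lemma beta_top k g : (0 < k <= s)%N -> inD k -> g \in SL2 p ->
  (Vmod chF (w k) g *m beta k - beta k *m rM g <= Soc)%MS.
Proof.
move=> ks dk Gg; have [k0 ks'] := andP ks.
have sub := top_mx_sub ks dk.
rewrite /beta /piece_mx dk mulmxA -tauJ // -mulmxBl; apply: soc_part => j.
have js := ord_range j.
rewrite mul_mxrow mul_mxrow_mxdiag -mxrowB mxrowK.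
case: ifP => [adj|_]; last by rewrite mulmx0 mul0mx subr0 mul0mx.
have kE := inD_adj dk adj k0; rewrite kE mulmxBl -!mulmxA lift_phi // mulmx1.
have := sd_phi_hom D js Gg; rewrite kE => ->.
by rewrite mulmxA lift_phi // mul1mx subrr.
Qed.

(** Subtracting from the elements of [X] the lifts of their images under the
    [phi] leaves elements killed by all the [phi], which are in the socles by
    [soc_part]. The gluing condition makes the two possible images in a shared
    top agree. *)
Lemma beta_full : (1%:M <= \sum_(k < s.+1 | (0 < k)%N) <<beta k>>)%MS.
Proof.
apply: submx_trans (_ : (sd_X D *m tau <= _)%MS); first by rewrite sub1mx.
pose pos k := if (k < s)%N then k else k.-1.
have posP k : (0 < k <= s)%N -> inD k -> (0 < pos k < s)%N /\ k = top (pos k).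
  move=> ks dk; rewrite /pos; case: ifP => ks'.
    by rewrite /top_idx dk; split=> //; lia.
  have kS : k = k.-1.+1 by lia.
  split; first lia.
  by rewrite /top_idx ifF //; apply/negbTE; rewrite -inDS -kS.
pose X := sd_X D.
pose ft k : 'M[F]_(BN, w k) :=
  \sum_(j < s.-1 | j.+1 == pos k) submxrow X j *m phi j.+1 k.
pose x := X - \sum_(k < s.+1 | (0 < k)%N && inD k) ft k *m top_mx k.
have xsoc : (x *m tau <= Soc)%MS.
  apply: soc_part => j; have js := ord_range j; set q := top j.+1.
  have qs : (0 < q <= s)%N := top_range js; have dq : inD q := inD_top j.+1.
  have qO : (q < s.+1)%N by lia.
  rewrite submxrowB submxrow_sum mulmxBl mulmx_suml (bigD1 (Ordinal qO)) /=; last first.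
    by rewrite dq andbT; lia.
  rewrite [X in _ - (_ + X)]big1 ?addr0 => [|k /andP[/andP[k0 dk] kq]]; last first.
    rewrite mul_mxrow mxrowK; case: ifP => [adj|_]; last by rewrite mulmx0 mul0mx.
    by move: kq; rewrite -(inj_eq val_inj) /= -(inD_adj dk adj k0) eqxx.
  rewrite mul_mxrow mxrowK top_adj -mulmxA lift_phi // mulmx1.
  apply/eqP; rewrite subr_eq0; apply/eqP.
  have [ar aE] := posP q qs dq.
  have jp : ((pos q).-1 < s.-1)%N by lia.
  have [j0 ja] : exists j : 'I_s.-1, j.+1 = pos q :> nat by exists (Ordinal jp) => /=; lia.
  rewrite /ft [RHS](bigD1 j0) /=; last by rewrite ja.
  rewrite [X in _ + X]big1 ?addr0 => [|j' /andP[/eqP j'a j'0]]; last first.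
    by case/negP: j'0; apply/eqP/val_inj/succn_inj; rewrite j'a ja.
  have [jj|jj] := eqVneq j j0; first by rewrite jj.
  have [jq dj jj0] : [/\ q = j.+2, ~~ inD j.+1 & j0 = j.+1 :> nat].
    move: (top_adj j.+1) ja jj; rewrite -(inj_eq val_inj) /= -/q /pos.
    case/orP => /eqP qE; case: ifP => qs'; try lia.
    move=> ja _; have qj : q = j.+2 by lia.
    by split=> //; [rewrite -inDS -qj | lia].
  by have /sub_XP/(_ j j0 jj0 dj) := submx_refl X; rewrite -jq.
have XE : sd_X D = x + \sum_(k < s.+1 | (0 < k)%N && inD k) ft k *m top_mx k.
  by rewrite /x subrK.
rewrite {1}XE.
rewrite mulmxDl addmx_sub //.
  apply: submx_trans xsoc _; apply/sumsmx_subP => k /andP[k0 _].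
  by rewrite (sumsmx_sup k).
rewrite mulmx_suml summx_sub // => k /andP[k0 dk].
by rewrite (sumsmx_sup k) // genmxE /beta /piece_mx dk -mulmxA submxMl.
Qed.

Lemma beta_free (f : forall k, 'rV[F]_(w k)) :
  \sum_(k < s.+1 | (0 < k)%N) f k *m beta k = 0 ->
  forall k, (0 < k <= s)%N -> f k = 0.
Proof.
move=> f0; apply: piece_mx_free; rewrite -tau0.
  rewrite mulmx_suml -[X in _ == X]f0; apply/eqP; apply: eq_bigr => k _.
  by rewrite mulmxA.
apply: summx_sub => k k0; rewrite (submx_trans (submxMl _ _)) // piece_mx_sub //.
by rewrite k0 -ltnS ltn_ord.
Qed.

Lemma submxrowZ m a (A : 'M[F]_(m, BN)) j :
  submxrow (a *: A) j = a *: submxrow A j.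
Proof. by rewrite -!mul_scalar_mx -mul_submxrow. Qed.

Lemma nilop_dsum1 m (A : forall j : 'I_s.-1, 'M[F]_(m, sd_deg D j.+1)) :
  \mxrow_j A j *m nilop rS = \mxrow_j (A j *m nilop (rBj j.+1)).
Proof.
apply/mxrowP => j; rewrite mxrowK /nilop /logdp !mulmxN submxrowN; congr (- _).
rewrite !mulmx_sumr submxrow_sum; apply: eq_bigr => x _.
by rewrite -!scalemxAr submxrowZ mul_mxrow_mxdiag mxrowK.
Qed.

Lemma nilop_dsum m e (A : forall j : 'I_s.-1, 'M[F]_(m, sd_deg D j.+1)) :
  \mxrow_j A j *m nilop rS ^+ e = \mxrow_j (A j *m nilop (rBj j.+1) ^+ e).
Proof.
elim: e => [|e IH].
  by rewrite expr0 mulmx1; apply: eq_mxrow => j; rewrite expr0 mulmx1.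
rewrite mxpowSr mulmxA IH nilop_dsum1; apply: eq_mxrow => j.
by rewrite mxpowSr mulmxA.
Qed.

Definition top_v k : 'rV[F]_BN :=
  \mxrow_(j < s.-1) (if (j.+1 == k.-1) || (j.+1 == k) then v j.+1 else 0).

Lemma top_mx_orb k : top_mx k = orbmx (nilop rS) (top_v k) (w k).
Proof.
apply/row_matrixP => r; rewrite rowK nilop_dsum row_mxrow.
apply/mxrowP => j; rewrite submxrowZ !mxrowK.
by case: ifP => _; rewrite ?rowK // row0 mul0mx scaler0.
Qed.

Lemma top_v_sub k : (0 < k <= s)%N -> inD k -> (top_v k <= sd_X D)%MS.
Proof.
move=> ks dk; apply: submx_trans (top_mx_sub ks dk).
have /andP[w0 wp] := walk_gt0 i p_odd p_pr Hls ks.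
rewrite -(orbmx_top (nilop rS) (top_v k) w0) top_mx_orb; exact: submxMl.
Qed.

Lemma nilop_tau m (x : 'M_(m, BN)) e : (x <= sd_X D)%MS ->
  x *m nilop rS ^+ e *m tau = x *m tau *m N ^+ e.
Proof.
move=> xX; elim: e => [|e IH]; first by rewrite !expr0 !mulmx1.
have XN : (sd_X D *m nilop rS <= sd_X D)%MS.
  apply: nilop_module; apply/mxmoduleP => g Bg.
  exact: (mxmoduleP (sd_X_mod D) g (subsetP (borel_sub p) g Bg)).
have xe : (x *m nilop rS ^+ e <= sd_X D)%MS.
  elim: e {IH} => [|e IH]; first by rewrite expr0 mulmx1.
  by rewrite mxpowSr mulmxA (submx_trans _ XN) // submxMr.
rewrite !mxpowSr !mulmxA -IH.
rewrite {2}/nilop {3}/nilop /logdp !mulmxN mulNmx; congr (- _).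
rewrite !mulmx_sumr mulmx_suml; apply: eq_bigr => y _.
rewrite -!scalemxAr -scalemxAl /= tauJ //.
exact: subsetP (borel_sub p) _ (unip_borel y).
Qed.

(** The generators: lifts of the highest monomials of the simple factors. *)
Definition gen_v k : 'rV[F]_n :=
  if inD k then top_v k *m tau else monv F (w k) (w k).-1 *m beta k.

Lemma beta_orb k : (0 < k <= s)%N -> beta k = orbmx N (gen_v k) (w k).
Proof.
move=> ks; have /andP[w0 wp] := walk_gt0 i p_odd p_pr Hls ks.
apply/row_matrixP => r; rewrite rowK /gen_v; case: ifP => dk.
  rewrite /beta /piece_mx dk top_mx_orb row_mul rowK -scalemxAl.
  by rewrite nilop_tau // top_v_sub.
have hb := resV_hom (beta_hom ks (negbT dk)); have rw := ltn_ord r.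
rewrite -mulmxA -(nilopX_hom _ hb) mulmxA (monv_nilopX p_odd p_pr chF); last lia.
rewrite -scalemxAl scalerA mulVf ?(ffact_neq0 chF) ?scale1r; try lia.
by rewrite subKn -?monv_row //; lia.
Qed.

Lemma gen_v_weight k : (0 < k <= s)%N -> weight rMB (gen_v k) ((w k).-1%:Z).
Proof.
move=> ks a a0; have /andP[w0 wp] := walk_gt0 i p_odd p_pr Hls ks.
rewrite /gen_v; case: ifP => dk.
  have Ga : tor a \in SL2 p := subsetP (borel_sub p) _ (tor_borel a0).
  rewrite /= -tauJ ?top_v_sub // scalemxAl; congr (_ *m _).
  rewrite mul_mxrow_mxdiag; apply/mxrowP => j; rewrite submxrowZ !mxrowK.
  case: ifP => [adj|_]; last by rewrite mul0mx scaler0.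
  have [k0 _] := andP ks; have kE := inD_adj dk adj k0.
  by have [_ wv _ _] := vc_link (ord_range j); rewrite wv // kE.
have hb := resV_hom (beta_hom ks (negbT dk)).
apply: (weight_hom hb) => // b b0; rewrite /= (monv_tor p_odd p_pr chF) ?prednK //.
by congr (_ ^ _ *: _); lia.
Qed.

Lemma gen_v_soc k : (0 < k <= s)%N -> ~~ inD k -> gen_v k *m N ^+ w k = 0.
Proof.
move=> ks dk; have /andP[w0 wp] := walk_gt0 i p_odd p_pr Hls ks.
have hb := resV_hom (beta_hom ks dk).
rewrite /gen_v (negPf dk) -mulmxA -(nilopX_hom _ hb) mulmxA.
rewrite (monv_nilopX p_odd p_pr chF) ?ffact_small ?scale0r ?mul0mx //; lia.
Qed.

(** The factorial accounts for the difference between [N ^ linkd a] applied to the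
    highest monomial and the monomial found in [sd_link], the sign for the choice
    of a copy of the socle. *)
Definition link_coef a : F :=
  c a * soc_sign a / ((w (soc a)).-1 ^_ linkd i l a)%:R.

Lemma linkd_lt a : (0 < a < s)%N -> (linkd i l a < w (soc a))%N.
Proof.
move=> ar; have := walk_top_soc i eps p_odd p_pr Hls ar.
have /andP[] := walk_gt0 i p_odd p_pr Hls (top_range ar).
have /andP[] := walk_gt0 i p_odd p_pr Hls (soc_range ar).
by rewrite /linkd; case: (_ == _); lia.
Qed.

Lemma link_coef_neq0 a : (0 < a < s)%N -> link_coef a != 0.
Proof.
move=> ar; have [c0 _ _ _] := vc_link ar; have := linkd_lt ar.
have /andP[w0 wp] := walk_gt0 i p_odd p_pr Hls (soc_range ar) => wl.
rewrite /link_coef !mulf_neq0 ?invr_eq0 ?(ffact_neq0 chF) //; last lia.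
by rewrite /soc_sign; case: ifP; rewrite ?oppr_eq0 oner_eq0.
Qed.

(** The lift of a top has its components in two extensions, each of which
    contributes the term found in [sd_link]. *)
Lemma gen_v_top k : (0 < k <= s)%N -> inD k ->
  gen_v k *m N ^+ w k = \sum_(a < s | (0 < a)%N && ((a == k.-1 :> nat) || (a == k :> nat)))
     link_coef a *: (gen_v (soc a) *m N ^+ linkd i l a).
Proof.
move=> ks dk; have [k0 _] := andP ks.
rewrite /gen_v dk -nilop_tau ?top_v_sub // nilop_dsum.
have -> : \mxrow_j ((if (j.+1 == k.-1) || (j.+1 == k) then v j.+1 else 0) *m
      nilop (rBj j.+1) ^+ w k) =
    \sum_(a < s | (0 < a)%N && ((a == k.-1 :> nat) || (a == k :> nat)))
      c a *: (monv F (w (soc a)) ((w (soc a)).-1 - linkd i l a) *m soc_mx a (soc a)).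
  apply/mxrowP => j; rewrite mxrowK submxrow_sum.
  have js := ord_range j; have jO : (j.+1 < s)%N by lia.
  transitivity (if (j.+1 == k.-1) || (j.+1 == k) then
    c j.+1 *: (monv F (w (soc j.+1)) ((w (soc j.+1)).-1 - linkd i l j.+1)
                 *m psi j.+1 (soc j.+1)) else 0).
    case: ifP => [adj|_]; last by rewrite mul0mx.
    by have [_ _ _ <-] := vc_link js; rewrite (inD_adj dk adj k0).
  rewrite big_mkcond (bigD1 (Ordinal jO)) //= [X in _ + X]big1 ?addr0 => [|a aj].
    by case: ifP => _ //; rewrite submxrowZ mul_mxrow mxrowK eqxx.
  case: ifP => // _; rewrite submxrowZ mul_mxrow mxrowK ifF ?mulmx0 ?scaler0 //.
  by apply/negbTE; rewrite eq_sym -(inj_eq val_inj) in aj.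
rewrite mulmx_suml; apply: eq_bigr => a /andP[a0 _].
have ar : (0 < a < s)%N by rewrite a0 ltn_ord.
have sr := soc_range ar; have wl := linkd_lt ar.
have /andP[w0 wp] := walk_gt0 i p_odd p_pr Hls sr.
rewrite -scalemxAl -mulmxA soc_tau // -scalemxAr scalerA.
rewrite -/(gen_v (soc a)) (orbmx_pow p_odd p_pr chF N (gen_v (soc a)) (b := w (soc a))); last lia.
rewrite -beta_orb // scalerA /link_coef divfK // (ffact_neq0 chF) //; lia.
Qed.

Lemma sum_walk : (\sum_(j < s) w j.+1 = n)%N.
Proof.
pose B := \mxcol_(j < s) beta j.+1.
have fullB : row_full B.
  rewrite -sub1mx; apply: submx_trans beta_full _; apply/sumsmx_subP => k k0.
  have ks : (k.-1 < s)%N by have := ltn_ord k; lia.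
  have kE : k = (Ordinal ks).+1 :> nat by rewrite /= prednK.
  rewrite genmxE kE -(mxcolK (fun j : 'I_s => beta j.+1) (Ordinal ks)).
  by rewrite -/B -[B in submxcol B]mul1mx -submxcol_mul submxMl.
have freeB : row_free B.
  rewrite -kermx_eq0; apply/eqP/row_matrixP => r; rewrite row0.
  set u := row r _; have uB : u *m B = 0 by apply/sub_kermxP; apply: row_sub.
  pose P k (x : 'rV[F]_(w k)) := forall j : 'I_s, k = j.+1 ->
    x *m beta k = submxrow u j *m beta j.+1 /\ (x = 0 -> submxrow u j = 0).
  have [|f Pf] := @finite_choice (fun k => 'rV[F]_(w k)) (fun=> 0) P s.+1.
    move=> k /andP[k0 ks]; have kO : (k.-1 < s)%N by lia.
    have [j jE] : exists j : 'I_s, k = j.+1 by exists (Ordinal kO); rewrite /= prednK.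
    subst k; exists (submxrow u j) => j' /succn_inj/val_inj <-; split=> //.
  have f0 : \sum_(k < s.+1 | (0 < k)%N) f k *m beta k = 0.
    rewrite big_mkcond big_ord_recl /= add0r -[RHS]uB.
    rewrite -[u in RHS](submxrowK u) mul_mxrow_mxcol; apply: eq_bigr => j _.
    by have [] := Pf j.+1 _ j erefl; rewrite //= ltnS ltn_ord.
  rewrite -[u]submxrowK -[RHS](mxrow0 (q_ := fun j : 'I_s => w j.+1)).
  apply: eq_mxrow => j; have [|_] := Pf j.+1 _ j erefl.
    by rewrite /= ltnS ltn_ord.
  by apply; apply: (beta_free f0); rewrite /= ltn_ord.
exact: etrans (esym (eqP freeB)) (eqP fullB).
Qed.

(** The order of the factors in a composition series which starts with the
    socles. *)
Definition walk_order := [seq k <- iota 1 s | ~~ inD k] ++ [seq k <- iota 1 s | inD k].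

Lemma perm_walk_order : perm_eq walk_order (iota 1 s).
Proof. by rewrite /walk_order perm_catC perm_filterC. Qed.

Lemma string_factors :
  has_factors rM [seq Representation (Vmod chF (w k)) | k <- walk_order].
Proof.
have sz : size walk_order = s by rewrite (perm_size perm_walk_order) size_iota.
pose ks j := nth 0%N walk_order j.
have ks_in j : (j < s)%N -> (0 < ks j <= s)%N.
  move=> js; have : ks j \in iota 1 s by rewrite -(perm_mem perm_walk_order) mem_nth ?sz.
  by rewrite mem_iota; lia.
have ks_of k : (0 < k <= s)%N -> exists2 j, (j < s)%N & ks j = k.
  move=> kk; have kin : k \in walk_order by rewrite (perm_mem perm_walk_order) mem_iota; lia.
  exists (index k walk_order); last exact: nth_index.
  by rewrite -[X in (_ < X)%N]sz index_mem.
have -> : [seq Representation (Vmod chF (w k)) | k <- walk_order] =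
    mkseq (fun j => Representation (Vmod chF (w (ks j)))) s.
  by rewrite -[in LHS](mkseq_nth 0%N walk_order) sz /mkseq -map_comp.
apply: (has_factors_filtration (f := fun j => beta (ks j))) => [j js|j g js Gg||].
- apply: (Vmod_irr p_odd p_pr chF).
  by have /andP[-> /ltnW ->] := walk_gt0 i p_odd p_pr Hls (ks_in j js).
- have [dk|dk] := boolP (inD (ks j)); last first.
    by rewrite (beta_hom (ks_in j js) dk) // subrr sub0mx.
  apply: submx_trans (beta_top (ks_in j js) dk Gg) _.
  apply/sumsmx_subP => k /andP[k0 dk']; have kk : (0 < k <= s)%N by rewrite k0 -ltnS ltn_ord.
  have [j' j's kE] := ks_of k kk.
  have j'j : (j' < j)%N.
    rewrite ltnNge; apply/negP => jj'; move: dk dk'; rewrite -kE /ks /walk_order.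
    rewrite !nth_cat; set sl := size _; case: (ltnP j sl) => h1.
      have := mem_nth 0%N h1; rewrite mem_filter => /andP[/negPf ->] //.
    have h2 : (sl <= j')%N by apply: leq_trans jj'.
    rewrite ltnNge h2 /= => _.
    have : (j' - sl < size [seq k <- iota 1 s | inD k])%N.
      by have := sz; rewrite /walk_order size_cat -/sl; lia.
    by move/(mem_nth 0%N); rewrite mem_filter => /andP[->].
  by rewrite (sumsmx_sup (Ordinal j'j)) //= kE.
- rewrite -sum_walk -(big_mkord predT (fun j => w (ks j))) -(big_mkord predT (fun j => w j.+1)).
  transitivity (\sum_(k <- walk_order) w k)%N.
    by rewrite [RHS](big_nth 0%N) sz.
  rewrite (perm_big _ perm_walk_order) /= /index_iota subn0.
  by rewrite -[1%N]addn0 iotaDl big_map.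
apply: submx_trans beta_full _; apply/sumsmx_subP => k k0.
have kk : (0 < k <= s)%N by rewrite k0 -ltnS ltn_ord.
by have [j js <-] := ks_of k kk; rewrite (sumsmx_sup (Ordinal js)).
Qed.

End StringStructure.

(** * String modules by generators and relations *)

Section Strings.
Variables (p : nat) (F : fieldType).
Hypotheses (p_odd : odd p) (p_pr : prime p) (chF : p \in [pchar F]).

(** The link [a] joins the factors [E_a] and [E_(a+1)]; it contributes to the
    relation of its top with the coefficient [c a]. *)
Record string_presentation i l s eps n (rM : mx_representation F (SL2 p) n)
    (x : nat -> 'rV[F]_n) (c : nat -> F) : Prop := StringPresentation {
  sp_weight : forall k, (0 < k <= s)%N ->
    weight (subg_repr rM (borel_sub p)) (x k) ((walk p i l k).-1%:Z);
  sp_full : (1%:M <= \sum_(k < s.+1 | (0 < k)%N)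
    <<orbmx (nilop (subg_repr rM (borel_sub p))) (x k) (walk p i l k)>>)%MS;
  sp_soc : forall k, (0 < k <= s)%N -> ~~ inD eps k ->
    x k *m nilop (subg_repr rM (borel_sub p)) ^+ walk p i l k = 0;
  sp_top : forall k, (0 < k <= s)%N -> inD eps k ->
    x k *m nilop (subg_repr rM (borel_sub p)) ^+ walk p i l k =
    \sum_(a < s | (0 < a)%N && ((a == k.-1 :> nat) || (a == k :> nat)))
      c a *: (x (soc_idx eps a) *m
                nilop (subg_repr rM (borel_sub p)) ^+ linkd i l a);
  sp_coef : forall a, (0 < a < s)%N -> c a != 0
}.

(** For [s = 1] the module is simple and [x] is its highest monomial. *)
Lemma string_module_presentation i l s eps n (rM : mx_representation F (SL2 p) n) :
  (0 < s)%N -> (l + s <= p - 1)%N -> is_M chF i l s eps rM ->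
  (exists x c, string_presentation i l s eps rM x c) /\
  (exists2 ks, perm_eq ks (iota 1 s) &
     has_factors rM [seq Representation (Vmod chF (walk p i l k)) | k <- ks]).
Proof.
move=> s0 Hls; rewrite /is_M; case: eqP => [s1|/eqP s1] HM; last first.
  case: HM => D simM; have s2 : (1 < s)%N by lia.
  have [tau [tauJ tau0 tauF]] := section_map simM.
  have [vc vcP] := finite_choice
    (fun k => (0, 0) : 'rV[F]_(sd_deg D k) * F) (fun j (js : (0 < j < s)%N) => sd_link p_odd p_pr s2 Hls D js).
  pose v k := (vc k).1; pose c k := (vc k).2.
  have vcl : forall j, (0 < j < s)%N -> _ := vcP.
  split.
    exists (gen_v v tau), (link_coef p i l s eps c); split.
    - by apply: (gen_v_weight p_odd p_pr s2 Hls vcl tauJ).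
    - apply: submx_trans (beta_full p_odd p_pr s2 Hls vcl tau0 tauF) _.
      apply/sumsmx_subP => k k0; rewrite (sumsmx_sup k) //.
      rewrite (beta_orb p_odd p_pr s2 Hls vcl tauJ tauF) //.
      by rewrite k0 -ltnS ltn_ord.
    - exact: (gen_v_soc p_odd p_pr s2 Hls v tauJ tauF).
    - exact: (gen_v_top p_odd p_pr s2 Hls vcl tauJ tau0 tauF).
    exact: (link_coef_neq0 p_odd p_pr s2 Hls vcl tauF).
  exists (walk_order s eps); first exact: perm_walk_order.
  by apply: (string_factors p_odd p_pr s2 Hls vcl tauJ tau0 tauF).
subst s; have /andP[w0 wp] := walk_gt0 i p_odd p_pr Hls (isT : (0 < 1 <= 1)%N).
move/mx_rsim_sym: HM => [B wn freeB homB].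
have fullB : row_full B by rewrite /row_full -{2}wn.
have hb := resV_hom homB.
pose x := monv F (walk p i l 1) (walk p i l 1).-1 *m B.
have xorb : orbmx (nilop (subg_repr rM (borel_sub p))) x (walk p i l 1) = B.
  apply/row_matrixP => r; rewrite rowK -mulmxA -(nilopX_hom _ hb) mulmxA.
  have rw := ltn_ord r; rewrite (monv_nilopX p_odd p_pr chF); last lia.
  rewrite -scalemxAl scalerA mulVf ?(ffact_neq0 chF) ?scale1r; try lia.
  by rewrite subKn -?monv_row //; lia.
have xN : x *m nilop (subg_repr rM (borel_sub p)) ^+ walk p i l 1 = 0.
  rewrite -mulmxA -(nilopX_hom _ hb) mulmxA (monv_nilopX p_odd p_pr chF); last lia.
  by rewrite ffact_small ?scale0r ?mul0mx //; lia.
have k1 k : (0 < k <= 1)%N -> k = 1%N by lia.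
split.
  exists (fun=> x), (fun=> 1); split=> [k /k1 ->|||k /k1 -> _|a].
  - apply: (weight_hom hb) => b b0; rewrite /= (monv_tor p_odd p_pr chF) ?prednK //.
    by congr (_ ^ _ *: _); lia.
  - by rewrite (sumsmx_sup (Ordinal (isT : 1 < 2)%N)) //= genmxE xorb sub1mx.
  - by move=> k /k1 -> _.
  - by rewrite xN big1 // => a /andP[a0 _]; have := ltn_ord a; lia.
  lia.
exists [:: 1%N] => //=.
apply: (@has_factors_filtration _ _ _ _ rM 1 (fun=> walk p i l 1)
  (fun=> Vmod chF (walk p i l 1)) (fun=> B)) => [j _|j g _ Gg||].
- by apply: (Vmod_irr p_odd p_pr chF); rewrite w0 ltnW.
- by rewrite homB // subrr sub0mx.
- by rewrite big_ord1.
by rewrite big_ord1 genmxE sub1mx.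
Qed.

(** Jordan-Hoelder, as simple modules [V_t] of different dimensions are not
    isomorphic. *)
Lemma comp_mult_count n (rM : mx_representation F (SL2 p) n) (ts : seq nat) t m :
  has_factors rM [seq Representation (Vmod chF k) | k <- ts] ->
  comp_mult rM (Vmod chF t) m -> m = count_mem t ts.
Proof.
case=> W [compW [lastW szW factW]] [W2 [compW2 [A [lastW2 AP <-]]]].
have eqlast : (last 0 W2 :=: last 0 W)%MS by apply: eqmx_trans lastW2 (eqmx_sym lastW).
have [szE [pi piP]] := mx_JordanHolder compW2 compW eqlast.
rewrite size_map in szW; have sz2 : size W2 = size ts by rewrite szE.
have AE k : (k \in A) = (nth 0%N ts (pi k) == t).
  have pk : (pi k < size W)%N by rewrite -szE ltn_ord.
  have fk := factW _ pk; rewrite (nth_map 0%N) in fk; last by rewrite -szW.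
  apply/idP/eqP => [/AP simk|E].
    have := mx_rsim_trans (mx_rsim_sym (mx_rsim_trans (piP k) fk)) simk.
    by case.
  by apply/AP; apply: mx_rsim_trans (piP k) _; rewrite -E.
have -> : #|A| = #|[set k : 'I_(size W2) | nth 0%N ts k == t]|.
  rewrite -(card_imset _ (@perm_inj _ pi)); congr #|pred_of_set _|; apply/setP => k.
  rewrite inE; apply/imsetP/eqP => [[j jA ->]|E].
    by apply/eqP; rewrite -AE.
  by exists (pi^-1 k)%g; rewrite ?AE permKV ?E.
rewrite -sum1_count (big_nth 0%N) -sum1_card big_mkord.
rewrite -(big_mkord (fun k => nth 0%N ts k == t) (fun=> 1%N)) -sz2 big_mkord.
by apply: eq_bigl => k; rewrite inE.
Qed.

End Strings.

(** * Dimensions along a chain *)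

Section ChainShape.
Variable p : nat.
Hypotheses (p_odd : odd p) (p_pr : prime p).

(** The dimensions in a chain of simple modules listed from the end at which
    the Borel subgroup leaves a generator unmatched. [o] tells whether the
    chain starts with a top; tops and socles alternate, a top and its
    predecessor having dimensions of sum [p + 1], a top and its successor of
    sum [p - 1]. *)
Variables (s : nat) (o : bool) (t : nat -> nat).
Hypotheses (s0 : (0 < s)%N)
  (t_range : forall q, (q < s)%N -> (0 < t q < p)%N)
  (t_soc : forall q, (q.+1 < s)%N -> odd q = o -> (t q + t q.+1 = p.+1)%N)
  (t_top : forall q, (q.+1 < s)%N -> odd q != o -> (t q + t q.+1 = p.-1)%N).

Lemma chain_dims q : (q < s)%N ->
  t q = (if o then if odd q then p - t 0 - q else t 0 + q
         else if odd q then p - t 0 + q else t 0 - q)%N.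
Proof.
elim: q => [|q IH] qs; first by rewrite /= addn0 subn0; case: o.
have {}IH := IH (ltnW qs); have := t_range qs; have := t_range (ltnW qs).
have := t_range s0; have := t_soc qs; have := t_top qs; rewrite /=.
move: IH; case: (odd q); case: o => /= -> ts tt; try (have {}ts := ts erefl); try (have {}tt := tt isT); lia.
Qed.

(** Dimension of the nonprojective summand. *)
Definition chain_dim : nat :=
  (if o then if odd s then t 0 + s./2 else p - s./2
   else if odd s then t 0 - s./2 else s./2)%N.

(** The positions of the tops that have a predecessor. *)
Definition chain_tops : seq nat := [seq (o + j.*2).+1 | j <- iota 0 (s - o)./2].

Lemma mem_chain_tops q :
  (q \in chain_tops) = [&& (0 < q)%N, (q < s)%N & odd q != o].
Proof.
clear p p_odd p_pr t_range t_soc t_top.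
apply/mapP/and3P => [[j]|[q0 qs qo]].
  rewrite mem_iota add0n => js ->; split=> //; first by case: o js => /=; lia.
  by rewrite /= oddD odd_double addbF oddb; case: o.
exists (q.-1 - o)./2; first by rewrite mem_iota; move: qo; case: o => /=; lia.
by move: qo; case: o => /=; lia.
Qed.

Lemma chain_dim_range : (0 < chain_dim <= p)%N.
Proof.
have p3 := p_gt2 p_odd p_pr; have lst : (s.-1 < s)%N by lia.
have := chain_dims lst; have := t_range lst; have := t_range s0.
rewrite /chain_dim (_ : odd s.-1 = ~~ odd s); last by rewrite -{2}(prednK s0) /= negbK.
by case: o; case: (boolP (odd s)) => os /=; lia.
Qed.

(** Pairs of consecutive dimensions have constant sums, so the partial sums have a
    closed form. *)
Lemma chain_dim_sum :
  (\sum_(q < s) t q = chain_dim + size chain_tops * p)%N.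
Proof.
have p3 := p_gt2 p_odd p_pr; have t0r := t_range s0.
have H k : (k <= s)%N -> (\sum_(q < k) t q =
    (if o then k./2 * p - k./2 + (if odd k then t 0 + k.-1 else 0)
     else k./2 * p + k./2 + (if odd k then t 0 - k.-1 else 0)))%N.
  elim: k => [|k IH] ks; first by rewrite big_ord0; case: o.
  rewrite big_ord_recr /= IH ?(ltnW ks) // chain_dims // uphalf_half.
  have := t_range ks; rewrite chain_dims // mulnDl; have kE := odd_double_half k.
  have : (k./2 <= k./2 * p)%N by rewrite leq_pmulr //; lia.
  move: kE; move: (k./2 * p)%N => hp; case: o; case: (odd k) => /= kE *; rewrite ?mul1n ?mul0n; lia.
rewrite H // /chain_dim /chain_tops size_map size_iota.
have sE := odd_double_half s; have lst : (s.-1 < s)%N by lia.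
have := t_range lst; rewrite chain_dims //.
rewrite (_ : odd s.-1 = ~~ odd s); last by rewrite -{2}(prednK s0) /= negbK.
have hp : (s./2 <= s./2 * p)%N by rewrite leq_pmulr //; lia.
have -> : (s - o)./2 = (s./2 - (o && ~~ odd s))%N by case: o; lia.
have hp2 : (0 < s./2)%N -> (p <= s./2 * p)%N by move=> h; rewrite leq_pmull.
move: hp hp2; rewrite mulnBl; move: (s./2 * p)%N => hp.
case: (o); case: (odd s) sE => /= sE; rewrite ?mul1n ?mul0n; lia.
Qed.

End ChainShape.

(** * Decomposition of a chain *)

Section Covers.
Variables (F : fieldType) (gT : finGroupType) (G : {group gT}).
Variables (n : nat) (rM : mx_representation F G n).

(** A direct sum covers the sum of what its summands cover, and a module covering
    everything in the right dimension is isomorphic to the whole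
    ([covers_rsim]); this avoids verifying that sums of submodules are direct. *)
Definition covers (R : representation F G) (A : 'M[F]_n) : Prop :=
  exists2 f : 'M[F]_(rdegree R, n), mxhom R rM f & (A <= f)%MS.

Lemma covers0 : covers (@grepr0 F gT G) 0.
Proof. by exists 0; rewrite ?sub0mx // => g _; rewrite mul0mx mulmx0. Qed.

Lemma covers_add R1 R2 A1 A2 : covers R1 A1 -> covers R2 A2 ->
  covers (dadd_grepr R1 R2) (A1 + A2)%MS.
Proof.
case=> f1 hom1 s1 [f2 hom2 s2]; exists (col_mx f1 f2) => [g Gg|].
  by rewrite /= mul_block_col !mul0mx addr0 add0r hom1 // hom2 // mul_col_mx.
by rewrite -addsmxE addsmxS.
Qed.

Lemma covers_sub R A1 A2 : (A1 <= A2)%MS -> covers R A2 -> covers R A1.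
Proof. by move=> s12 [f hom s2]; exists f => //; apply: submx_trans s2. Qed.

Lemma covers_big (I : Type) (r : seq I) (R : I -> representation F G) A :
  (forall i, covers (R i) (A i)) ->
  covers (\big[dadd_grepr/@grepr0 F gT G]_(i <- r) R i) (\sum_(i <- r) A i)%MS.
Proof.
move=> cov; elim: r => [|i r IH]; first by rewrite !big_nil; apply: covers0.
by rewrite !big_cons; apply: covers_add.
Qed.

Lemma rdegree_big (I : Type) (r : seq I) (R : I -> representation F G) :
  rdegree (\big[dadd_grepr/@grepr0 F gT G]_(i <- r) R i) =
  (\sum_(i <- r) rdegree (R i))%N.
Proof. by elim: r => [|i r IH]; rewrite ?big_nil // !big_cons /= IH. Qed.

Lemma covers_muln R T (vs : seq T) (A : T -> 'M_n) :
  (forall v, covers R (A v)) ->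
  covers (muln_grepr R (size vs)) (\sum_(v <- vs) A v)%MS.
Proof.
case: vs => [|v0 vs] cov.
  by rewrite /muln_grepr big_ord0 big_nil; apply: covers0.
rewrite (big_nth v0) big_mkord; exact: covers_big.
Qed.

Lemma covers_rsim R : covers R 1%:M -> rdegree R = n -> mx_rsim rM R.
Proof.
case=> f hom; rewrite sub1mx => /eqP full dim.
by apply: mx_rsim_sym; exists f; rewrite // /row_free full dim.
Qed.

End Covers.

Section Chain.
Variables (p : nat) (F : fieldType).
Hypotheses (p_odd : odd p) (p_pr : prime p) (chF : p \in [pchar F]).
Variables (n : nat) (rB : mx_representation F (borel p) n).
Local Notation N := (nilop rB).

Variables (s : nat) (o : bool) (t : nat -> nat) (y : nat -> 'rV[F]_n) (e : nat -> F).
Hypotheses (s0 : (0 < s)%N)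
  (t_range : forall q, (q < s)%N -> (0 < t q < p)%N)
  (t_soc : forall q, (q.+1 < s)%N -> odd q = o -> (t q + t q.+1 = p.+1)%N)
  (t_top : forall q, (q.+1 < s)%N -> odd q != o -> (t q + t q.+1 = p.-1)%N)
  (y_weight : forall q, (q < s)%N -> weight rB (y q) ((t q).-1%:Z))
  (y_soc : forall q, (q < s)%N -> odd q = o -> y q *m N ^+ t q = 0)
  (y_top : forall q, (q < s)%N -> odd q != o -> y q *m N ^+ t q =
     (if (0 < q)%N then e q.-1 *: (y q.-1 *m N) else 0) +
     (if (q.+1 < s)%N then e q *: y q.+1 else 0))
  (e_neq0 : forall q, (q.+1 < s)%N -> e q != 0).

Let chain_dims := chain_dims p_odd p_pr s0 t_range t_soc t_top.
Local Notation chain_dim := (chain_dim p s o t).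
Local Notation chain_tops := (chain_tops s o).
Let mem_chain_tops := mem_chain_tops o s0.

(** The relation of the top [y_(q+1)] expresses [y_q N] by [y_(q+2)] and an element
    of the free module generated by that top. Its power of [N] is chosen so that
    subtracting a multiple of it from [u] replaces [k y_q N] by a multiple of
    [y_(q+2)], one more power of [N] having been applied to [u]. *)
Lemma chain_next m u k : ((o + m.*2).+1 < s)%N ->
  weight rB u ((t 0).-1%:Z) -> u *m N ^+ (o * t 0 + m) = k *: y (o + m.*2) ->
  let u' := u - (k / e (o + m.*2)) *:
      (y (o + m.*2).+1 *m N ^+ (t (o + m.*2).+1 - (o * t 0 + m).+1)) in
  weight rB u' ((t 0).-1%:Z) /\
  u' *m N ^+ (o * t 0 + m).+1 = - (k / e (o + m.*2)) *:
     (if ((o + m.*2).+2 < s)%N then e (o + m.*2).+1 *: y (o + m.*2).+2 else 0).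
Proof.
set q := (o + m.*2)%N => qs wu uN; set E := (o * t 0 + m)%N in uN *.
have qo : odd q.+1 != o by rewrite /= /q oddD odd_double addbF oddb; case: o.
have p3 := p_gt2 p_odd p_pr; have t0r := t_range s0.
have tE := chain_dims qs; have tr := t_range qs.
have Et : (E.+1 <= t q.+1)%N.
  by move: tE tr qo; rewrite /E /q; case: o => /=; case: (odd _) => //=; lia.
move=> u'; split.
  apply: weight_sub => //; apply: weight_scale.
  apply: (weightE p_pr chF _ (weight_nilopX p_odd p_pr chF _ (y_weight qs))).
  apply/eqP; rewrite eqz_mod_dvd; apply/dvdzP.
  exists (if o then 0 else -1); move: tE tr qo Et; rewrite /E /q.
  by case: o => /=; case: (odd _) => //=; lia.
rewrite mulmxBl -scalemxAl -mulmxA -mxpowD subnK // y_top // /=.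
rewrite mxpowSr mulmxA uN -scalemxAl scalerDr scalerA divfK; last first.
  exact: e_neq0.
by rewrite opprD addrA subrr add0r scaleNr.
Qed.

(** Following the chain, a generator of the nonprojective part is corrected by
    elements of the free modules spanned by the tops so that a power of the
    nilpotent operator sends it to a multiple of the next socle generator. *)
Lemma chain_induct m : (o + m.*2 < s)%N -> exists u : 'rV[F]_n, exists2 k : F, k != 0 &
  [/\ weight rB u ((t 0).-1%:Z), u *m N ^+ (o * t 0 + m) = k *: y (o + m.*2) &
   forall W : 'M[F]_n, (W *m N <= W)%MS -> (u <= W)%MS ->
     (forall q, q \in chain_tops -> (y q <= W)%MS) ->
     forall q, (q <= o + m.*2)%N -> (y q <= W)%MS].
Proof.
have stabX (W : 'M[F]_n) (v : 'rV_n) k : (W *m N <= W)%MS -> (v <= W)%MS ->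
    (v *m N ^+ k <= W)%MS.
  move=> WN vW; elim: k => [|k IH]; first by rewrite expr0 mulmx1.
  by rewrite mxpowSr mulmxA; apply: submx_trans WN; apply: submxMr.
elim: m => [|m IH] ms.
  rewrite double0 !addn0 in ms *.
  have [oE|oE] : o = true \/ o = false by case: (o); [left | right].
    rewrite oE /= mul1n in ms *.
    have e0 := e_neq0 ms; have y0 : y 0%N *m N ^+ t 0 = e 0%N *: y 1%N.
      by rewrite y_top ?oE //= ms add0r.
    exists (y 0%N), (e 0%N) => //; split=> //.
      exact: y_weight.
    move=> W WN uW _ [|[|q]] // _.
    have := stabX W _ (t 0) WN uW; rewrite y0.
    by move/(scalemx_sub (e 0%N)^-1); rewrite scalerA mulVf ?scale1r.
  rewrite oE /= mul0n in ms *.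
  exists (y 0%N), 1; rewrite ?oner_neq0 //; rewrite expr0 mulmx1 scale1r; split=> //.
    exact: y_weight.
  by move=> W _ uW _ [|q].
have ms' : ((o + m.*2).+1 < s)%N by lia.
have ms2 : ((o + m.*2).+2 < s)%N by lia.
have [u [k k0 [wu uN gen]]] := IH (ltn_trans (ltnSn _) ms').
have [wu' u'N] := chain_next ms' wu uN.
move: u'N; rewrite ms2 scalerA; set u' := _ - _ in wu' *; set k' := _ * _ => u'N.
have e1 := e_neq0 ms'; have e2 := e_neq0 ms2.
have k'0 : k' != 0 by rewrite /k' mulf_neq0 // oppr_eq0 mulf_neq0 // invr_eq0.
have qE : (o + m.+1.*2 = (o + m.*2).+2)%N by lia.
exists u', k' => //; rewrite addnS qE; split=> // W WN uW tops q.
have yt : (y (o + m.*2).+1 <= W)%MS.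
  apply: tops; rewrite mem_chain_tops ms' /= oddD odd_double addbF oddb.
  by case: o.
have uW' : (u <= W)%MS.
  rewrite -[u](subrK ((k / e (o + m.*2)%N) *: (y (o + m.*2).+1 *m
    N ^+ (t (o + m.*2).+1 - (o * t 0 + m).+1)))) addmx_sub // scalemx_sub //.
  exact: stabX.
rewrite leq_eqVlt => /predU1P[->|].
  have := stabX W _ (o * t 0 + m).+1 WN uW; rewrite u'N.
  by move/(scalemx_sub k'^-1); rewrite scalerA mulVf ?scale1r.
rewrite ltnS leq_eqVlt => /predU1P[->//|]; exact: gen.
Qed.

(** The chain ends with a socle, whose generator is killed by a known power, or
    with a top, whose relation has no successor term. *)
Lemma chain_generator : exists u : 'rV[F]_n,
  [/\ weight rB u ((t 0).-1%:Z), u *m N ^+ chain_dim = 0 &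
   forall W : 'M[F]_n, (W *m N <= W)%MS -> (u <= W)%MS ->
     (forall q, q \in chain_tops -> (y q <= W)%MS) ->
     forall q, (q < s)%N -> (y q <= W)%MS].
Proof.
have [so|so] := leqP s o.
  have [oE sE] : o = true /\ s = 1%N by move: so s0; case: o => /=; lia.
  exists (y 0%N); split; first exact: y_weight.
    by rewrite /chain_dim oE sE /= addn0 y_top ?oE // sE addr0.
  by move=> W _ uW _ q; rewrite sE; case: q.
pose m := (s - o.+1)./2.
have ms : (o + m.*2 < s)%N by rewrite /m; lia.
have [u [k k0 [wu uN gen]]] := chain_induct ms.
have tE := chain_dims ms; have tr := t_range ms; have t0r := t_range s0.
have om : odd (o + m.*2) = o by rewrite oddD odd_double addbF oddb.
have [last_soc|last_top] : s = (o + m.*2).+1 \/ s = (o + m.*2).+2 by rewrite /m; lia.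
  exists u; split=> // [|W WN uW tops q qs]; last by apply: gen => //; lia.
  have -> : chain_dim = (o * t 0 + m + t (o + m.*2))%N.
    rewrite /chain_dim tE om; have -> : odd s = ~~ o by rewrite last_soc /= om.
    by rewrite last_soc; move: tr; rewrite tE om; case: o => /=; lia.
  by rewrite mxpowD mulmxA uN -scalemxAl y_soc // scaler0.
have ms' : ((o + m.*2).+1 < s)%N by rewrite last_top.
have [wu' u'N] := chain_next ms' wu uN.
move: u'N; rewrite {1}last_top ltnn scaler0; set u' := _ - _ in wu' * => u'N.
exists u'; split=> // [|W WN uW tops q].
  have -> : chain_dim = (o * t 0 + m).+1; last by [].
  rewrite /chain_dim; have -> : odd s = o by rewrite last_top /= om negbK.
  by rewrite last_top; move: tr; rewrite tE om; case: o => /=; lia.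
have yt : (y (o + m.*2).+1 <= W)%MS.
  by apply: tops; rewrite mem_chain_tops ms' /= om; case: o.
have uW' : (u <= W)%MS.
  rewrite -[u](subrK ((k / e (o + m.*2)%N) *: (y (o + m.*2).+1 *m
    N ^+ (t (o + m.*2).+1 - (o * t 0 + m).+1)))) addmx_sub // scalemx_sub //.
  elim: (_ - _)%N => [|j IH]; first by rewrite expr0 mulmx1.
  by rewrite mxpowSr mulmxA; apply: submx_trans WN; apply: submxMr.
rewrite {1}last_top ltnS leq_eqVlt => /predU1P[->//|]; exact: gen.
Qed.

(** By [chain_generator], a submodule containing the corrected generator and the
    tops with a predecessor contains all the generators; and each of these few
    vectors generates the image of a module [U_(a,b)], with [b = p] for the
    tops. *)
Theorem chain_covers a (Mult : 'I_(p - 1) -> nat) :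
  ((t 0).-1%:Z = a + (2 * chain_dim.-1)%N%:Z %[mod p.-1])%Z ->
  (forall c : 'I_(p - 1), Mult c = count (fun q => (t q).-1 == c) chain_tops) ->
  (1%:M <= \sum_(q < s) <<orbmx N (y q) (t q)>>)%MS ->
  covers rB (dadd_grepr (Representation (Umod chF a chain_dim))
    (\big[dadd_grepr/@grepr0 F _ (borel p)]_(c < p - 1)
       muln_grepr (Representation (Umod chF c%:Z p)) (Mult c))) 1%:M.
Proof.
move=> aE multE full; have [u [wu uN gen]] := chain_generator.
have p3 := p_gt2 p_odd p_pr; have /andP[b0 bp] := chain_dim_range p_odd p_pr s0 t_range t_soc t_top.
pose tops c := [seq q <- chain_tops | (t q).-1 == c].
pose A (q : nat) : 'M[F]_n := if q \in chain_tops then <<orbmx N (y q) p>>%MS else 0.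
have covU : covers rB (Representation (Umod chF a chain_dim)) <<orbmx N u chain_dim>>%MS.
  by exists (orbmx N u chain_dim); rewrite ?genmxE //; apply: (orbmx_hom p_odd p_pr chF bp wu uN aE).
have covA q : covers rB (Representation (Umod chF ((t q).-1)%:Z p)) (A q).
  rewrite /A; case: ifP => qt; last first.
    by exists 0; rewrite ?sub0mx // => g _; rewrite mul0mx mulmx0.
  move: qt; rewrite mem_chain_tops => /and3P[_ qs _].
  exists (orbmx N (y q) p); rewrite ?genmxE //.
  apply: (orbmx_hom p_odd p_pr chF (leqnn p) (y_weight qs)).
    by rewrite (nilop_expp p_odd p_pr chF) mulmx0.
  apply/eqP; rewrite eqz_mod_dvd opprD addNKr; apply/dvdzP; exists (-2); lia.
pose A' (c q : nat) := if (t q).-1 == c then A q else 0.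
have covA' (c q : nat) : covers rB (Representation (Umod chF c%:Z p)) (A' c q).
  rewrite /A'; case: eqP => [<-|_]; first exact: covA.
  by exists 0; rewrite ?sub0mx // => g _; rewrite mul0mx mulmx0.
have covM (c : 'I_(p - 1)) : covers rB
    (muln_grepr (Representation (Umod chF c%:Z p)) (Mult c)) (\sum_(q <- tops c) A' c q)%MS.
  by rewrite multE -size_filter -/(tops c); apply: covers_muln.
have cov := covers_add covU (covers_big (index_enum _) covM).
apply: covers_sub cov; set W := (_ + _)%MS.
have AW q : q \in chain_tops -> (<<orbmx N (y q) p>> <= W)%MS.
  move=> qt; have /and3P[_ qs _] : [&& (0 < q)%N, (q < s)%N & odd q != o].
    by rewrite -mem_chain_tops.
  have tq := t_range qs; have cq : ((t q).-1 < p - 1)%N by lia.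
  apply: submx_trans (addsmxSr _ _).
  rewrite (sumsmx_sup (Ordinal cq)) //= (big_rem q) /=; last first.
    by rewrite mem_filter eqxx.
  by rewrite {1}/A' eqxx {1}/A qt addsmxSl.
have stab0 : ((0 : 'M[F]_n) *m N <= (0 : 'M[F]_n))%MS by rewrite mul0mx.
have stabD (B C : 'M[F]_n) :
    (B *m N <= B)%MS -> (C *m N <= C)%MS -> ((B + C)%MS *m N <= (B + C)%MS)%MS.
  by move=> BN CN; rewrite addsmxMr addsmxS.
have stab_orb m v w b : (b <= p)%N -> weight rB v w -> v *m N ^+ b = 0 ->
    (w = m + (2 * b.-1)%N%:Z %[mod p.-1])%Z ->
    (<<orbmx N v b>> *m N <= <<orbmx N v b>>)%MS.
  move=> bp' wv vb wE; rewrite genmxE (eqmxMr _ (genmxE _)).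
  by rewrite -(nilop_hom (orbmx_hom p_odd p_pr chF bp' wv vb wE)) submxMl.
have WN : (W *m N <= W)%MS.
  apply: (stabD); first exact: (stab_orb a _ _ _ bp wu uN aE).
  elim/big_ind: _ => // c _; elim/big_ind: _ => // q _.
  rewrite /A'; case: ifP => // _; rewrite /A; case: ifP => // qt.
  have qs : (q < s)%N by move: qt; rewrite mem_chain_tops => /and3P[].
  apply: (stab_orb ((t q).-1%:Z) _ _ _ (leqnn p) (y_weight qs)).
    by rewrite (nilop_expp p_odd p_pr chF) mulmx0.
  apply/eqP; rewrite eqz_mod_dvd opprD addNKr; apply/dvdzP; exists (-2); lia.
have yW q : (q < s)%N -> (y q <= W)%MS.
  apply: gen => // [|q' qt].
    apply: submx_trans (addsmxSl _ _); rewrite genmxE.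
    have := @orbmx_sub _ _ p_odd p_pr chF _ N u chain_dim 0; rewrite expr0 mulmx1.
    by apply; rewrite b0.
  apply: submx_trans (AW q' qt); rewrite genmxE.
  have := @orbmx_sub _ _ p_odd p_pr chF _ N (y q') p 0; rewrite expr0 mulmx1.
  by apply; rewrite leqnn; lia.
apply: submx_trans full _; apply/sumsmx_subP => q _; rewrite genmxE.
apply: (orbmx_subP p_odd p_pr chF) => j _.
elim: j => [|j IH]; first by rewrite expr0 mulmx1 yW.
by rewrite mxpowSr mulmxA; apply: submx_trans WN; apply: submxMr.
Qed.
End Chain.

(** * Counting weights *)

Section Occurrences.
Variables (p : nat).
Hypotheses (p_odd : odd p) (p_pr : prime p).

Definition congr_ind (w c : int) : nat := (w == c %[mod p.-1])%Z.

(** The multiplicity of [S_c] in a module with the weights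
    [w, w - 2, ..., w - 2 (b - 1)]. *)
Definition occ (w : int) (b : nat) (c : int) : nat :=
  (\sum_(j < b) congr_ind (w - (2 * j)%N%:Z) c)%N.

Lemma congr_ind_eq w w' c : (w = w' %[mod p.-1])%Z -> congr_ind w c = congr_ind w' c.
Proof. by rewrite /congr_ind => ->. Qed.

Lemma occ_eq w w' b c : (w = w' %[mod p.-1])%Z -> occ w b c = occ w' b c.
Proof.
move=> E; apply: eq_bigr => j _; apply: congr_ind_eq.
by rewrite -modzDml E modzDml.
Qed.

Lemma occD w b1 b2 c : occ w (b1 + b2) c = (occ w b1 c + occ (w - (2 * b1)%N%:Z) b2 c)%N.
Proof.
rewrite /occ big_split_ord /=; congr (_ + _)%N.
apply: eq_bigr => j _; congr congr_ind; rewrite mulnDr PoszD; ring.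
Qed.

Lemma occ1 w c : occ w 1 c = congr_ind w c.
Proof. by rewrite /occ big_ord1 muln0 subr0. Qed.

Lemma floor_div (m : int) : Num.floor (m%:~R / (p%:R - 1) : rat) = (m %/ p.-1)%Z.
Proof.
have p2 := prime_gt1 p_pr; have -> : (p%:R - 1 : rat) = (p.-1)%:R.
  by rewrite -{1}(prednK (ltnW p2)) -addn1 natrD addrK.
have p0 : 0 < (p.-1)%:R :> rat by rewrite ltr0n; lia.
apply: floor_def; rewrite ler_pdivlMr // ltr_pdivrMr //.
have [m1 m2] : (m %/ p.-1)%Z * (p.-1)%:Z <= m /\ m < ((m %/ p.-1)%Z + 1) * (p.-1)%:Z.
  have := divz_eq m p.-1; have := modz_ge0 m (d := (p.-1)%:Z); have := ltz_pmod m (d := (p.-1)%:Z); lia.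
have E : (p.-1)%:R = (p.-1)%:Z%:~R :> rat by [].
by rewrite E -!intrM ler_int ltr_int; apply/andP.
Qed.

Lemma theta_divz (a b c : int) : (a == c %[mod 2])%Z ->
  theta p a b c = ((2 * (b - 1) + a - c) %/ p.-1)%Z + ((c - a) %/ p.-1)%Z + 1.
Proof.
move=> ac; rewrite /theta ac floor_div ceilNfloor -mulNr -rmorphN floor_div.
by rewrite opprK opprB.
Qed.

Lemma occSr w b c : occ w b.+1 c = (occ w b c + congr_ind (w - (2 * b)%N%:Z) c)%N.
Proof. by rewrite -addn1 occD occ1. Qed.

Lemma occSl w b c : occ w b.+1 c = (congr_ind w c + occ (w - 2) b c)%N.
Proof. by rewrite -add1n occD occ1. Qed.

Lemma divz_opp_pred (h : nat) (x : int) : 0 < h%:Z :> int ->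
  (- x %/ h)%Z = - ((x - 1) %/ h)%Z - 1.
Proof.
move=> h0; have E := divz_eq (x - 1) h; have r0 := modz_ge0 (x - 1) (lt0r_neq0 h0).
have r1 := ltz_pmod (x - 1) h0; move: E r0 r1.
move: ((x - 1) %/ h)%Z ((x - 1) %% h)%Z => k r E r0 r1.
have -> : - x = (- k - 1) * h%:Z + (h%:Z - 1 - r).
  by rewrite mulrBl mulNr mul1r; lia.
by rewrite divzMDl ?lt0r_neq0 // divz_small ?addr0 //; lia.
Qed.

Lemma divz_step (h : nat) (x : int) : 0 < h%:Z :> int ->
  (x %/ h)%Z = ((x - 1) %/ h)%Z + (h %| x)%Z%:Z.
Proof.
move=> h0; have E := divz_eq (x - 1) h; have r0 := modz_ge0 (x - 1) (lt0r_neq0 h0).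
have r1 := ltz_pmod (x - 1) h0; move: E r0 r1.
move: ((x - 1) %/ h)%Z ((x - 1) %% h)%Z => k r E r0 r1.
have -> : x = k * h%:Z + (r + 1) by lia.
rewrite divzMDl ?lt0r_neq0 // rpredDl ?dvdz_mull //.
have [->|rh] := eqVneq (r + 1) h%:Z; first by rewrite divzz dvdzz lt0r_neq0.
rewrite divz_small ?addr0; last by move: rh; lia.
suff -> : (h %| r + 1)%Z = false by rewrite addr0.
by apply/dvdz_mod0P; rewrite modz_small; move: rh; lia.
Qed.

(** By induction on [b]: halving all weights, the floor increases at the step that
    adds a weight exactly when this weight is congruent to [c]. *)
Lemma theta_occ (a : int) (b : nat) (c : int) :
  theta p a b c = (occ (a + 2 * (b%:Z - 1)) b c)%:Z.
Proof.
have p3 := p_gt2 p_odd p_pr.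
have [h hE h0] : exists2 h : nat, (p.-1)%:Z = 2 * h%:Z & 0 < h%:Z :> int.
  by exists (p.-1)./2; lia.
have [ac|ac] := boolP (a == c %[mod 2])%Z; last first.
  rewrite /theta (negPf ac) /occ big1 // => j _; apply/eqP; rewrite eqb0.
  apply: contra ac; rewrite !eqz_mod_dvd => /dvdzP[q]; rewrite hE => qE.
  apply/dvdzP; exists (q * h%:Z - b%:Z + 1 + j%:Z).
  have -> : a - c = (a + 2 * (b%:Z - 1) - (2 * j)%N%:Z - c) - 2 * (b%:Z - 1) + 2 * j%:Z by lia.
  by rewrite qE; ring.
rewrite theta_divz //; have [q qE] : exists q, a - c = q * 2.
  by move: ac; rewrite eqz_mod_dvd => /dvdzP.
have dE (x : int) : ((x * 2) %/ p.-1)%Z = (x %/ h)%Z.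
  by rewrite hE mulrC divzMpl.
have cE (x : int) : congr_ind (x * 2 + c) c = (h %| x)%Z.
  by rewrite /congr_ind eqz_mod_dvd addrK hE [x * 2]mulrC dvdz_mul2l.
have -> : (c - a = - q * 2)%R by lia.
have -> : 2 * (b%:Z - 1) + a - c = (b%:Z - 1 + q) * 2 by lia.
have -> : a + 2 * (b%:Z - 1) = (b%:Z - 1 + q) * 2 + c by lia.
rewrite !dE divz_opp_pred //; elim: b => [|b IH].
  by rewrite /occ big_ord0 addrC [0 - 1 + q]addrC sub0r; lia.
rewrite occSl cE PoszD.
have -> : (b.+1%:Z - 1 + q) * 2 + c - 2 = (b%:Z - 1 + q) * 2 + c by lia.
rewrite -IH [((b.+1%:Z - 1 + q) %/ h)%Z]divz_step //.
have -> : b.+1%:Z - 1 + q - 1 = b%:Z - 1 + q by lia.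
lia.
Qed.

(** The [p] weights of a projective module run through the residues of one parity
    twice, and come back once more to the first one. *)
Lemma theta_projective (a c : int) :
  theta p a p c =
  if (a == c %[mod 2])%Z then 2 + (congr_ind a c)%:Z else 0.
Proof.
have p3 := p_gt2 p_odd p_pr.
have [ac|ac] := boolP (a == c %[mod 2])%Z; last by rewrite /theta (negPf ac).
rewrite theta_divz //; have h0 : 0 < (p.-1)%:Z :> int by lia.
have -> : 2 * (p%:Z - 1) + a - c = 2 * (p.-1)%:Z + (a - c) by lia.
rewrite divzMDl ?lt0r_neq0 // -[c - a]opprB divz_opp_pred // [((a - c) %/ _)%Z]divz_step //.
by rewrite /congr_ind eqz_mod_dvd; lia.
Qed.

End Occurrences.

Section ChainCount.
Variables (p : nat).
Hypotheses (p_odd : odd p) (p_pr : prime p).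
Variables (s : nat) (o : bool) (t : nat -> nat).
Hypotheses (s0 : (0 < s)%N)
  (t_range : forall q, (q < s)%N -> (0 < t q < p)%N)
  (t_soc : forall q, (q.+1 < s)%N -> odd q = o -> (t q + t q.+1 = p.+1)%N)
  (t_top : forall q, (q.+1 < s)%N -> odd q != o -> (t q + t q.+1 = p.-1)%N).
Local Notation chain_dim := (chain_dim p s o t).
Local Notation chain_tops := (chain_tops s o).

(** A socle and the next top have dimensions of sum [p + 1]. Their weights are
    those of a free module with the generator of the top, together with the
    highest weight of the socle, which is the next weight of the nonprojective
    summand. *)
Lemma chain_occ_pairs c m : (o + m.*2 <= s)%N ->
  (\sum_(q < o + m.*2) occ p ((t q).-1)%:Z (t q) c =
   occ p ((t 0).-1)%:Z (o * t 0 + m) c +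
   \sum_(j < m) occ p ((t (o + j.*2).+1).-1)%:Z p c)%N.
Proof.
have dims := chain_dims p_odd p_pr s0 t_range t_soc t_top.
have p3 := p_gt2 p_odd p_pr; have t0r := t_range s0.
elim: m => [|m IH] ms.
  by rewrite big_ord0 !addn0; case: (o) => /=; rewrite ?big_ord1 ?mul1n ?big_ord0 // /occ big_ord0.
have qs : ((o + m.*2).+1 < s)%N by move: ms; rewrite doubleS !addnS.
rewrite doubleS !addnS !big_ord_recr /= IH; last by lia.
set q := (o + m.*2)%N in qs *.
have qo : odd q = o by rewrite /q oddD odd_double addbF oddb.
have tr := t_range qs; have tr' := t_range (ltnW qs); have ts := t_soc qs qo.
have tE := dims _ (ltnW qs).
rewrite occSr.
have -> : congr_ind p ((t 0).-1%:Z - (2 * (o * t 0 + m))%N%:Z) c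
    = congr_ind p ((t q).-1)%:Z c.
  apply: congr_ind_eq; apply/eqP; rewrite eqz_mod_dvd; apply/dvdzP.
  exists (- o%:Z); rewrite tE qo /q; move: tr'; rewrite tE qo /q.
  by case: (o) => /=; lia.
have pE : p = (t q.+1 + (t q).-1)%N by lia.
have -> : occ p (t q.+1).-1 p c = occ p (t q.+1).-1 (t q.+1 + (t q).-1) c by rewrite -pE.
rewrite [occ p _ (t q.+1 + _) c]occD.
have -> : occ p ((t q).-1)%:Z (t q) c =
    (congr_ind p ((t q).-1)%:Z c + occ p ((t q).-1%:Z - 2) (t q).-1 c)%N.
  by rewrite -{2}(prednK (proj1 (andP tr'))) occSl.
have -> : occ p ((t q.+1).-1%:Z - (2 * t q.+1)%N%:Z) (t q).-1 c =
    occ p ((t q).-1%:Z - 2) (t q).-1 c.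
  apply: occ_eq; apply/eqP; rewrite eqz_mod_dvd; apply/dvdzP; exists (-1); lia.
by rewrite (AC (2*2*1) ((1*3)*(2*(5*4)))).
Qed.

Lemma chain_occ c :
  (\sum_(q < s) occ p ((t q).-1)%:Z (t q) c =
   occ p ((t 0).-1)%:Z chain_dim c +
   \sum_(q <- chain_tops) occ p ((t q).-1)%:Z p c)%N.
Proof.
have dims := chain_dims p_odd p_pr s0 t_range t_soc t_top.
have p3 := p_gt2 p_odd p_pr; have t0r := t_range s0.
pose m := (s - o)./2; have ms : (o + m.*2 <= s)%N by rewrite /m; case: (o) => /=; lia.
have -> : (\sum_(q <- chain_tops) occ p ((t q).-1)%:Z p c =
    \sum_(j < m) occ p ((t (o + j.*2).+1).-1)%:Z p c)%N.
  rewrite /chain_tops big_map -/m -(big_mkord xpredT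
    (fun j => occ p (t (o + j.*2).+1).-1 p c)).
  by rewrite /index_iota subn0.
have om : odd (o + m.*2) = o by rewrite oddD odd_double addbF oddb.
have [sE|sE] : s = (o + m.*2)%N \/ s = (o + m.*2).+1.
- by rewrite /m; case: (o) => /=; lia.
- have := chain_occ_pairs c ms; rewrite -sE => ->; congr (occ _ _ _ _ + _)%N.
  rewrite /chain_dim sE om; case: (o) => /=; lia.
have -> : (\sum_(q < s) occ p (t q).-1%:Z (t q) c =
    \sum_(q < (o + m.*2).+1) occ p (t q).-1%:Z (t q) c)%N by rewrite -sE.
rewrite big_ord_recr /= chain_occ_pairs // addnAC; congr (_ + _)%N.
have qs : (o + m.*2 < s)%N by rewrite sE.
have tr := t_range qs; have tE := dims _ qs; rewrite om in tE.
have -> : chain_dim = (o * t 0 + m + t (o + m.*2))%N.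
  rewrite /chain_dim tE; have -> : odd s = ~~ o by rewrite sE /= om.
  by rewrite sE; move: tr; rewrite tE; case: (o) => /=; lia.
rewrite [in RHS]occD; congr (_ + _)%N; apply: occ_eq; apply/eqP; rewrite eqz_mod_dvd.
apply/dvdzP; exists o%:Z; move: tr; rewrite tE.
by case: (o) => /=; lia.
Qed.

End ChainCount.

(** * The multiplicities of the projective summands *)

Section Multiplicities.

Lemma big_nat_pred1 (R : nmodType) (m n k : nat) (f : nat -> R) : (m <= k < n)%N ->
  \sum_(m <= j < n) (if k == j then f j else 0) = f k.
Proof.
move=> kmn; rewrite (bigD1_seq k) ?iota_uniq ?mem_index_iota //= eqxx big1 ?addr0 //.
by move=> j; rewrite eq_sym => /negPf->.
Qed.

Lemma sum_count_mem (m n : nat) (ts : seq nat) (f : nat -> int) :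
  {in ts, forall u, m <= u < n}%N ->
  \sum_(m <= u < n) (count_mem u ts)%:Z * f u = \sum_(u <- ts) f u.
Proof.
elim: ts => [|v ts IH] tsmn.
  by rewrite big_nil big1 // => u _; rewrite mul0r.
rewrite big_cons -IH => [|u us]; last by apply: tsmn; rewrite inE us orbT.
rewrite -(@big_nat_pred1 _ m n v f) ?tsmn ?mem_head // -big_split /=.
by apply: eq_bigr => u _; rewrite PoszD mulrDl; case: eqP => _; rewrite ?mul1r ?mul0r.
Qed.

Lemma half_index_eq (i c d : nat) : (i <= 1)%N -> odd c = odd i -> odd d = odd i ->
  ((d + 2 - i)./2 == (c + 2 - i)./2) = (d == c).
Proof.
move=> i1 ci di; have iE : i = odd i by case: i i1 {ci di} => [|[]].
rewrite -(odd_double_half c) -(odd_double_half d) ci di -iE -!addnA !addKn.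
by rewrite -!(doubleD _ 1) !doubleK !eqn_add2r !eqn_add2l -!muln2 eqn_mul2r.
Qed.

Variables (p : nat).
Hypotheses (p_odd : odd p) (p_pr : prime p).

(** [V_u] restricts to [U_(1-u,u)], and [p - u] is congruent to [1 - u]. *)
Lemma theta_simple (u : nat) (c : int) : (0 < u)%N ->
  theta p (p%:Z - u%:Z) u%:Z c = (occ p (u.-1)%:Z u c)%:Z.
Proof.
move=> u0; rewrite theta_occ //; congr Posz; apply: occ_eq.
apply/eqP; rewrite eqz_mod_dvd; apply/dvdzP; exists 1; lia.
Qed.

(** [delta] is the inverse of the matrix [2 + (r == j)] of multiplicities of the
    simple modules of one parity in the projective ones. *)
Lemma delta_sum (h r k : nat) : p = h.*2.+1 -> (1 <= r <= h)%N -> (1 <= k <= h)%N ->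
  \sum_(1 <= j < h.+1) delta p r j * (2 + (k == j)%:R) = (k == r)%:R.
Proof.
move=> pE rh kh; have p0 : p%:R != 0 :> rat by rewrite pE pnatr_eq0.
have E j : delta p r j * (2 + (k == j)%:R) =
    ((if r == j then 2 + (k == j)%:R else 0) - 2 / p%:R * 2) +
    (if k == j then - 2 / p%:R else 0) :> rat.
  by rewrite /delta; case: (r == j); case: (k == j) => /=; field.
under eq_bigr => j _ do rewrite E.
rewrite big_split sumrB /= !big_nat_pred1 //.
rewrite sumr_const_nat subn1 /= -[_ *+ h]mulr_natr.
have -> : (h%:R : rat) = (p%:R - 1) / 2.
  by rewrite pE -addn1 natrD addrK -muln2 natrM mulfK.
by field.
Qed.

Lemma delta_theta (i c d : nat) : (i <= 1)%N -> (c < p - 1)%N -> (d < p - 1)%N ->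
  odd c = odd i -> odd d = odd i ->
  \sum_(1 <= j < ((p - 1)./2).+1)
     delta p (c + 2 - i)./2 j * (theta p d p (i + 2 * (j - 1))%N)%:~R = (d == c)%:R.
Proof.
move=> i1 cp dp ci di; have p3 := p_gt2 p_odd p_pr.
set h := (p - 1)./2; have pE : p = h.*2.+1 by rewrite /h; lia.
rewrite -(half_index_eq i1 ci di) -(@delta_sum h) //; [|lia|lia].
apply: eq_big_nat => j jh; congr (_ * _); rewrite theta_projective //.
have jE : d%:Z - (i + 2 * (j - 1))%N%:Z = (((d + 2 - i)./2)%:Z - j%:Z) * 2 by lia.
have -> : (d%:Z == (i + 2 * (j - 1))%N%:Z %[mod 2])%Z.
  by rewrite eqz_mod_dvd jE dvdz_mull.
suff -> : congr_ind p d (i + 2 * (j - 1))%N = ((d + 2 - i)./2 == j) :> nat.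
  by rewrite rmorphD.
rewrite /congr_ind !modz_small; [|lia|lia].
by congr (nat_of_bool _); apply/eqP/eqP; lia.
Qed.

Variables (s i l : nat) (eps : int) (o : bool) (t : nat -> nat) (Theta : nat -> nat).
Hypotheses (s0 : (0 < s)%N) (Hi : (i <= 1)%N)
  (t_range : forall q, (q < s)%N -> (0 < t q < p)%N)
  (t_soc : forall q, (q.+1 < s)%N -> odd q = o -> (t q + t q.+1 = p.+1)%N)
  (t_top : forall q, (q.+1 < s)%N -> odd q != o -> (t q + t q.+1 = p.-1)%N)
  (t_odd : forall q, (q < s)%N -> odd (t q) != odd i)
  (ThetaE : forall u, (0 < u < p)%N -> Theta u = count_mem u [seq t q | q <- iota 0 s])
  (Lval_dim : Lval p i l s = (chain_dim p s o t)%:Z)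
  (aval_weight : ((t 0).-1%:Z =
     aval p i l s eps + (2 * (chain_dim p s o t).-1)%N%:Z %[mod p.-1])%Z).

Lemma kappa_tops c : kappa p i l s eps Theta c =
  \sum_(q <- chain_tops s o) theta p (t q).-1 p c.
Proof.
have p3 := p_gt2 p_odd p_pr.
have -> : kappa p i l s eps Theta c =
    \sum_(1 <= u < p) (Theta u)%:Z * (occ p (u.-1)%:Z u c)%:Z
    - (occ p (t 0).-1 (chain_dim p s o t) c)%:Z.
  rewrite /kappa [in RHS]big_ltn ?(ltnW p3) //; congr (_ * _ + _ - _).
  - by rewrite theta_occ.
  - apply: eq_big_nat => u u2; rewrite theta_simple //; lia.
  rewrite Lval_dim theta_occ //; congr Posz; apply: occ_eq; rewrite aval_weight.
  have /andP[d0 _] := chain_dim_range p_odd p_pr s0 t_range t_soc t_top.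
  by congr ((_ + _) %% _)%Z; lia.
under eq_big_nat => u up do rewrite ThetaE //.
rewrite sum_count_mem => [|u /mapP[q]]; last first.
  by rewrite mem_iota => qs ->; apply: t_range; lia.
rewrite big_map (_ : iota 0 s = index_iota 0 s) ?big_mkord; last first.
  by rewrite /index_iota subn0.
rewrite -(big_morph Posz PoszD (erefl _)) (chain_occ p_odd p_pr s0 t_range t_soc t_top).
rewrite PoszD addrC addKr (big_morph Posz PoszD (erefl _)).
apply: eq_big_seq => q; rewrite mem_chain_tops // => /and3P[_ qs _].
rewrite theta_occ //; congr Posz; apply: occ_eq; apply/eqP; rewrite eqz_mod_dvd.
by apply/dvdzP; exists (-2); lia.
Qed.

Lemma ncp_tops c : (c < p - 1)%N -> ncp p i l s eps Theta c =
  (count (fun q => (t q).-1 == c) (chain_tops s o))%:R.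
Proof.
have p3 := p_gt2 p_odd p_pr => cp; rewrite /ncp.
have topP q : q \in chain_tops s o -> ((t q).-1 < p - 1)%N /\ odd (t q).-1 = odd i.
  rewrite mem_chain_tops // => /and3P[_ qs _]; have := t_odd qs.
  have := t_range qs; case: (t q) => //= d dp dE; split; first by lia.
  by move: dE; case: (odd d); case: (odd i).
have [ci|/negPn/eqP ci] := ifPn.
  rewrite (eq_in_count (a2 := pred0)) ?count_pred0 // => q /topP[_ /= tq].
  by apply: contraNF ci => /eqP<-; apply/eqP.
rewrite -sum1_count natr_sum [RHS]big_mkcond /=.
under eq_bigr => j _.
  rewrite kappa_tops rmorph_sum mulr_sumr.
  over.
rewrite exchange_big /=; apply: eq_big_seq => q /topP[dp tq].
by rewrite delta_theta //; case: eqP.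
Qed.

End Multiplicities.

(** * The orientation of the walk *)

Section Orientation.
Variables (p i l s : nat) (eps : int).
Hypotheses (p_odd : odd p) (p_pr : prime p) (Hi : (i <= 1)%N)
  (s0 : (0 < s)%N) (Hls : (l + s <= p - 1)%N).

(** A direction of reading in which every top is linked to its predecessor with
    sum [p + 1] and to its successor with sum [p - 1]. The walk is read forwards
    if its first edge is a top linked to the second one with sum [p - 1], or a
    socle linked with sum [p + 1]; otherwise its last edge has this property. *)
Definition forward : bool := inD eps 1 == (odd l.+1 != odd i).
Definition edge_idx (q : nat) : nat := if forward then q.+1 else (s - q)%N.
Definition link_idx (q : nat) : nat := if forward then q.+1 else (s - q.+1)%N.
Definition top_first : bool := inD eps (edge_idx 0).

Let t q := walk p i l (edge_idx q).
Let o := top_first.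

Lemma inD_odd k : inD eps k = (odd k == (eps == 1)).
Proof. by rewrite /inD; case: (eps == 1); case: (odd k). Qed.

Lemma edge_idx_range q : (q < s)%N -> (0 < edge_idx q <= s)%N.
Proof. by move=> qs; rewrite /edge_idx; case: forward; clear -qs; lia. Qed.

Lemma edge_idx_inD q : (q < s)%N -> inD eps (edge_idx q) = (odd q != o).
Proof.
rewrite /o /top_first /edge_idx !inD_odd subn0; case: forward => qs; last first.
  by rewrite oddB ?(ltnW qs) //; case: (odd q); case: (odd s); case: (eps == 1).
by rewrite /=; case: (odd q); case: (eps == 1).
Qed.

Lemma link_idx_linkd q : (q.+1 < s)%N -> linkd i l (link_idx q) = (odd q == o).
Proof.
move=> qs; rewrite /linkd /o /top_first /link_idx /edge_idx !inD_odd subn0.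
have -> : odd (l + (if forward then q.+1 else s - q.+1))%N =
    odd l (+) (if forward then ~~ odd q else odd s (+) ~~ odd q).
  by case: forward; rewrite oddD ?oddB // ltnW.
case E: forward; move: E; rewrite /forward inD_odd /=; case: (odd q); case: (odd l);
  by case: (odd i); case: (eps == 1); case: (odd s).
Qed.

(** All the factors belong to the block of parity [i]. *)
Lemma walk_odd k : (0 < k <= s)%N -> odd (walk p i l k) != odd i.
Proof.
move=> ks; rewrite (walkE i p_odd p_pr Hls ks); case: ifP => //; move: ks.
by clear -p_odd Hls; lia.
Qed.

Lemma edge_dim_sum q : (q.+1 < s)%N -> (t q + t q.+1 = p.-1 + 2 * (odd q == o))%N.
Proof.
move=> qs; rewrite -link_idx_linkd // /t /edge_idx /link_idx.
case: forward; first by rewrite (walk_link i p_odd p_pr Hls).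
rewrite -(walk_link i p_odd p_pr Hls); last by lia.
by rewrite addnC; congr (_ + walk _ _ _ _)%N; lia.
Qed.

Lemma first_edge_dim : t 0 = (if forward then if o then l.+1 else p - l - 1
                   else if o then p - l - s else l + s)%N.
Proof.
rewrite /t (walkE i p_odd p_pr Hls (edge_idx_range s0)) /o /top_first inD_odd /edge_idx subn0.
case E: forward; move: E; rewrite /forward inD_odd /= oddD /=;
  case: (odd l); case: (odd i); case: (odd s); case: (eps == 1) => //= _; lia.
Qed.

Lemma Lval_chain_dim : Lval p i l s = (chain_dim p s o t)%:Z.
Proof.
have p3 := p_gt2 p_odd p_pr.
rewrite /chain_dim first_edge_dim /o /top_first /edge_idx inD_odd subn0 /Lval.
have i01 : i = 0%N \/ i = 1%N by case: i Hi => [|[|]] //; [left | right].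
case E: forward; move: E; rewrite /forward inD_odd; case: i01 => -> /=;
  case: (boolP (odd l)) => ol; case: (boolP (odd s)) => os; case: (eps == 1) => //= _;
  lia.
Qed.

(** For [s >= 2], on each line of the table the difference of the two sides is
    [p - 1] times a constant between [-2] and [2]. *)
Lemma aval_first_weight :
  ((t 0).-1%:Z = aval p i l s eps + (2 * (chain_dim p s o t).-1)%N%:Z %[mod p.-1])%Z.
Proof.
have p3 := p_gt2 p_odd p_pr; have LE := Lval_chain_dim.
have i01 : i = 0%N \/ i = 1%N by case: i Hi => [|[|]] //; [left | right].
apply/eqP; rewrite eqz_mod_dvd; apply/dvdzP.
have [s1|s1] := eqVneq s 1%N.
  have dE : chain_dim p s o t = t 0 by rewrite /chain_dim s1 /= addn0 subn0; case: (o).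
  have t1 : t 0 = walk p i l 1 by rewrite /t /edge_idx s1; case: forward.
  have tr : (0 < t 0 < p)%N.
    by rewrite t1; apply: (walk_gt0 i p_odd p_pr Hls); rewrite s0.
  rewrite /aval LE dE -t1 (introT eqP s1); case: eqP => [->|_]; first by exists 0.
  by exists (-1); lia.
rewrite /aval (negPf s1) /chain_dim first_edge_dim /o /top_first /edge_idx inD_odd subn0 {LE}.
case E: forward; move: E; rewrite /forward inD_odd; case: i01 => -> /=;
  have [l0|l0] := eqVneq l 0%N; case: (boolP (odd l)) => ol;
  case: (boolP (odd s)) => os; case: (eps == 1) => //= _;
  (case: ifPn => S1; [|case: ifPn => S2]) => /=;
  first [by exists 0; lia | by exists 1; lia | by exists (-1); lia
        | by exists 2; lia | by exists (-2); lia].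
Qed.

End Orientation.

(** * The restriction of a string module *)

Lemma sum_count_fibres (T : eqType) (m : nat) (f : T -> nat) (r : seq T) :
  {in r, forall q, f q < m}%N ->
  (\sum_(d < m) count (fun q => f q == d) r = size r)%N.
Proof.
elim: r => [|q r IH] fm; first by rewrite big1.
rewrite /= -IH => [|q' q'r]; last by apply: fm; rewrite inE q'r orbT.
rewrite big_split /= -add1n; congr (_ + _)%N.
rewrite (bigD1 (Ordinal (fm q (mem_head q r)))) //= eqxx big1 // => d.
by rewrite -val_eqE /= eq_sym => /negPf->.
Qed.

(** The presentation of a string module, read along the orientation of its walk,
    satisfies the hypotheses on chains. *)
Section Reading.
Variables (i l s : nat) (eps : int).
Local Notation edge := (edge_idx i l s eps).
Local Notation link := (link_idx i l s eps).
Local Notation o := (top_first i l s eps).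

Lemma edge_idx_perm : perm_eq [seq edge q | q <- iota 0 s] (iota 1 s).
Proof.
rewrite /edge_idx; case: forward; first by rewrite -[1%N]/(1 + 0)%N iotaDl.
have -> : [seq (s - q)%N | q <- iota 0 s] = rev (iota 1 s); last by rewrite perm_rev.
apply: (@eq_from_nth _ 0%N) => [|k]; rewrite size_map ?size_rev !size_iota // => ks.
rewrite (nth_map 0%N) ?size_iota // nth_rev ?size_iota // !nth_iota //; lia.
Qed.

Lemma sum_two_links (V : nmodType) (k : nat) (f : nat -> V) : (0 < k <= s)%N ->
  \sum_(a < s | (0 < a)%N && ((a == k.-1 :> nat) || (a == k :> nat))) f a =
  (if (0 < k.-1)%N then f k.-1 else 0) + (if (k < s)%N then f k else 0).
Proof.
move=> ks; rewrite -(big_mkord (fun a => (0 < a)%N && ((a == k.-1) || (a == k))) f).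
rewrite big_mkcond /=.
under eq_bigr => a _.
  have -> : (if (0 < a)%N && ((a == k.-1) || (a == k)) then f a else 0) =
    (if k.-1 == a then if (0 < a)%N then f a else 0 else 0) + (if k == a then f a else 0).
    have [->|ka] := eqVneq a k.-1.
      by rewrite andbT (_ : k == k.-1 = false) ?addr0 //; lia.
    rewrite add0r [k == a]eq_sym; case: eqP => [->|]; rewrite ?andbF //.
    by case/andP: ks => ->.
  over.
rewrite big_split /= big_nat_pred1; last by lia.
congr (_ + _); case: ifPn => sk; first by rewrite big_nat_pred1.
rewrite big_nat big1 // => a a1; case: eqP => // ka; lia.
Qed.

Variables (p : nat) (F : fieldType).
Hypotheses (p_odd : odd p) (p_pr : prime p) (chF : p \in [pchar F]).
Hypotheses (Hi : (i <= 1)%N) (s0 : (0 < s)%N) (Hls : (l + s <= p - 1)%N).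
Local Notation t q := (walk p i l (edge q)).
Variables (n : nat) (rM : mx_representation F (SL2 p) n).
Variables (x : nat -> 'rV[F]_n) (c : nat -> F).
Hypothesis pres : string_presentation i l s eps rM x c.
Local Notation rB := (subg_repr rM (borel_sub p)).
Local Notation N := (nilop rB).

Lemma presentation_full : (1%:M <= \sum_(q < s) <<orbmx N (x (edge q)) (t q)>>)%MS.
Proof.
apply: submx_trans (sp_full pres) _; apply/sumsmx_subP => k k0.
have ks := ltn_ord k; pose q := (if forward i l eps then k.-1 else s - k)%N.
have qs : (q < s)%N by rewrite /q; case: forward; lia.
have -> : (k : nat) = edge q by rewrite /edge_idx /q; case: forward; lia.
exact: (sumsmx_sup (Ordinal qs)).
Qed.

(** Reading the walk backwards exchanges the two neighbours of a top. *)
Lemma presentation_top q : (q < s)%N -> odd q != o ->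
  x (edge q) *m N ^+ t q =
    (if (0 < q)%N then c (link q.-1) *: (x (edge q.-1) *m N) else 0) +
    (if (q.+1 < s)%N then c (link q) *: x (edge q.+1) else 0).
Proof.
move=> qs qo; have er := edge_idx_range i l eps qs.
rewrite (sp_top pres er) ?edge_idx_inD //.
rewrite (@sum_two_links _ _ (fun a => c a *: (x (soc_idx eps a) *m N ^+ linkd i l a))) //.
have next : (q.+1 < s)%N ->
    c (link q) *: (x (soc_idx eps (link q)) *m N ^+ linkd i l (link q)) =
    c (link q) *: x (edge q.+1).
  move=> q1s; rewrite link_idx_linkd // (negPf qo) expr0 mulmx1; congr (_ *: x _).
  have := edge_idx_inD i l eps qs; rewrite qo /soc_idx.
  rewrite /edge_idx /link_idx; case: forward => [-> //|].
  rewrite (_ : s - q = (s - q.+1).+1)%N; last by lia.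
  by rewrite inDS => /negPf->.
have prev : (0 < q)%N ->
    c (link q.-1) *: (x (soc_idx eps (link q.-1)) *m N ^+ linkd i l (link q.-1)) =
    c (link q.-1) *: (x (edge q.-1) *m N).
  move=> q0; have qE := prednK q0; rewrite link_idx_linkd ?qE //.
  have -> : odd q.-1 == o by move: qo; rewrite -{1}qE /=; case: (odd _); case: (o).
  rewrite expr1; congr (_ *: (x _ *m _)).
  have := edge_idx_inD i l eps qs; rewrite qo /soc_idx.
  rewrite /edge_idx /link_idx; case: forward; rewrite qE; last by move=> ->; lia.
  by rewrite inDS => /negPf->.
case fE: (forward i l eps).
  have -> : (0 < (edge q).-1)%N = (0 < q)%N by rewrite /edge_idx fE.
  have -> : (edge q < s)%N = (q.+1 < s)%N by rewrite /edge_idx fE.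
  have -> : edge q = link q by rewrite /edge_idx /link_idx fE.
  congr (_ + _); [case: ifP => // q0 | by case: ifP => // /next].
  by rewrite -prev // /link_idx fE prednK.
have -> : (0 < (edge q).-1)%N = (q.+1 < s)%N by rewrite /edge_idx fE; lia.
have -> : (edge q < s)%N = (0 < q)%N by rewrite /edge_idx fE; lia.
have -> : (edge q).-1 = link q by rewrite /edge_idx /link_idx fE subnS.
rewrite addrC; congr (_ + _); [case: ifP => // q0 | by case: ifP => // /next].
by rewrite -prev // /edge_idx /link_idx fE prednK.
Qed.

End Reading.

Theorem theorem5p8 (p : nat) (F : closedFieldType)
    (p_odd : odd p) (p_prime : prime p) (chF : p \in [pchar F])
    (i l s : nat) (eps : int)
    (Hi : (i <= 1)%N) (Hl : (l <= (p - 3)./2)%N) (Hs : (1 <= s <= p - 1)%N)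
    (Heps : eps = 1 \/ eps = -1) (Hls : (l + s <= p - 1)%N)
    (n : nat) (rM : mx_representation F (SL2 p) n)
    (HM : is_M chF i l s eps rM)
    (Theta : nat -> nat)
    (HTheta : forall t : nat, (1 <= t <= p - 1)%N ->
       comp_mult rM (Vmod chF t) (Theta t)) :
  exists (b : nat) (UL : mx_representation F (borel p) b)
         (Up : 'I_(p - 1) -> mx_representation F (borel p) p)
         (mult : 'I_(p - 1) -> nat),
    [/\ b%:Z = Lval p i l s,
        is_U chF (aval p i l s eps) b UL,
        (forall c : 'I_(p - 1), is_U chF c%:Z p (Up c)),
        (forall c : 'I_(p - 1), (mult c)%:R = ncp p i l s eps Theta c)
      & mx_rsim (subg_repr rM (borel_sub p))
          (dadd_grepr (Representation UL)
             (\big[dadd_grepr/grepr0]_(c < p - 1)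
                 muln_grepr (Representation (Up c)) (mult c)))].
Proof.
have /andP[s0 _] := Hs; clear Hl Hs Heps.
have [[x [c pres]] [ks ksP fac]] :=
  @string_module_presentation p F p_odd p_prime chF i l s eps n rM s0 Hls HM.
pose t q := walk p i l (edge_idx i l s eps q).
pose o := top_first i l s eps.
have range q : (q < s)%N -> (0 < edge_idx i l s eps q <= s)%N.
  exact: edge_idx_range.
have t_range q : (q < s)%N -> (0 < t q < p)%N.
  by move=> qs; apply: (walk_gt0 i p_odd p_prime Hls (range q qs)).
have t_sum q : (q.+1 < s)%N -> (t q + t q.+1 = p.-1 + 2 * (odd q == o))%N.
  exact: edge_dim_sum.
have t_soc q : (q.+1 < s)%N -> odd q = o -> (t q + t q.+1 = p.+1)%N.
  move=> qs qo; rewrite t_sum // qo eqxx muln1 addn2.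
  by rewrite (prednK (prime_gt0 p_prime)).
have t_top q : (q.+1 < s)%N -> odd q != o -> (t q + t q.+1 = p.-1)%N.
  by move=> qs /negPf qo; rewrite t_sum // qo muln0 addn0.
have LE : Lval p i l s = (chain_dim p s o t)%:Z by apply: Lval_chain_dim.
have aE := @aval_first_weight p i l s eps p_odd p_prime Hi s0 Hls.
have ksE : perm_eq [seq walk p i l k | k <- ks] [seq t q | q <- iota 0 s].
  apply: perm_trans (perm_map _ ksP) _; rewrite perm_sym.
  by rewrite (map_comp (walk p i l)) perm_map // edge_idx_perm.
have ThetaE u : (0 < u < p)%N -> Theta u = count_mem u [seq t q | q <- iota 0 s].
  move=> up; rewrite -(seq.permP ksE); apply: (@comp_mult_count _ _ chF _ rM).
    by rewrite -map_comp.
  by apply: HTheta; lia.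
have /andP[d0 dp] := chain_dim_range p_odd p_prime s0 t_range t_soc t_top.
pose Mult (c : 'I_(p - 1)) := count (fun q => (t q).-1 == c) (chain_tops s o).
exists (chain_dim p s o t), (Umod chF (aval p i l s eps) (chain_dim p s o t)),
  (fun c : 'I_(p - 1) => Umod chF c%:Z p), Mult; split=> //.
- exact: Umod_is_U.
- by move=> d; apply: Umod_is_U.
- move=> d; rewrite (ncp_tops p_odd p_prime s0 Hi t_range t_soc t_top _ ThetaE LE aE) //.
  by move=> q qs; exact: (walk_odd i p_odd p_prime Hls (range q qs)).
apply: covers_rsim.
  have cc := @chain_covers p F p_odd p_prime chF n (subg_repr rM (borel_sub p)) s o t (fun q => x (edge_idx i l s eps q))
    (fun q => c (link_idx i l s eps q)) s0 t_range t_soc t_top.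
  apply: cc => //.
  - by move=> q qs; apply: (sp_weight pres (range q qs)).
  - move=> q qs qo; apply: (sp_soc pres (range q qs)).
    by rewrite edge_idx_inD // qo eqxx.
  - by move=> q qs qo; apply: presentation_top.
  - by move=> q qs; apply: (sp_coef pres); rewrite /link_idx; case: forward; lia.
  by apply: presentation_full pres.
rewrite /= rdegree_big; under eq_bigr => d _.
  rewrite /muln_grepr rdegree_big sum_nat_const card_ord.
  over.
rewrite /= -big_distrl /=.
have -> : (\sum_(d < p - 1) Mult d = size (chain_tops s o))%N.
  apply: (@sum_count_fibres _ _ (fun q => (t q).-1)) => q; rewrite mem_chain_tops //.
  by case/and3P=> _ qs _; have := t_range _ qs; lia.
rewrite -(chain_dim_sum p_odd p_prime s0 t_range t_soc t_top) -(has_factors_dim fac).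
rewrite size_map; under [RHS]eq_bigr => k _ do rewrite (nth_map 0%N) //=.
have -> : (\sum_(k < size ks) walk p i l (nth 0 ks k) =
    \sum_(u <- [seq walk p i l k | k <- ks]) u)%N.
  by rewrite big_map (big_nth 0%N) big_mkord.
rewrite (perm_big _ ksE) big_map -(big_mkord xpredT t) /index_iota subn0.
by [].
Qed.
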